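(* Let $X$ be a Tychonoff space. The space $P(X)$ is $C^*$-embedded in $P(\beta X)$ (i.e., $\beta P(X)=P(\beta X)$) if and only if $P(X)$ is pseudocompact. In this case, $X^n$ is pseudocompact for all $n\in\mathbb N$.
   Context: $\beta X$ is the Stone–Čech compactification of $X$. For a Tychonoff space $Z$, $P(Z)$ is the set of Radon probability measures on the Borel $\sigma$-algebra of $Z$ (for every Borel $B$ and $\varepsilon>0$ there is a compact $K\subset B$ with $\mu(B\setminus K)<\varepsilon$), with the weak topology, i.e. the topology generated by the functions $\mu\mapsto\int_Z f\,d\mu$ for bounded continuous $f:Z\to\mathbb R$. $P(X)$ is regarded as a subspace of the compact space $P(\beta X)$ via push-forward along the inclusion $X\subset\beta X$; it is identified with the set of $\mu\in P(\beta X)$ with $\mu(S)=1$ for some $\sigma$-compact $S\subset X$. A space is pseudocompact if every continuous real-valued function on it is bounded. A subspace $Y\subset Z$ is $C^*$-embedded in $Z$ if every bounded continuous function $Y\to\mathbb R$ extends to a continuous function on $Z$. The equality $\beta P(X)=P(\beta X)$ means that the continuous extension $\beta P(X)\to P(\beta X)$ of the embedding $P(X)\to P(\beta X)$ is a homeomorphism. *)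

(* Defs.v *)
From HB Require Import structures.
From mathcomp Require Import all_boot all_order all_algebra.
From mathcomp Require Import all_classical all_reals all_analysis.

Set Implicit Arguments.
Unset Strict Implicit.
Unset Printing Implicit Defensive.

Import Order.TTheory GRing.Theory Num.Theory.
Import numFieldNormedType.Exports.

Local Open Scope classical_set_scope.
Local Open Scope ring_scope.

Definition tychonoff_space (X : topologicalType) : Prop :=
  completely_regular_space X /\ hausdorff_space X.

Definition pseudocompact (R : realType) (X : topologicalType) : Prop :=
  forall f : X -> R, continuous f -> bounded_fun f.

Definition Cstar_embedded (R : realType) (Z : topologicalType) (Y : set Z) :
    Prop :=
  forall f : Y -> R, continuous f -> bounded_fun f ->
    exists2 g : Z -> R, continuous g & forall y : Y, g (set_val y) = f y.

Definition homeomorphism (Y Z : topologicalType) (h : Y -> Z) : Prop :=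
  continuous h /\ exists g : Z -> Y, [/\ continuous g, cancel h g & cancel g h].

Definition Cb (R : realType) (Z : topologicalType) : set (Z -> R) :=
  [set f | continuous f /\ bounded_fun f].
Arguments Cb : clear implicits.

(* Cech's construction of the Stone-Cech compactification: the closure of the
   image of [X] under the evaluation map into the product of copies of [R]
   indexed by the bounded continuous functions on [X]. *)

Section stone_cech.
Context (R : realType) (X : topologicalType).

Definition evaluation (x : X) : {ptws Cb R X -> R} :=
  fun f => (set_val f : X -> R) x.

Definition stone_cech : Type :=
  set_type (closure (range evaluation)).

HB.instance Definition _ := Topological.on stone_cech.

Definition stone_cech_unit (x : X) : stone_cech :=
  SigSub (mem_set (subset_closure (imageT evaluation x))).

Lemma evaluation_continuous : continuous evaluation.
Proof.
move=> x; apply/cvg_sup => f A [_ [[B oB <-] Bx BA]].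
have [cf _] := set_valP f.
apply: filterS BA _; apply: cf; exact: open_nbhs_nbhs.
Qed.

Lemma stone_cech_unit_continuous : continuous stone_cech_unit.
Proof.
move=> x A [_ [[B oB <-] Bx BA]].
by apply: filterS BA _; apply: evaluation_continuous; exact: open_nbhs_nbhs.
Qed.

Lemma stone_cech_hausdorff : hausdorff_space stone_cech.
Proof.
move=> p q pq; apply: val_inj.
have hprod := @hausdorff_product _ (fun _ : Cb R X => R)
  (fun=> @Rhausdorff R).
apply: hprod => A B nA nB.
pose v : stone_cech -> {ptws Cb R X -> R} := set_val.
have cv : continuous v by exact: initial_continuous.
by have [r [Ar Br]] := pq _ _ (cv p A nA) (cv q B nB); exists (v r).
Qed.

End stone_cech.

Arguments stone_cech_unit {R X} x.

(* Measurable types are pointed.  The point used here is chosen from a proof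
   that the space is nonempty, hence does not depend on the proof; neither the
   sigma-algebra nor the integral depends on it. *)

Section borel.
Context (Z : topologicalType) (Z0 : [set: Z] !=set0).

Definition pointed_copy : Type := let _ := Z0 in Z.

HB.instance Definition _ := Choice.on pointed_copy.
HB.instance Definition _ := isPointed.Build pointed_copy (sval (cid Z0)).

Definition borel : Type :=
  g_sigma_algebraType (@open Z : set (set pointed_copy)).

HB.instance Definition _ := Measurable.on borel.

End borel.

Section radon.
Context (R : realType) (Z : topologicalType).

(* A [probability] is a function defined on all subsets of [Z], with
   unconstrained values outside the sigma-algebra.  [radon_normal] fixes these
   values to 0, so that two elements of [radon_prob] are equal as soon as they
   agree on Borel sets.  There is no probability measure on an empty space, so
   [radon_nonempty] is no restriction.  In a Hausdorff space every compact set
   is Borel, so there [measurable K] in [radon_regular] is redundant. *)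
Record radon_prob : Type := RadonProb {
  radon_nonempty : [set: Z] !=set0 ;
  radon_measure :> probability (borel radon_nonempty) R ;
  radon_regular : forall (B : set (borel radon_nonempty)) (e : R),
    measurable B -> 0 < e ->
    exists K : set (borel radon_nonempty),
      [/\ compact (K : set Z), measurable K, K `<=` B
        & (radon_measure (B `\` K) < e%:E)%E] ;
  radon_normal : forall B : set (borel radon_nonempty),
    ~ measurable B -> radon_measure B = 0%E
}.

HB.instance Definition _ := gen_eqMixin radon_prob.
HB.instance Definition _ := gen_choiceMixin radon_prob.

Definition integrals (mu : radon_prob) : {ptws Cb R Z -> R} :=
  fun f => \int[radon_measure mu]_z (set_val f : Z -> R) z.

(* the coarsest topology making all [mu |-> \int f d mu], [f] bounded and
   continuous, continuous *)
HB.instance Definition _ :=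
  Topological.copy radon_prob (initial_topology integrals).

End radon.

Section pushforward.
Context (R : realType) (Y Z : topologicalType) (f : Y -> Z).
Hypotheses (cf : continuous f) (hZ : hausdorff_space Z).
Variable mu : radon_prob R Y.

Lemma radon_push_nonempty : [set: Z] !=set0.
Proof. by have [y _] := radon_nonempty mu; exists (f y). Qed.

Local Notation BY := (borel (radon_nonempty mu)).
Local Notation BZ := (borel radon_push_nonempty).

Lemma borel_preimage (B : set BZ) :
  measurable B -> measurable (f @^-1` B : set BY).
Proof.
move=> mB; rewrite -[X in measurable X]setTI.
suff mf : measurable_fun setT (f : BY -> BZ) by exact: mf.
apply: (measurability (@open Z : set (set BZ))) => // _ [A oA <-].
rewrite setTI; apply: sub_sigma_algebra.
by move/continuousP : cf; apply.
Qed.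

Definition radon_push_measure (B : set BZ) : \bar R :=
  if pselect (measurable B) is left _ then
    pushforward (radon_measure mu) (f : BY -> BZ) B
  else 0%E.

Lemma radon_push_measureE (B : set BZ) : measurable B ->
  radon_push_measure B = radon_measure mu (f @^-1` B).
Proof. by rewrite /radon_push_measure; case: pselect. Qed.

Let push0 : radon_push_measure set0 = 0%E.
Proof. by rewrite radon_push_measureE// preimage_set0; exact: measure0. Qed.

Let push_ge0 B : (0 <= radon_push_measure B)%E.
Proof.
rewrite /radon_push_measure; case: pselect => // mB.
exact: (measure_ge0 (radon_measure mu)).
Qed.

Let push_sigma_additive : semi_sigma_additive radon_push_measure.
Proof.
move=> F mF tF mUF; rewrite radon_push_measureE//.
under eq_fun do under eq_bigr do rewrite (radon_push_measureE (mF _)).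
rewrite preimage_bigcup.
apply: measure_semi_sigma_additive.
- by move=> n; exact: borel_preimage.
- apply/trivIsetP => /= i j _ _ ij; rewrite -preimage_setI.
  by move/trivIsetP : tF => /(_ _ _ _ _ ij) ->//; rewrite preimage_set0.
- by rewrite -preimage_bigcup; exact: borel_preimage.
Qed.

HB.instance Definition _ := isMeasure.Build _ _ _ radon_push_measure
  push0 push_ge0 push_sigma_additive.

Let push_setT : radon_push_measure setT = 1%E.
Proof. by rewrite radon_push_measureE// preimage_setT; exact: probability_setT. Qed.

HB.instance Definition _ :=
  Measure_isProbability.Build _ _ _ radon_push_measure push_setT.

Lemma radon_push_regular (B : set BZ) (e : R) : measurable B -> 0 < e ->
  exists K : set BZ,
    [/\ compact (K : set Z), measurable K, K `<=` B
      & (radon_push_measure (B `\` K) < e%:E)%E].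
Proof.
move=> mB e0.
have [K [cK mK KB Ke]] := radon_regular (borel_preimage mB) e0.
have cfK : compact (f @` K).
  by apply: continuous_compact cK; exact: continuous_subspaceT.
have mfK : measurable (f @` K : set BZ).
  rewrite -[X in measurable X]setCK; apply: measurableC.
  by apply: sub_sigma_algebra; apply/closed_openC/(compact_closed hZ cfK).
exists (f @` K); split => //.
  by move=> _ [y Ky <-]; exact: KB.
rewrite radon_push_measureE; last exact: measurableD.
apply: le_lt_trans Ke; apply: le_measure; rewrite ?inE.
- by apply: borel_preimage; exact: measurableD.
- by apply: measurableD => //; exact: borel_preimage.
- by move=> y [Bfy nKy]; split => // Ky; apply: nKy; exists y.
Qed.

Definition radon_push : radon_prob R Z.
Proof.
refine (@RadonProb R Z radon_push_nonempty radon_push_measure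
  radon_push_regular _).
by move=> B nB; rewrite /= /radon_push_measure; case: pselect.
Defined.

End pushforward.

Definition radon_embedding (R : realType) (X : topologicalType) :
    radon_prob R X -> radon_prob R (stone_cech R X) :=
  radon_push (@stone_cech_unit_continuous R X) (@stone_cech_hausdorff R X).
Arguments radon_embedding : clear implicits.

(* The extension [h] is unique: the image of [stone_cech_unit] is dense and
   [radon_prob R (stone_cech R X)] is Hausdorff. *)
Definition beta_radon_eq (R : realType) (X : topologicalType) : Prop :=
  exists2 h : stone_cech R (radon_prob R X) -> radon_prob R (stone_cech R X),
    homeomorphism h &
    forall mu : radon_prob R X, h (stone_cech_unit mu) = radon_embedding R X mu.

(* Main.v *)
(* Let E = P(X) be pseudocompact.  Given finitely supported measures s_n on a
   finite power X^I, with each coordinate of each atom surrounded by an open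
   set, put in E the open set of all measures giving these open sets about the
   average mass prescribed by the marginals of s_n.  A cluster point of these
   open sets, split along the open sets and recombined by products, yields a
   Radon measure on X^I which is a cluster point of measures spread over the
   boxes of s_n ([coupling_cluster]); it is tight because its marginals are
   dominated by a multiple of an element of E.  With one-point s_n, a point of
   its support shows that X^I is pseudocompact.

   Let f : E -> R be continuous.  Since E x E is pseudocompact, a Glicksberg-type
   argument shows that d(x, y) = sup |f((1-t)b + t delta_x) - f((1-t)b + t delta_y)|,
   the supremum being over t and b, is a continuous totally bounded
   pseudometric on X.  If two finitely supported measures are coupled along
   pairs of points at d-distance less than eta, with eta small, then f is nearly
   the same on both: otherwise a cluster point of couplings would be a measure
   on {d = 0} whose marginals are separated by f, while approximating it by
   finitely supported measures on {d = 0} and swapping one atom at a time shows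
   that f takes the same value on the marginals.  Hence f is uniformly
   approximated by f(sum_i mu(h_i) delta_(x_i)) for partitions of unity (h_i)
   subordinate to small d-balls around the x_i, and these functions of mu make
   sense and are continuous on P(beta X).

   Conversely, if bounded continuous functions extend to the compact space
   P(beta X), then cos f and sin f vary uniformly little along short pieces of
   the segments from a fixed u to x, which bounds the increment of f along
   each piece by pi and hence f itself. *)

From HB Require Import structures.
Require Import Defs.
From mathcomp Require Import all_boot all_order all_algebra.
From mathcomp Require Import all_classical all_reals all_analysis.
From mathcomp Require Import ring lra.

Set Implicit Arguments.
Unset Strict Implicit.
Unset Printing Implicit Defensive.

Import Order.TTheory GRing.Theory Num.Theory.
Import numFieldNormedType.Exports.

Local Open Scope classical_set_scope.
Local Open Scope ring_scope.

(** On the compact space P(beta X) limits of measures always exist, but they may leave P(X).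
    Pseudocompactness of E only provides cluster points of sequences of open sets, yet such a point
    is a Radon measure on X; hence limits are taken along filters built from open sets, and whatever
    tightness they have is borrowed from that point. It is moreover a property of E alone, and
    pseudocompactness is not productive in general. Averaging the marginals with equal weights
    brings all coordinates into a single element of E; the open sets around the atoms allow the
    coordinates to be told apart again afterwards. These conditions being open and finitely
    supported measures being dense, every recombination is a finite sum and no product measure is
    needed. The limits arise as functionals on bounded continuous functions, hence the Riesz
    representation for tight functionals. In the converse, pi is the increment at which cos and sin
    both change sign: as they are never both small, one of them then jumps by a fixed amount. *)

(** * Bounded continuous functions and separation *)

Section bounded_continuous.
Context {R : realType} {Y : topologicalType}.
Implicit Types f g : Y -> R.

Lemma continuous_epsP f :
  continuous f <-> forall x e, 0 < e -> \forall y \near x, `|f y - f x| < e.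
Proof.
split=> [cf x e e0|cf x].
  by have /cvgrPdistC_lt := cf x; apply.
by apply/cvgrPdistC_lt => e e0; exact: cf.
Qed.

Lemma bounded_funP (T : Type) (f : T -> R) :
  bounded_fun f <-> exists M, forall x, `|f x| <= M.
Proof.
split=> [[M [_ bM]]|[M bM]].
  by exists (M + 1) => x; apply: bM => //; rewrite ltrDl.
exists M; split; first exact: num_real.
by move=> N MN x _ /=; rewrite (le_trans (bM x))// ltW.
Qed.

Lemma CbP f : Cb R Y f <-> continuous f /\ exists M, forall x, `|f x| <= M.
Proof. by split=> -[cf /bounded_funP bf]; split. Qed.

Lemma Cb_continuous f : Cb R Y f -> continuous f.
Proof. by case. Qed.

Lemma Cb_ex f : Cb R Y f -> exists2 M, 0 < M & forall x, `|f x| <= M.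
Proof.
move=> /CbP[_ [M bM]]; exists (`|M| + 1); first by rewrite ltr_wpDl.
by move=> x; rewrite (le_trans (bM x))// (le_trans (ler_norm _))// lerDl.
Qed.

Lemma Cb_cst (c : R) : Cb R Y (fun=> c).
Proof. by apply/CbP; split; [exact: cst_continuous|exists `|c|]. Qed.

Lemma Cb_add f g : Cb R Y f -> Cb R Y g -> Cb R Y (fun x => f x + g x).
Proof.
move=> /CbP[cf [M fM]] /CbP[cg [N gN]]; apply/CbP; split.
  by move=> x; apply: cvgD; [exact: cf|exact: cg].
by exists (M + N) => x; rewrite (le_trans (ler_normD _ _))// lerD.
Qed.

Lemma Cb_mul f g : Cb R Y f -> Cb R Y g -> Cb R Y (fun x => f x * g x).
Proof.
move=> /CbP[cf [M fM]] /CbP[cg [N gN]]; apply/CbP; split.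
  by move=> x; apply: cvgM; [exact: cf|exact: cg].
by exists (M * N) => x; rewrite normrM ler_pM.
Qed.

Lemma Cb_scale (c : R) f : Cb R Y f -> Cb R Y (fun x => c * f x).
Proof. by apply: Cb_mul; exact: Cb_cst. Qed.

Lemma Cb_opp f : Cb R Y f -> Cb R Y (fun x => - f x).
Proof.
move=> /CbP[cf [M fM]]; apply/CbP; split.
  by move=> x; apply: cvgN; exact: cf.
by exists M => x; rewrite normrN.
Qed.

Lemma Cb_sub f g : Cb R Y f -> Cb R Y g -> Cb R Y (fun x => f x - g x).
Proof. by move=> bf bg; apply: Cb_add => //; exact: Cb_opp. Qed.

Lemma Cb_norm f : Cb R Y f -> Cb R Y (fun x => `|f x|).
Proof.
move=> /CbP[cf [M fM]]; apply/CbP; split.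
  by move=> x; apply: cvg_norm; exact: cf.
by exists M => x; rewrite normr_id.
Qed.

Lemma Cb_max f g : Cb R Y f -> Cb R Y g -> Cb R Y (fun x => Num.max (f x) (g x)).
Proof.
move=> bf bg; have := Cb_scale (2^-1) (Cb_add (Cb_add bf bg) (Cb_norm (Cb_sub bf bg))).
by congr (Cb R Y _); apply/funext => x; rewrite maxr_absE mulrC.
Qed.

Lemma Cb_min f g : Cb R Y f -> Cb R Y g -> Cb R Y (fun x => Num.min (f x) (g x)).
Proof.
move=> bf bg; have := Cb_scale (2^-1) (Cb_sub (Cb_add bf bg) (Cb_norm (Cb_sub bf bg))).
by congr (Cb R Y _); apply/funext => x; rewrite minr_absE mulrC.
Qed.

Lemma Cb_sum (I : Type) (r : seq I) (P : pred I) (F : I -> Y -> R) :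
  (forall i, P i -> Cb R Y (F i)) -> Cb R Y (fun x => \sum_(i <- r | P i) F i x).
Proof.
move=> bF; elim: r => [|i r ih].
  rewrite (_ : (fun _ => _) = fun=> 0); first exact: Cb_cst.
  by apply/funext => x; rewrite big_nil.
have [Pi|nPi] := boolP (P i).
  rewrite (_ : (fun _ => _) = fun x => F i x + \sum_(j <- r | P j) F j x).
    by apply: Cb_add => //; exact: bF.
  by apply/funext => x; rewrite big_cons Pi.
rewrite (_ : (fun _ => _) = fun x => \sum_(j <- r | P j) F j x) //.
by apply/funext => x; rewrite big_cons (negbTE nPi).
Qed.

Lemma Cb_inv f (c : R) : 0 < c -> (forall x, c <= f x) ->
  Cb R Y f -> Cb R Y (fun x => (f x)^-1).
Proof.
move=> c0 cf /CbP[cof _]; have f0 x : 0 < f x by exact: lt_le_trans (cf x).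
apply/CbP; split.
  by move=> x; apply: cvgV; [rewrite gt_eqF|exact: cof].
exists (c^-1) => x; rewrite gtr0_norm ?invr_gt0//.
by rewrite lef_pV2 ?posrE.
Qed.

End bounded_continuous.

Lemma Cb_comp {R : realType} {Y Z : topologicalType} (h : Y -> Z) (f : Z -> R) :
  continuous h -> Cb R Z f -> Cb R Y (fun y => f (h y)).
Proof.
move=> ch /CbP[cf [M fM]]; apply/CbP; split.
  by move=> x; apply: continuous_comp; [exact: ch|exact: cf].
by exists M.
Qed.

(** If [C] is not good, the sets [A] with [C \ A] good form a proper filter containing [C]; a
    cluster point of it in [C] has a good neighbourhood, a contradiction. This takes the place of
    extracting finite subcovers. *)
Lemma compact_induction {Y : topologicalType} (good : set (set Y)) (C : set Y) :
    compact C -> good set0 ->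
    (forall A B, A `<=` B -> good B -> good A) ->
    (forall A B, good A -> good B -> good (A `|` B)) ->
    (forall x, C x -> exists2 V, nbhs x V & good V) ->
  good C.
Proof.
move=> cC g0 gS gU gV; apply: contrapT => nC.
pose F : set_system Y := [set A | good (C `\` A)].
have FF : ProperFilter F.
  apply: Build_ProperFilter.
    by rewrite /F/= setD0.
  split; rewrite /F /=.
  - by rewrite setDT.
  - move=> A B gA gB; apply: gS (gU _ _ gA gB) => x [Cx nAB].
    by have [Ax|nAx] := pselect (A x); [right; split => // Bx; exact: nAB|left].
  - by move=> A B AB; apply: gS => x [Cx nB]; split => // /AB.
have FC : F C by rewrite /F /= setDv.
have [x [Cx clx]] := cC F FF FC.
have [V nV gVV] := gV x Cx.
have FV : F (~` V) by apply: gS gVV => y [_ /contrapT].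
by have [y []] := clx _ _ FV nV.
Qed.

Section separation.
Context {R : realType} {Y : topologicalType}.
Hypothesis crY : completely_regular_space Y.

Lemma cr_bump (a : Y) (O : set Y) : open O -> O a ->
  exists f : Y -> R, [/\ Cb R Y f, forall x, 0 <= f x <= 1, f a = 1
    & forall x, ~ O x -> f x = 0].
Proof.
move=> oO Oa.
have /(@uniform_separatorP _ R)[f [cf f01 f0 f1]] :=
  crY (open_closedC oO) (fun h : (~` O) a => h Oa).
have f01' x : 0 <= f x <= 1.
  by have := f01 (f x) (ex_intro2 _ _ x I erefl); rewrite /= in_itv.
exists (fun x => 1 - f x); split.
- apply: Cb_sub; first exact: Cb_cst.
  apply/CbP; split => //; exists 1 => x.
  by have /andP[? ?] := f01' x; rewrite ger0_norm.
- by move=> x; have /andP[? ?] := f01' x; rewrite subr_ge0 lerBlDr lerDl; apply/andP.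
- by rewrite (f0 (f a)) ?subr0//; exists a.
- by move=> x nOx; rewrite (f1 (f x)) ?subrr//; exists x.
Qed.

Lemma cr_bump_compact (C O : set Y) : compact C -> open O -> C `<=` O ->
  exists f : Y -> R, [/\ Cb R Y f, forall x, 0 <= f x <= 1,
    forall x, C x -> f x = 1 & forall x, ~ O x -> f x = 0].
Proof.
move=> cC oO CO.
pose good (A : set Y) := exists f : Y -> R, [/\ Cb R Y f, forall x, 0 <= f x <= 1,
    forall x, A x -> f x = 1 & forall x, ~ O x -> f x = 0].
apply: (@compact_induction _ good C) => //.
- exists (fun=> 0); split => //; first exact: Cb_cst.
  by move=> _; rewrite lexx ler01.
- move=> A B AB [f [? ? f1 ?]]; exists f; split => // x Ax.
  by apply: f1; exact: AB.
- move=> A B [f [bf f01 f1 f0]] [g [bg g01 g1 g0]].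
  exists (fun x => Num.max (f x) (g x)); split.
  + exact: Cb_max.
  + move=> x; have /andP[f00 f01'] := f01 x; have /andP[_ g01'] := g01 x.
    by rewrite le_max f00 ge_max f01'.
  + move=> x [/f1 ->|/g1 ->].
      by apply/max_idPl; have /andP[] := g01 x.
    by apply/max_idPr; have /andP[] := f01 x.
  + by move=> x nOx; rewrite f0// g0// maxxx.
- move=> x Cx; have [f [bf f01 fx f0]] := cr_bump oO (CO _ Cx).
  exists [set y | 2^-1 < f y].
    have /CbP[cf _] := bf.
    apply: (cf x [set r | 2^-1 < r]); apply: open_nbhs_nbhs; split.
      exact: open_gt.
    by rewrite /= fx; lra.
  (* Doubling and truncating turns the value [1] at the single point [x] into the value [1] on the
     neighbourhood where [f] exceeds 1/2. *)
  exists (fun y => Num.min 1 (2 * f y)); split.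
  + by apply: Cb_min; [exact: Cb_cst|exact: Cb_scale].
  + move=> y; have /andP[fy0 fy1] := f01 y.
    by rewrite le_min ler01 ge_min lexx /= mulr_ge0.
  + by move=> y /= fy; apply/min_idPl; lra.
  + by move=> y nOy; rewrite f0// mulr0; apply/min_idPr.
Qed.

End separation.

(** * Riesz representation of tight functionals *)

(* The functionals [f |-> \int f dm] of Radon probabilities [m]; on a compact
   space the last field is automatic. *)
Record tight_state {R : realType} {Y : topologicalType} (L : (Y -> R) -> R) : Prop :=
  TightState {
    state_add : forall f g, Cb R Y f -> Cb R Y g -> L (fun x => f x + g x) = L f + L g ;
    state_scale : forall c f, Cb R Y f -> L (fun x => c * f x) = c * L f ;
    state_ge0 : forall f, Cb R Y f -> (forall x, 0 <= f x) -> 0 <= L f ;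
    state_one : L (fun=> 1) = 1 ;
    state_tight : forall e, 0 < e -> exists2 C, compact C &
      forall f, Cb R Y f -> (forall x, 0 <= f x <= 1) ->
        (forall x, C x -> f x = 0) -> L f <= e }.

Section state_theory.
Context {R : realType} {Y : topologicalType} (L : (Y -> R) -> R).
Hypothesis sL : tight_state L.
Implicit Types f g : Y -> R.

Lemma state_cst c : L (fun=> c) = c.
Proof.
by have := state_scale sL c (Cb_cst 1); rewrite /= (state_one sL) mulr1.
Qed.

Lemma state_opp f : Cb R Y f -> L (fun x => - f x) = - L f.
Proof.
move=> bf; rewrite -mulN1r -(state_scale sL)//.
by congr L; apply/funext => x; rewrite mulN1r.
Qed.

Lemma state_sub f g : Cb R Y f -> Cb R Y g -> L (fun x => f x - g x) = L f - L g.
Proof.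
by move=> bf bg; rewrite (state_add sL bf (Cb_opp bg)) state_opp.
Qed.

Lemma state_le f g : Cb R Y f -> Cb R Y g -> (forall x, f x <= g x) -> L f <= L g.
Proof.
move=> bf bg fg; rewrite -subr_ge0 -state_sub//; apply: (state_ge0 sL).
  exact: Cb_sub.
by move=> x; rewrite subr_ge0.
Qed.

Lemma state_sum (I : Type) (r : seq I) (P : pred I) (F : I -> Y -> R) :
  (forall i, P i -> Cb R Y (F i)) ->
  L (fun x => \sum_(i <- r | P i) F i x) = \sum_(i <- r | P i) L (F i).
Proof.
move=> bF; elim: r => [|i r ih].
  by rewrite big_nil -[RHS](state_cst 0); congr L; apply/funext => x; rewrite big_nil.
rewrite big_cons; case: ifPn => Pi.
  rewrite -ih -(state_add sL); [|exact: bF|exact: Cb_sum].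
  by congr L; apply/funext => x; rewrite big_cons Pi.
by rewrite -ih; congr L; apply/funext => x; rewrite big_cons (negbTE Pi).
Qed.

Lemma state_norm_le f M : Cb R Y f -> (forall x, `|f x| <= M) -> `|L f| <= M.
Proof.
move=> bf fM; rewrite ler_norml -(state_cst (- M)) -{2}(state_cst M).
apply/andP; split; apply: state_le; rewrite //; try exact: Cb_cst.
  by move=> x; have := fM x; rewrite ler_norml => /andP[].
by move=> x; have := fM x; rewrite ler_norml => /andP[].
Qed.

Lemma state_nonempty : [set: Y] !=set0.
Proof.
apply/set0P/eqP => Y0.
have := state_one sL; rewrite (_ : (fun=> 1) = (fun=> 0) :> (Y -> R)).
  by rewrite state_cst => /esym/eqP; rewrite oner_eq0.
by apply/funext => x; have : [set: Y] x by []; rewrite Y0.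
Qed.

End state_theory.

Section open_content.
Context {R : realType} {Y : topologicalType}.

Definition below (U : set Y) : set (Y -> R) :=
  [set f | [/\ Cb R Y f, forall x, 0 <= f x <= 1 & forall x, ~ U x -> f x = 0]].

(** What a representing measure must give to an open set. [Y] need not be locally compact, so
    functions vanishing off [U] replace compactly supported ones; [state_tight] makes up for the
    difference. *)
Definition content (L : (Y -> R) -> R) (U : set Y) : R := sup (L @` below U).

Definition outer (L : (Y -> R) -> R) (A : set Y) : R :=
  inf (content L @` [set U | open U /\ A `<=` U]).

End open_content.

Section riesz.
Context {R : realType} {Y : topologicalType} (L : (Y -> R) -> R).
Hypotheses (crY : completely_regular_space Y) (sL : tight_state L).

Local Notation tau := (content L).
Local Notation mu := (outer L).

Let below0 (U : set Y) : below U (fun=> 0 : R).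
Proof. by split=> //; [exact: Cb_cst|move=> _; rewrite lexx ler01]. Qed.

Let tau_sup (U : set Y) : has_sup (L @` below U).
Proof.
split; first by exists (L (fun=> 0)); exists (fun=> 0).
exists 1 => _ [f [bf f01 _] <-]; rewrite -(state_one sL).
by apply: (state_le sL) => //; [exact: Cb_cst|move=> x; have /andP[] := f01 x].
Qed.

Lemma content_ge U f : below U f -> L f <= tau U.
Proof. by move=> bf; apply: ub_le_sup; [exact: (tau_sup U).2|exists f]. Qed.

Lemma content_ex U e : 0 < e -> exists2 f, below U f & tau U < L f + e.
Proof.
move=> e0; have [_ [f bf <-] lf] := sup_adherent e0 (tau_sup U).
by exists f => //; rewrite -ltrBlDr.
Qed.

Lemma content_le U c : (forall f, below U f -> L f <= c) -> tau U <= c.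
Proof. by move=> h; apply: ge_sup; [exact: (tau_sup U).1|move=> _ [f bf <-]; exact: h]. Qed.

Lemma content_ge0 U : 0 <= tau U.
Proof. by rewrite -(state_cst sL 0); apply: content_ge. Qed.

Lemma content_mono U V : U `<=` V -> tau U <= tau V.
Proof.
move=> UV; apply: content_le => f [bf f01 f0]; apply: content_ge; split => //.
by move=> x nVx; apply: f0 => /UV.
Qed.

Let mu_inf (A : set Y) : has_inf (tau @` [set U | open U /\ A `<=` U]).
Proof.
split; first by exists (tau setT); exists setT => //; split => //; exact: openT.
by exists 0 => _ [U _ <-]; exact: content_ge0.
Qed.

Lemma outer_le A U : open U -> A `<=` U -> mu A <= tau U.
Proof. by move=> oU AU; apply: ge_inf; [exact: (mu_inf A).2|exists U]. Qed.

Lemma outer_ex A e : 0 < e -> exists U, [/\ open U, A `<=` U & tau U < mu A + e].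
Proof.
move=> e0; have [_ [U [oU AU] <-] lt] := inf_adherent e0 (mu_inf A).
by exists U.
Qed.

Lemma outer_ge A c : (forall U, open U -> A `<=` U -> c <= tau U) -> c <= mu A.
Proof.
by move=> h; apply: lb_le_inf; [exact: (mu_inf A).1|move=> _ [U [oU AU] <-]; exact: h].
Qed.

Lemma outer_open U : open U -> mu U = tau U.
Proof.
move=> oU; apply/eqP; rewrite eq_le outer_le//=.
by apply: outer_ge => V _; exact: content_mono.
Qed.

Lemma outer_ge0 A : 0 <= mu A.
Proof. by apply: outer_ge => U _ _; exact: content_ge0. Qed.

Lemma outer_mono A B : A `<=` B -> mu A <= mu B.
Proof.
move=> AB; apply: outer_ge => U oU BU.
by apply: outer_le => //; exact: subset_trans BU.
Qed.

Lemma outer_set0 : mu set0 = 0.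
Proof.
rewrite outer_open; last exact: open0.
apply/eqP; rewrite eq_le content_ge0 andbT; apply: content_le => f [_ _ f0].
rewrite -(state_cst sL 0) (_ : f = fun=> 0)//.
by apply/funext => x; exact: f0.
Qed.

Lemma outer_setT : mu setT = 1.
Proof.
rewrite outer_open; last exact: openT.
apply/eqP; rewrite eq_le; apply/andP; split.
  apply: content_le => f [bf f01 _]; rewrite -(state_one sL).
  by apply: (state_le sL) => //; [exact: Cb_cst|move=> x; have /andP[] := f01 x].
rewrite -{1}(state_one sL); apply: content_ge; split.
- exact: Cb_cst.
- by move=> _; rewrite lexx ler01.
- by move=> x [].
Qed.

Lemma compact_bumps (C : set Y) (U : nat -> set Y) :
    compact C -> (forall n, open (U n)) -> C `<=` \bigcup_n U n ->
  exists M (b : nat -> Y -> R), (forall n, below (U n) (b n)) /\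
    forall x, C x -> 1 <= \sum_(n < M) b n x.
Proof.
move=> cC oU CU.
pose good (A : set Y) := exists M (b : nat -> Y -> R), (forall n, below (U n) (b n)) /\
    forall x, A x -> 1 <= \sum_(n < M) b n x.
apply: (@compact_induction _ good C) => //.
- by exists 0%N, (fun _ _ => 0).
- move=> A B AB [M [b [bb b1]]]; exists M, b; split => // x Ax.
  by apply: b1; exact: AB.
- move=> A B [M [b [bb b1]]] [N [c [bc c1]]].
  exists (M + N)%N, (fun n x => Num.max (b n x) (c n x)); split.
    move=> n; have [? b01 b0] := bb n; have [? c01 c0] := bc n.
    split => [|x|x nUx]; first exact: Cb_max.
      have /andP[bx0 bx1] := b01 x; have /andP[_ cx1] := c01 x.
      by rewrite le_max bx0 ge_max bx1.
    by rewrite b0// c0// maxxx.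
  have mono K K' (u v : nat -> R) : (K <= K')%N -> (forall n, 0 <= v n) ->
      (forall n, u n <= v n) -> \sum_(n < K) u n <= \sum_(n < K') v n.
    move=> KK v0 uv; rewrite -(subnKC KK) big_split_ord /=.
    by rewrite ler_wpDr ?sumr_ge0//; apply: ler_sum.
  move=> x ABx.
  have m0 n : 0 <= Num.max (b n x) (c n x).
    by rewrite le_max; have [_ /(_ x)/andP[->]] := bb n.
  case: ABx => [/b1|/c1] /le_trans; apply.
    apply: (mono M (M + N)%N (b ^~ x) (fun n => Num.max (b n x) (c n x))) => //.
      by rewrite leq_addr.
    by move=> n; rewrite le_max lexx.
  apply: (mono N (M + N)%N (c ^~ x) (fun n => Num.max (b n x) (c n x))) => //.
    by rewrite leq_addl.
  by move=> n; rewrite le_max lexx orbT.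
- move=> x /CU[n _ Unx].
  have [f [bf f01 fx f0]] := @cr_bump R _ crY x (U n) (oU n) Unx.
  exists [set y | 2^-1 < f y].
    have /CbP[cf _] := bf.
    apply: (cf x [set r | 2^-1 < r]); apply: open_nbhs_nbhs; split.
      exact: open_gt.
    by rewrite /= fx; lra.
  (* Only the entry of index [n] is nonzero, and the sum needs [n.+1] terms to reach it. *)
  exists n.+1, (fun m y => if m == n then Num.min 1 (2 * f y) else 0); split.
    move=> m; case: eqVneq => [->|_]; last exact: below0.
    split.
    + by apply: Cb_min; [exact: Cb_cst|exact: Cb_scale].
    + move=> y; have /andP[fy0 fy1] := f01 y.
      by rewrite le_min ler01 ge_min lexx /= mulr_ge0.
    + by move=> y nOy; rewrite f0// mulr0; apply/min_idPr.
  move=> y /= fy; rewrite (bigD1 ord_max)//= eqxx big1 ?addr0.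
    by rewrite le_min lexx /=; lra.
  by move=> i; rewrite -val_eqE /= => /negbTE ->.
Qed.

(** Tightness reduces the matter to a compact set: up to [e], only the part of a compact [C] where
    [f] is at least [e / 3] counts, and finitely many [U n] cover it. The three errors are the
    choice of [f], the cut at [e / 3] and the mass off [C]. *)
Lemma content_bigcup (U : nat -> set Y) e : (forall n, open (U n)) -> 0 < e ->
  exists M, tau (\bigcup_n U n) <= \sum_(n < M) tau (U n) + e.
Proof.
move=> oU e0; have e3 : 0 < e / 3 by lra.
have [f [bf f01 f0] tauf] := content_ex (\bigcup_n U n) e3.
have [C cC tC] := state_tight sL e3.
have cC' : compact (C `&` [set x | e / 3 <= f x]).
  apply: compact_closedI => //.
  have /CbP[cf _] := bf.
  by apply: ((continuous_closedP f).1 cf [set r | e / 3 <= r]); exact: closed_ge.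
have [|M [b [bb b1]]] := compact_bumps cC' oU.
  move=> x [_ /= fx]; apply: contrapT => nUx; move: fx; rewrite f0//.
  by rewrite leNgt e3.
exists M.
have Cbb n : Cb R Y (b n) by have [] := bb n.
have CbS : Cb R Y (fun x => \sum_(n < M) b n x) by exact: Cb_sum.
(* What the bumps fail to dominate. It vanishes on [C]: there either the bumps sum up to at least
   [1], or [f] is below [e / 3]. *)
pose p x := Num.max (f x - \sum_(n < M) b n x - e / 3) 0.
have Cp : Cb R Y p.
  by apply: Cb_max; [apply: Cb_sub; [exact: Cb_sub|]|]; exact: Cb_cst.
have S0 x : 0 <= \sum_(n < M) b n x.
  by apply: sumr_ge0 => n _; have [_ /(_ x)/andP[]] := bb n.
have Lp : L p <= e / 3.
  apply: tC => // x.
    have /andP[fx0 fx1] := f01 x; rewrite /p le_max lexx orbT /= ge_max ler01 andbT.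
    by have := S0 x; lra.
  move=> Cx; apply/max_idPr.
  have [fx|fx] := leP (e / 3) (f x).
    have := b1 x (conj Cx fx); have /andP[? ?] := f01 x; lra.
  have := S0 x; lra.
have Lf : L f <= \sum_(n < M) L (b n) + e / 3 + L p.
  rewrite -(state_sum sL)// -(state_cst sL (e / 3)).
  rewrite -!(state_add sL)//; try exact: Cb_cst.
    apply: (state_le sL) => //.
      by apply: Cb_add => //; apply: Cb_add => //; exact: Cb_cst.
    move=> x; rewrite /p.
    have : f x - \sum_(n < M) b n x - e / 3 <= Num.max (f x - \sum_(n < M) b n x - e / 3) 0.
      by rewrite le_max lexx.
    lra.
  by apply: Cb_add => //; exact: Cb_cst.
have : \sum_(n < M) L (b n) <= \sum_(n < M) tau (U n).
  by apply: ler_sum => n _; exact: content_ge.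
lra.
Qed.

Lemma outer_sigma_subadditive : sigma_subadditive (fun A => (mu A)%:E).
Proof.
move=> F; apply/lee_addgt0Pr => e e0; have e2 : 0 < e / 2 by lra.
(* Half of [e] pays for the open covers through a geometric series, the other half for
   [content_bigcup]. *)
have d0 n : 0 < e / 2 / 2 ^+ n.+1 by rewrite divr_gt0// exprn_gt0.
have /choice[U UP] : forall n, exists U, [/\ open U, F n `<=` U &
    tau U < mu (F n) + e / 2 / 2 ^+ n.+1] by move=> n; exact: outer_ex.
have [M tauM] := @content_bigcup U (e / 2) (fun n => let: And3 o _ _ := UP n in o) e2.
apply: (@le_trans _ _ (\sum_(n < M) mu (F n) + e)%:E).
  rewrite lee_fin; apply: (@le_trans _ _ (tau (\bigcup_n U n))).
    apply: outer_le; first by apply: bigcup_open => n _; have [] := UP n.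
    by apply: subset_bigcup => n _; have [] := UP n.
  apply: (le_trans tauM).
  have : \sum_(n < M) tau (U n) <= \sum_(n < M) (mu (F n) + e / 2 / 2 ^+ n.+1).
    by apply: ler_sum => n _; have [_ _ /ltW] := UP n.
  have : \sum_(n < M) (e / 2 / 2 ^+ n.+1) <= e / 2.
    have -> : \sum_(n < M) (e / 2 / 2 ^+ n.+1) = e / 2 - e / 2 / 2 ^+ M.
      elim: M {tauM} => [|M ih]; first by rewrite big_ord0 expr0 divr1 subrr.
      rewrite big_ord_recr /= ih exprS; field.
      by rewrite expf_eq0 pnatr_eq0 andbF.
    by rewrite lerBlDr lerDl divr_ge0 ?exprn_ge0// ltW.
  by rewrite big_split /=; lra.
rewrite EFinD; apply: leeD => //.
rewrite -sumEFin; have := @nneseries_lim_ge R (fun n => (mu (F n))%:E) xpredT 0 M.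
rewrite big_mkord; apply => n _ _.
by rewrite lee_fin outer_ge0.
Qed.

End riesz.

Lemma borel_open {Y : topologicalType} (Y0 : [set: Y] !=set0) (U : set Y) :
  open U -> measurable (U : set (borel Y0)).
Proof. by move=> oU; exact: sub_sigma_algebra. Qed.

Section riesz_measure.
Context {R : realType} {Y : topologicalType} (L : (Y -> R) -> R).
Hypotheses (crY : completely_regular_space Y) (sL : tight_state L).

Local Notation tau := (content L).
Local Notation mu := (outer L).

(** For [V] open around [A], take [f] nearly optimal below [V] inter [U] and [g] nearly optimal
    below the part of [V] where [f] is less than [e / 4]. The positive part of [f - e / 4] and [g]
    are never nonzero together, so their sum is still below [V]. *)
Lemma outer_open_split (U A : set Y) : open U ->
  mu (A `&` U) + mu (A `&` ~` U) <= mu A.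
Proof.
move=> oU; apply/ler_addgt0Pr => e e0; have e4 : 0 < e / 4 by lra.
have [V [oV AV tauV]] := outer_ex sL A e4.
have [f [bf f01 f0] tauf] := content_ex sL (V `&` U) e4.
pose F := [set x | e / 4 <= f x].
have oVF : open (V `&` ~` F).
  apply: openI => //; apply: closed_openC.
  have /CbP[cf _] := bf.
  by apply: ((continuous_closedP f).1 cf [set r | e / 4 <= r]); exact: closed_ge.
have [g [bg g01 g0] taug] := content_ex sL (V `&` ~` F) e4.
have h1 : mu (A `&` U) <= tau (V `&` U).
  by apply: outer_le => //; [exact: openI|exact: setSI].
have h2 : mu (A `&` ~` U) <= tau (V `&` ~` F).
  apply: outer_le => // x [Ax nUx]; split; first exact: AV.
  by rewrite /F /= f0 ?leNgt ?e4// => -[_].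
pose p x := Num.max (f x - e / 4) 0.
have bp : Cb R Y p by apply: Cb_max; [apply: Cb_sub => //|]; exact: Cb_cst.
have h3 : L p + L g <= tau V.
  rewrite -(state_add sL)//; apply: content_ge => //; split.
  - exact: Cb_add.
  - move=> x; have /andP[f0x f1x] := f01 x; have /andP[g0x g1x] := g01 x.
    have [fx|fx] := leP (e / 4) (f x).
      rewrite (g0 x); last by move=> [_]; exact.
      by rewrite addr0 /p le_max lexx orbT /= ge_max ler01 andbT; lra.
    have -> : p x = 0 by apply/max_idPr; lra.
    by rewrite add0r g0x.
  - move=> x nVx; rewrite (g0 x) => [|[]//].
    by rewrite /p (f0 x) => [|[]//]; rewrite addr0; apply/max_idPr; lra.
have h4 : L f - e / 4 <= L p.
  rewrite -(state_cst sL (e / 4)) -(state_sub sL)//; last exact: Cb_cst.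
  apply: (state_le sL) => //; first by apply: Cb_sub => //; exact: Cb_cst.
  by move=> x; rewrite /p le_max lexx.
lra.
Qed.

Let Y0 : [set: Y] !=set0 := state_nonempty sL.
Local Notation PY := (pointed_copy Y0).
Local Notation BY := (borel Y0).

Definition riesz_outer (A : set PY) : \bar R := (mu A)%:E.

Let riesz_outer0 : riesz_outer set0 = 0%E.
Proof. by rewrite /riesz_outer outer_set0. Qed.

Let riesz_outer_ge0 A : (0 <= riesz_outer A)%E.
Proof. by rewrite lee_fin outer_ge0. Qed.

Let riesz_outer_mono : {homo riesz_outer : A B / A `<=` B >-> (A <= B)%E}.
Proof. by move=> A B AB; rewrite lee_fin outer_mono. Qed.

Let riesz_outer_sub : sigma_subadditive riesz_outer.
Proof. exact: outer_sigma_subadditive. Qed.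

HB.instance Definition _ := isOuterMeasure.Build R PY riesz_outer
  riesz_outer0 riesz_outer_ge0 riesz_outer_mono riesz_outer_sub.

Lemma borel_caratheodory (B : set BY) :
  measurable B -> riesz_outer.-cara.-measurable (B : set PY).
Proof.
move: B; apply: smallest_sub; first exact: sigma_algebra_measurable.
move=> U oU; apply: le_caratheodory_measurable => A.
by rewrite lee_fin; exact: outer_open_split.
Qed.

(** The outer measure is cut to [0] off the Borel sets because [radon_normal] requires it. *)
Definition riesz_measure (B : set BY) : \bar R :=
  if pselect (measurable B) is left _ then riesz_outer B else 0%E.

Lemma riesz_measureE (B : set BY) : measurable B -> riesz_measure B = (mu B)%:E.
Proof. by rewrite /riesz_measure; case: pselect. Qed.

Let riesz_measure0 : riesz_measure set0 = 0%E.
Proof. by rewrite riesz_measureE// outer_set0. Qed.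

Let riesz_measure_ge0 B : (0 <= riesz_measure B)%E.
Proof. by rewrite /riesz_measure; case: pselect. Qed.

Let riesz_measure_sigma_additive : semi_sigma_additive riesz_measure.
Proof.
move=> F mF tF mUF; rewrite riesz_measureE//.
under eq_fun do under eq_bigr do rewrite (riesz_measureE (mF _)).
apply: (@caratheodory_measure_sigma_additive R PY riesz_outer) => //.
- by move=> n; exact: borel_caratheodory.
- exact: borel_caratheodory.
Qed.

HB.instance Definition _ := isMeasure.Build _ _ _ riesz_measure
  riesz_measure0 riesz_measure_ge0 riesz_measure_sigma_additive.

Let riesz_measure_setT : riesz_measure setT = 1%E.
Proof. by rewrite riesz_measureE// outer_setT. Qed.

HB.instance Definition _ :=
  Measure_isProbability.Build _ _ _ riesz_measure riesz_measure_setT.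

(** For an open [U] around [C], a bump [h] that is [1] on [C] and [0] off [U] satisfies
    [L h <= tau U], while [1 - h] vanishes on [C]. *)
Lemma outer_compact (C : set Y) e : compact C ->
    (forall f, Cb R Y f -> (forall x, 0 <= f x <= 1) ->
       (forall x, C x -> f x = 0) -> L f <= e) ->
  1 - e <= mu C.
Proof.
move=> cC tC; apply: (outer_ge sL) => U oU CU.
have [h [bh h01 h1 h0]] := @cr_bump_compact R Y crY C U cC oU CU.
have := content_ge sL (And3 bh h01 h0).
suff : L (fun x => 1 - h x) <= e.
  by rewrite (state_sub sL)//; [rewrite (state_one sL); lra|exact: Cb_cst].
apply: tC; first by apply: Cb_sub => //; exact: Cb_cst.
- by move=> x; have /andP[? ?] := h01 x; apply/andP; split; lra.
- by move=> x Cx; rewrite h1// subrr.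
Qed.

(** Outer regularity is enough: remove from a compact set of mass at least [1 - e / 3] an open set
    that contains the complement of [B] and exceeds it by less than [e / 3]. *)
Lemma riesz_measure_regular (hY : hausdorff_space Y) (B : set BY) (e : R) :
    measurable B -> 0 < e ->
  exists K : set BY, [/\ compact (K : set Y), measurable K, K `<=` B
      & (riesz_measure (B `\` K) < e%:E)%E].
Proof.
move=> mB e0; have e3 : 0 < e / 3 by lra.
have [C cC tC] := state_tight sL e3.
have muC := outer_compact cC tC.
have [U [oU BU tauU]] := outer_ex sL (~` B) e3.
have mC : measurable (C : set BY).
  rewrite -[X in measurable X]setCK; apply: measurableC.
  by apply: borel_open; exact/closed_openC/(compact_closed hY cC).
have mU : measurable (U : set BY) by exact: borel_open.
have mCU : measurable (C `\` U : set BY) by exact: measurableD.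
exists (C `\` U); split => //.
- by apply: compact_closedI => //; exact: open_closedC.
- by move=> x [_ nUx]; apply: contrapT => nBx; apply: nUx; exact: BU.
have sub : (B `\` (C `\` U) : set BY) `<=` (~` C) `|` (U `&` B).
  move=> x [Bx nCU]; have [Cx|] := pselect (C x); last by left.
  by right; split => //; apply: contrapT => nUx; apply: nCU.
have mC' : measurable (~` C : set BY) by exact: measurableC.
have mUB : measurable (U `&` B : set BY) by exact: measurableI.
apply: (@le_lt_trans _ _ (riesz_measure (~` C) + riesz_measure (U `&` B))%E).
  apply: le_trans (measureU2 _ mC' mUB).
  by apply: le_measure; rewrite ?inE//; [exact: measurableD|exact: measurableU].
have : (riesz_measure (~` C) = 1 - riesz_measure C)%E by exact: probability_setC.
rewrite (riesz_measureE mC) => ->.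
have : riesz_measure U = (riesz_measure (U `&` B) + riesz_measure (U `&` ~` B))%E.
  rewrite -[X in X = _](_ : riesz_measure ((U `&` B) `|` (U `&` ~` B)) = _).
    apply: measureU => //; first by apply: measurableI => //; exact: measurableC.
    by rewrite setIACA setICr setI0.
  by rewrite -setIUr setUCr setIT.
have -> : U `&` ~` B = ~` B by rewrite setIC; exact/setIidPl.
rewrite !riesz_measureE//; last exact: measurableC.
rewrite -EFinD => -[]; rewrite (outer_open sL)//.
move=> muU; rewrite [X in (X < _)%E](_ : _ = (1 - mu C + mu (U `&` B))%:E)// lte_fin; lra.
Qed.

Definition riesz (hY : hausdorff_space Y) : radon_prob R Y.
Proof.
refine (@RadonProb R Y Y0 riesz_measure (riesz_measure_regular hY) _).
by move=> B nB; rewrite /= /riesz_measure; case: pselect.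
Defined.

End riesz_measure.

Lemma probability_eq d (T : measurableType d) (R : realType) (P Q : probability T R) :
  P = Q :> (set T -> \bar R) -> P = Q.
Proof.
move: P Q => [p [[a1 a2] [a3] [a4] [a5] [a6] [a7] [a8]]].
move=> [q [[b1 b2] [b3] [b4] [b5] [b6] [b7] [b8]]] /= pq; subst q.
by rewrite (Prop_irrelevance a1 b1) (Prop_irrelevance a2 b2) (Prop_irrelevance a3 b3)
  (Prop_irrelevance a4 b4) (Prop_irrelevance a5 b5) (Prop_irrelevance a6 b6)
  (Prop_irrelevance a7 b7) (Prop_irrelevance a8 b8).
Qed.

Section borel_integral.
Context {R : realType} {Y : topologicalType} {Y0 : [set: Y] !=set0}.
Variable P : probability (borel Y0) R.
Implicit Types f g : Y -> R.

Local Notation BY := (borel Y0).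

Lemma continuous_borel f : continuous f -> measurable_fun setT (f : BY -> R).
Proof.
move=> cf; apply: (measurability _ (measurable_realfun.RGenOInfty.measurableE R)) => //.
move=> _ [_ [a ->] <-]; rewrite setTI; apply: sub_sigma_algebra.
by apply: ((continuousP f).1 cf); exact: interval_open.
Qed.

Lemma Cb_integrable f : Cb R Y f -> P.-integrable setT (EFin \o (f : BY -> R)).
Proof.
move=> [cf bf]; apply: measurable_bounded_integrable => //.
  by rewrite -ge0_fin_numE// fin_num_measure.
exact: continuous_borel.
Qed.

Lemma indic_integrable (B : set BY) : measurable B ->
  P.-integrable setT (EFin \o (\1_B : BY -> R)).
Proof.
move=> mB; apply: measurable_bounded_integrable => //.
  by rewrite -ge0_fin_numE// fin_num_measure.
apply/bounded_funP; exists 1 => x.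
by rewrite indicE ger0_norm; case: (_ \in _).
Qed.

Lemma Rintegral_indicT (B : set BY) : measurable B ->
  \int[P]_x (\1_B x : R) = fine (P B).
Proof. by move=> mB; rewrite /Rintegral integral_indic// setIT. Qed.

Lemma Rintegral_ge_measure (B : set BY) f : measurable B -> Cb R Y f ->
  (forall x, 0 <= f x) -> (forall x, B x -> 1 <= f x) ->
  fine (P B) <= \int[P]_x f x.
Proof.
move=> mB bf f0 f1; rewrite -Rintegral_indicT//; apply: le_Rintegral => //.
- exact: indic_integrable.
- exact: Cb_integrable.
- move=> x _; rewrite indicE; case: (boolP (x \in B)) => [|_]; last exact: f0.
  by rewrite inE => /f1.
Qed.

Lemma Rintegral_le_measure (B : set BY) f : measurable B -> Cb R Y f ->
  (forall x, f x <= 1) -> (forall x, ~ B x -> f x = 0) ->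
  \int[P]_x f x <= fine (P B).
Proof.
move=> mB bf f1 f0; rewrite -Rintegral_indicT//; apply: le_Rintegral => //.
- exact: Cb_integrable.
- exact: indic_integrable.
- move=> x _; rewrite indicE; case: (boolP (x \in B)) => [_|]; first exact: f1.
  by move=> /negP xB; rewrite f0// => Bx; apply: xB; rewrite inE.
Qed.

End borel_integral.

Definition rint {R : realType} {Y : topologicalType} (m : radon_prob R Y)
    (f : Y -> R) : R := \int[radon_measure m]_z f z.

Section rint_theory.
Context {R : realType} {Y : topologicalType}.
Implicit Types (m : radon_prob R Y) (f g : Y -> R).

Lemma rint_tight m : tight_state (rint m).
Proof.
split.
- by move=> f g bf bg; apply: RintegralD => //; exact: Cb_integrable.
- by move=> c f bf; apply: RintegralZl => //; exact: Cb_integrable.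
- by move=> f bf f0; apply: Rintegral_ge0.
- by rewrite /rint Rintegral_cst// mul1r; exact: (congr1 fine (probability_setT (radon_measure m))).
- move=> e e0; have [K [cK mK _ Ke]] := radon_regular (r := m) (B := setT) measurableT e0.
  exists K => // f bf f01 f0.
  apply: (@le_trans _ _ (fine (radon_measure m (~` K)))).
    apply: Rintegral_le_measure => //.
    + exact: measurableC.
    + by move=> x; have /andP[] := f01 x.
    + by move=> x /contrapT /f0.
  rewrite -lee_fin fineK; last by apply: fin_num_measure; exact: measurableC.
  by rewrite -setTD ltW.
Qed.

Hypotheses (crY : completely_regular_space Y) (hY : hausdorff_space Y).

(* The slices [min (max (f - k/n) 0) (1/n)] of [f] sum up to [f], and the
   [k.+1]-th one is squeezed between [1/n] times the indicators of
   [f > (k.+1)/n] and [f > k/n]. *)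
Lemma rint_riesz_le (L : (Y -> R) -> R) (sL : tight_state L) f : Cb R Y f ->
  (forall x, 0 <= f x <= 1) -> L f <= rint (riesz crY sL hY) f.
Proof.
move=> bf f01; apply/ler_addgt0Pr => e e0.
set m := riesz crY sL hY.
pose n := (Num.truncn e^-1).+1.
have n0 : 0 < n%:R :> R by rewrite ltr0n.
have ne : n%:R^-1 <= e.
  by rewrite invf_ple ?posrE// ltW// /n truncnS_gt.
pose s (k : nat) x := Num.min (Num.max (f x - k%:R / n%:R) 0) n%:R^-1.
have bs k : Cb R Y (s k).
  apply: Cb_min; last exact: Cb_cst.
  by apply: Cb_max; [apply: Cb_sub => //|]; exact: Cb_cst.
have in0 : 0 < n%:R^-1 :> R by rewrite invr_gt0.
have s0 k x : 0 <= s k x by rewrite /s le_min le_max lexx orbT ltW.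
have s1 k x : s k x <= n%:R^-1 by rewrite /s ge_min lexx orbT.
have fE x : f x = \sum_(k < n) s k x.
  have /andP[fx0 fx1] := f01 x.
  have H (N : nat) : (N <= n)%N ->
      \sum_(k < N) s k x = Num.min (f x) (N%:R / n%:R).
    elim: N => [_|N ih Nn]; first by rewrite big_ord0 mul0r; apply/esym/min_idPr.
    rewrite big_ord_recr /= ih ?(ltnW Nn)// /s.
    have -> : N.+1%:R / n%:R = N%:R / n%:R + n%:R^-1 :> R by rewrite -natr1 mulrDl mul1r.
    have [h1|h1] := leP (f x) (N%:R / n%:R).
      rewrite (max_idPr _) ?subr_le0// (min_idPl _) ?ltW// addr0.
      by apply/esym/min_idPl; lra.
    rewrite (max_idPl _) ?subr_ge0 ?ltW//.
    by have [h2|h2] := leP (f x - N%:R / n%:R) n%:R^-1;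
      have [h3|h3] := leP (f x) (N%:R / n%:R + n%:R^-1); lra.
  by rewrite H// divff ?gt_eqF//; apply/esym/min_idPl.
pose B k : set (borel (radon_nonempty m)) := [set x | k%:R / n%:R < f x].
have oB k : open (B k : set Y).
  have /CbP[cf _] := bf.
  by apply: ((continuousP f).1 cf [set r | k%:R / n%:R < r]); exact: open_gt.
have mB k : measurable (B k) by exact: borel_open.
have bns k : Cb R Y (fun x => n%:R * s k x) by exact: Cb_scale.
have up k : n%:R * L (s k) <= fine (radon_measure m (B k)).
  rewrite /m /= riesz_measureE// /= outer_open// -(state_scale sL)//.
  apply: content_ge => //; split => //.
  - move=> x; rewrite mulr_ge0//=.
    by rewrite -[leRHS](divff (lt0r_neq0 n0)) ler_pM2l.
  - move=> x /negP; rewrite -leNgt => fx.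
    rewrite /s (max_idPr _) ?subr_le0//.
    by rewrite (min_idPl _) ?ltW// mulr0.
have lo k : fine (radon_measure m (B k.+1)) <= n%:R * rint m (s k).
  rewrite -(state_scale (rint_tight m))//; apply: Rintegral_ge_measure => //.
  - by move=> x; rewrite mulr_ge0.
  - move=> x; rewrite /B /= => fx; rewrite -[leLHS](divff (lt0r_neq0 n0)) ler_pM2l//.
    rewrite /s le_min lexx andbT le_max; apply/orP; left.
    have : k.+1%:R / n%:R = k%:R / n%:R + n%:R^-1 :> R by rewrite -natr1 mulrDl mul1r.
    lra.
have lo' k : L (s k.+1) <= rint m (s k).
  by rewrite -(ler_pM2l n0) (le_trans (up _))//.
have -> : L f = \sum_(k < n) L (s k).
  by rewrite -(state_sum sL)//; congr L; apply/funext.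
have -> : rint m f = \sum_(k < n) rint m (s k).
  by rewrite -(state_sum (rint_tight m))//; congr rint; apply/funext.
(* Comparing slice [k.+1] under [L] with slice [k] under [m] leaves the lowest slice over; it is at
   most [1/n], which is where the error [e] goes. *)
have L0 : L (s 0%N) <= e.
  apply: le_trans ne; rewrite -(state_cst sL n%:R^-1).
  by apply: (state_le sL) => //; exact: Cb_cst.
have rN : 0 <= rint m (s (Num.truncn e^-1)) by exact: (state_ge0 (rint_tight m)).
rewrite /n big_ord_recl [in leRHS]big_ord_recr /=.
have : \sum_(i < Num.truncn e^-1) L (s (bump 0 i)) <=
    \sum_(i < Num.truncn e^-1) rint m (s i) by apply: ler_sum => i _; exact: lo'.
lra.
Qed.

(** The inequality for [1 - g] is the reverse inequality for [g]; an affine change of scale brings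
    any bounded function into the range from 0 to 1. *)
Lemma rint_riesz (L : (Y -> R) -> R) (sL : tight_state L) f : Cb R Y f ->
  rint (riesz crY sL hY) f = L f.
Proof.
set m := riesz crY sL hY.
have H g : Cb R Y g -> (forall x, 0 <= g x <= 1) -> rint m g = L g.
  move=> bg g01; apply/eqP; rewrite eq_le rint_riesz_le// andbT.
  have : L (fun x => 1 - g x) <= rint m (fun x => 1 - g x).
    apply: rint_riesz_le; first by apply: Cb_sub => //; exact: Cb_cst.
    by move=> x; have /andP[? ?] := g01 x; apply/andP; split; lra.
  rewrite (state_sub sL) ?(state_sub (rint_tight m))//; try exact: Cb_cst.
  rewrite (state_one sL) (state_one (rint_tight m)); lra.
move=> bf; have [M M0 fM] := Cb_ex bf.
pose g x := (2 * M)^-1 * (f x + M).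
have bg : Cb R Y g by apply: Cb_scale; apply: Cb_add => //; exact: Cb_cst.
have g01 x : 0 <= g x <= 1.
  have := fM x; rewrite ler_norml => /andP[? ?].
  rewrite /g mulr_ge0 ?invr_ge0//=; [|lra|lra].
  by rewrite mulrC ler_pdivrMr; lra.
have fE : f = fun x => 2 * M * g x - M.
  by apply/funext => x; rewrite /g mulrA mulfV ?mul1r ?addrK//; lra.
have bMg : Cb R Y (fun x => 2 * M * g x) by exact: Cb_scale.
rewrite fE (state_sub sL) ?(state_sub (rint_tight m))//; try exact: Cb_cst.
rewrite (state_scale sL _ bg) (state_scale (rint_tight m) _ bg) (H g bg g01).
by rewrite (state_cst sL) (state_cst (rint_tight m)).
Qed.

Lemma radon_exists (L : (Y -> R) -> R) : tight_state L ->
  exists m : radon_prob R Y, forall f, Cb R Y f -> rint m f = L f.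
Proof. by move=> sL; exists (riesz crY sL hY) => f; exact: rint_riesz. Qed.

(** Choose compact [K] in [B] nearly full for [P] and compact [K'] in the complement nearly full for
    [Q]. For a bump [f] that is [1] on [K] and [0] on [K'], the mass [P K] is at most the integral
    of [f], which is at most the mass that [Q] gives to the complement of [K']. *)
Lemma radon_le (Y0 : [set: Y] !=set0) (P Q : probability (borel Y0) R) :
    (forall (B : set (borel Y0)) e, measurable B -> 0 < e ->
      exists K : set (borel Y0), [/\ compact (K : set Y), measurable K, K `<=` B
      & (P (B `\` K) < e%:E)%E]) ->
    (forall (B : set (borel Y0)) e, measurable B -> 0 < e ->
      exists K : set (borel Y0), [/\ compact (K : set Y), measurable K, K `<=` B
      & (Q (B `\` K) < e%:E)%E]) ->
    (forall f, Cb R Y f -> \int[P]_x f x = \int[Q]_x f x) ->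
  forall B : set (borel Y0), measurable B -> (P B <= Q B)%E.
Proof.
move=> regP regQ PQ B mB.
have finP A : measurable A -> P A \is a fin_num by move=> mA; exact: fin_num_measure.
have finQ A : measurable A -> Q A \is a fin_num by move=> mA; exact: fin_num_measure.
rewrite -(fineK (finP _ mB)) -(fineK (finQ _ mB)) lee_fin.
apply/ler_addgt0Pr => e e0; have e2 : 0 < e / 2 by lra.
have [K [cK mK KB PK]] := regP B _ mB e2.
have mB' : measurable (~` B) by exact: measurableC.
have [K' [cK' mK' KB' QK']] := regQ (~` B) _ mB' e2.
have [f [bf f01 f1 f0]] := @cr_bump_compact R Y crY K (~` K') cK
  (closed_openC (compact_closed hY cK')) (fun x Kx K'x => KB' _ K'x (KB _ Kx)).
have h1 : fine (P K) <= \int[P]_x f x.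
  apply: Rintegral_ge_measure => //; first by move=> x; have /andP[] := f01 x.
  by move=> x Kx; rewrite f1.
have mnK' : measurable (~` K') by exact: measurableC.
have h2 : \int[Q]_x f x <= fine (Q (~` K')).
  by apply: Rintegral_le_measure => // x; have /andP[] := f01 x.
have mBK : measurable (B `\` K) by exact: measurableD.
have mBK' : measurable (~` B `\` K') by exact: measurableD.
have h3 : fine (P B) <= fine (P K) + e / 2.
  rewrite -lee_fin EFinD !fineK ?finP//.
  have : (P B <= P K + P (B `\` K))%E.
    apply: le_trans (measureU2 P mK mBK); apply: le_measure; rewrite ?inE//.
      exact: measurableU.
    by move=> x Bx; have [?|?] := pselect (K x); [left|right].
  by move=> /le_trans; apply; rewrite leeD2l// ltW.
have h4 : fine (Q (~` K')) <= fine (Q B) + e / 2.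
  rewrite -lee_fin EFinD !fineK ?finQ//.
  have : (Q (~` K') <= Q B + Q (~` B `\` K'))%E.
    apply: le_trans (measureU2 Q mB mBK'); apply: le_measure; rewrite ?inE//.
      exact: measurableU.
    by move=> x Kx; have [?|?] := pselect (B x); [left|right].
  by move=> /le_trans; apply; rewrite leeD2l// ltW.
by have := PQ f bf; lra.
Qed.

Lemma radon_ext m m' : (forall f, Cb R Y f -> rint m f = rint m' f) -> m = m'.
Proof.
case: m m' => [n P rP oP] [n' Q rQ oQ]; have en := Prop_irrelevance n n'; subst n'.
rewrite /rint /= => PQ.
have PQE : P = Q :> (set _ -> \bar R).
  apply/funext => B; have [mB|nB] := pselect (measurable B); last by rewrite oP// oQ.
  apply/eqP; rewrite eq_le (radon_le rP rQ)//= (radon_le rQ rP)//.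
  by move=> f bf; rewrite PQ.
have {}PQE := probability_eq PQE.
subst Q; congr RadonProb; exact: Prop_irrelevance.
Qed.

End rint_theory.

(** * The space of Radon probability measures *)

Lemma ultra_bounded_cvg {R : realType} (T : Type) (F : set_system T) (g : T -> R) M :
  UltraFilter F -> (forall a, `|g a| <= M) -> exists l : R, g @ F --> l.
Proof.
move=> UF gM.
have gF : F (g @^-1` `[- M, M]).
  by apply: filterS filterT => a _ /=; rewrite in_itv /= -ler_norml.
have [l [_ ll]] := segment_compact (fmap_proper_filter g _) gF.
exists l => A nA; rewrite nbhs_simpl /=.
have [//|nFA] := in_ultra_setVsetC (g @^-1` A) UF.
by have [x [nAx Ax]] := ll (~` A) A nFA nA.
Qed.

Section state_limit.
Context {R : realType} {Y : topologicalType} (T : Type) (F : set_system T).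
Hypothesis UF : UltraFilter F.
Variable S : T -> (Y -> R) -> R.
Hypothesis sS : forall a, tight_state (S a).

Lemma ultra_state : exists L : (Y -> R) -> R,
  (forall f, Cb R Y f -> S ^~ f @ F --> L f) /\
  ((forall e, 0 < e -> exists2 C, compact C &
      forall f, Cb R Y f -> (forall x, 0 <= f x <= 1) ->
        (forall x, C x -> f x = 0) -> L f <= e) -> tight_state L).
Proof.
pose L f := lim (S ^~ f @ F).
have cL f : Cb R Y f -> S ^~ f @ F --> L f.
  move=> bf; have [M _ fM] := Cb_ex bf.
  have [l cl] := ultra_bounded_cvg UF (fun a => state_norm_le (sS a) bf fM).
  by rewrite /L (cvg_lim _ cl).
exists L; split => // tL; split => //.
- move=> f g bf bg; apply: cvg_lim => //.
  under eq_fun do rewrite (state_add (sS _) bf bg).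
  by apply: cvgD; exact: cL.
- move=> c f bf; apply: cvg_lim => //.
  under eq_fun do rewrite (state_scale (sS _) _ bf).
  by apply: cvgM; [exact: cvg_cst|exact: cL].
- move=> f bf f0; apply: (cvgr_to_ge (cL f bf)).
  by apply: nearW => a; exact: (state_ge0 (sS a)).
- apply: cvg_lim => //.
  under eq_fun do rewrite (state_one (sS _)).
  exact: cvg_cst.
Qed.

End state_limit.

Section radon_topology.
Context {R : realType} {Y : topologicalType}.
Implicit Types (m : radon_prob R Y) (f g : Y -> R).

Lemma rint_continuous f : Cb R Y f ->
  continuous ((fun m => rint m f) : radon_prob R Y -> R).
Proof.
move=> bf m.
pose i : Cb R Y := SigSub (mem_set bf).
apply: (@continuous_comp _ _ _ (@integrals R Y) (fun h : {ptws Cb R Y -> R} => h i)).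
  exact: initial_continuous.
exact: (@proj_continuous _ (fun=> R) i).
Qed.

Lemma radon_cvg (F : set_system (radon_prob R Y)) m : Filter F ->
  (forall f, Cb R Y f -> (fun m' => rint m' f) @ F --> rint m f) -> F --> m.
Proof.
move=> FF cF A [_ [[B oB <-] Bm BA]].
apply: (filterS BA).
have : @integrals R Y @ F --> (integrals m : {ptws Cb R Y -> R}).
  apply/cvg_sup => f C [_ [[D oD <-] Dm DC]].
  apply: filterS DC _; apply: (cF (set_val f)); first exact: set_valP.
  exact: open_nbhs_nbhs.
by apply; exact: open_nbhs_nbhs.
Qed.

(** The sets that satisfy the conclusion form a filter. By [radon_cvg] it converges to [m], so it
    contains every neighbourhood of [m]. *)
Lemma radon_nbhs_basis m (A : set (radon_prob R Y)) : nbhs m A ->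
  exists (s : seq (Y -> R)) e, [/\ 0 < e, forall f, f \in s -> Cb R Y f &
    forall m', (forall f, f \in s -> `|rint m' f - rint m f| < e) -> A m'].
Proof.
pose F : set_system (radon_prob R Y) := [set A | exists (s : seq (Y -> R)) e,
  [/\ 0 < e, forall f, f \in s -> Cb R Y f &
    forall m', (forall f, f \in s -> `|rint m' f - rint m f| < e) -> A m']].
have FF : Filter F.
  split.
  - by exists [::], 1.
  - move=> C D [s [e [e0 bs sC]]] [t [d [d0 bt tD]]].
    exists (s ++ t), (Num.min e d); split.
    + by rewrite lt_min e0.
    + by move=> f; rewrite mem_cat => /orP[/bs|/bt].
    + move=> m' h; split; [apply: sC|apply: tD] => f fs.
        by have := h f; rewrite mem_cat fs lt_min => /(_ isT)/andP[].
      by have := h f; rewrite mem_cat fs orbT lt_min => /(_ isT)/andP[].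
  - move=> C D CD [s [e [e0 bs sC]]]; exists s, e; split => // m' /sC.
    exact: CD.
apply: (radon_cvg FF) => f bf; apply/cvgrPdistC_lt => e e0.
exists [:: f], e; split => //.
  by move=> g; rewrite inE => /eqP ->.
by move=> m' /(_ f); apply; rewrite inE.
Qed.

Lemma radon_continuous (Z : topologicalType) (h : Z -> radon_prob R Y) :
  (forall f, Cb R Y f -> continuous (fun z => rint (h z) f)) -> continuous h.
Proof. by move=> ch z; apply: radon_cvg => f bf; exact: ch. Qed.

Lemma radon_basic_nbhs m (s : seq (Y -> R)) e : 0 < e ->
  (forall f, f \in s -> Cb R Y f) ->
  nbhs m [set m' | forall f, f \in s -> `|rint m' f - rint m f| < e].
Proof.
move=> e0; elim: s => [|f s ih] bs; first by apply: filterS filterT.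
have bf : Cb R Y f by apply: bs; rewrite inE eqxx.
have nf := (continuous_epsP (fun m => rint m f)).1 (rint_continuous bf) m e e0.
have ns := ih (fun g gs => bs g (mem_behead (s := f :: s) gs)).
apply: filterS2 nf ns => m' h1 h2 g; rewrite inE => /orP[/eqP ->//|].
exact: h2.
Qed.

Hypotheses (crY : completely_regular_space Y) (hY : hausdorff_space Y).

Lemma radon_hausdorff : hausdorff_space (radon_prob R Y).
Proof.
move=> m m' mm'; apply: (radon_ext crY hY) => f bf.
apply: (@Rhausdorff R) => A B nA nB.
have [r [Ar Br]] := mm' _ _ (rint_continuous bf nA) (rint_continuous bf nB).
by exists (rint r f).
Qed.

Lemma radon_compact : compact [set: Y] -> compact [set: radon_prob R Y].
Proof.
move=> cY; rewrite compact_ultra => F UF _.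
have [L [cL tL]] := ultra_state UF (fun m : radon_prob R Y => rint_tight m).
have [|m mL] := radon_exists crY hY (tL _).
  move=> e e0; exists setT => // f _ _ f0.
  have -> : f = fun=> 0 by apply/funext => x; exact: f0.
  have := cL _ (Cb_cst 0).
  under eq_fun do rewrite (state_cst (rint_tight _)).
  move=> /cvg_lim <-//; rewrite (_ : lim _ = 0) ?ltW//.
  by apply: cvg_lim => //; exact: cvg_cst.
by exists m; split => //; apply: radon_cvg => f bf; rewrite mL//; exact: cL.
Qed.

End radon_topology.

(** Atoms may repeat and weights may vanish. [Y] is a bare type, so that a combination on [I -> X]
    can also be read on [{ptws I -> X}]. *)
Record finite_comb (R : realType) (Y : Type) := FiniteComb {
  comb_size : nat ;
  weight : 'I_comb_size -> R ;
  atom : 'I_comb_size -> Y ;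
  weight_ge0 : forall i, 0 <= weight i ;
  weight_sum : \sum_i weight i = 1 }.

Arguments comb_size {R Y} f.
Arguments weight {R Y} f i.
Arguments atom {R Y} f i.

Definition comb_int {R : realType} {Y : Type} (s : finite_comb R Y) (f : Y -> R) : R :=
  \sum_i weight s i * f (atom s i).

Definition comb_map {R : realType} {Y Z : Type} (h : Y -> Z) (s : finite_comb R Y) :
  finite_comb R Z := FiniteComb (h \o atom s) (weight_ge0 (f := s)) (weight_sum s).

Section comb_of.
Context {R : realType} {Y : Type} {T : finType} (w : T -> R) (p : T -> Y).
Hypotheses (w0 : forall t, 0 <= w t) (w1 : \sum_t w t = 1).

Let w0' (i : 'I_#|T|) : 0 <= w (enum_val i).
Proof. exact: w0. Qed.

Let w1' : \sum_(i < #|T|) w (enum_val i) = 1.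
Proof. by rewrite -w1 [RHS]big_enum_val. Qed.

Definition comb_of : finite_comb R Y := FiniteComb (p \o enum_val) w0' w1'.

Lemma comb_ofE (f : Y -> R) : comb_int comb_of f = \sum_t w t * f (p t).
Proof. by rewrite /comb_int [RHS]big_enum_val. Qed.

End comb_of.

(** It makes convex combinations meaningful for every real parameter, so that segments of measures
    become maps defined on the whole line. *)
Definition clamp {R : realType} (t : R) : R := Num.max 0 (Num.min 1 t).

Lemma clamp_itv {R : realType} (t : R) : 0 <= clamp t <= 1.
Proof. by rewrite /clamp le_max lexx ge_max ler01 ge_min lexx. Qed.

Lemma clamp_id {R : realType} (t : R) : 0 <= t <= 1 -> clamp t = t.
Proof. by move=> /andP[t0 t1]; rewrite /clamp (min_idPr _)//; exact/max_idPr. Qed.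

Lemma clamp_continuous {R : realType} : continuous (clamp : R -> R).
Proof.
move=> t; rewrite /clamp; apply: continuous_max; first exact: cvg_cst.
by apply: continuous_min; [exact: cvg_cst|exact: cvg_id].
Qed.

Section combinations.
Context {R : realType} {Y : topologicalType}.
Implicit Types (m : radon_prob R Y) (f : Y -> R) (s : finite_comb R Y).

Lemma comb_tight s : tight_state (comb_int s).
Proof.
split.
- move=> f g _ _; rewrite -big_split /=; apply: eq_bigr => i _.
  by rewrite mulrDr.
- move=> c f _; rewrite /comb_int mulr_sumr; apply: eq_bigr => i _.
  by rewrite mulrCA.
- by move=> f _ f0; apply: sumr_ge0 => i _; rewrite mulr_ge0// weight_ge0.
- by rewrite -[RHS](weight_sum s); apply: eq_bigr => i _; rewrite mulr1.
- move=> e e0; exists (\big[setU/set0]_(i < comb_size s) [set atom s i]).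
    by apply: bigsetU_compact => i _; exact: compact_set1.
  move=> f _ _ f0; rewrite /comb_int big1 ?ltW// => i _.
  rewrite f0 ?mulr0//; rewrite (bigD1 i)//=; by left.
Qed.

Lemma mix_tight (t : R) (a b : radon_prob R Y) :
  tight_state (fun f => (1 - clamp t) * rint a f + clamp t * rint b f).
Proof.
have /andP[t0 t1] := clamp_itv t; have t1' : 0 <= 1 - clamp t by rewrite subr_ge0.
have sa := rint_tight a; have sb := rint_tight b.
split.
- by move=> f g bf bg; rewrite (state_add sa)// (state_add sb)//; ring.
- by move=> c f bf; rewrite (state_scale sa)// (state_scale sb)//; ring.
- move=> f bf f0; rewrite addr_ge0// mulr_ge0//; [exact: (state_ge0 sa)|].
  exact: (state_ge0 sb).
- by rewrite (state_one sa) (state_one sb); ring.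
- move=> e e0; have [C cC tC] := state_tight sa e0.
  have [D cD tD] := state_tight sb e0.
  exists (C `|` D); first exact: compactU.
  move=> f bf f01 f0.
  have h1 : rint a f <= e by apply: tC => // x Cx; apply: f0; left.
  have h2 : rint b f <= e by apply: tD => // x Cx; apply: f0; right.
  have -> : e = (1 - clamp t) * e + clamp t * e by ring.
  by rewrite lerD// ler_wpM2l.
Qed.

Hypotheses (crY : completely_regular_space Y) (hY : hausdorff_space Y).

Definition radon_comb s : radon_prob R Y := riesz crY (comb_tight s) hY.

Lemma radon_combE s f : Cb R Y f -> rint (radon_comb s) f = comb_int s f.
Proof. exact: rint_riesz. Qed.

Definition mix (t : R) (a b : radon_prob R Y) : radon_prob R Y :=
  riesz crY (mix_tight t a b) hY.

Lemma mixE t a b f : Cb R Y f ->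
  rint (mix t a b) f = (1 - clamp t) * rint a f + clamp t * rint b f.
Proof. exact: rint_riesz. Qed.

Lemma mix0 a b : mix 0 a b = a.
Proof.
apply: (radon_ext crY hY) => f bf; rewrite mixE// clamp_id ?lexx ?ler01//.
by rewrite subr0 mul1r mul0r addr0.
Qed.

Lemma mix1 a b : mix 1 a b = b.
Proof.
apply: (radon_ext crY hY) => f bf; rewrite mixE// clamp_id ?lexx ?ler01//.
by rewrite subrr mul1r mul0r add0r.
Qed.

Lemma mix_continuous (Z : topologicalType) (t : Z -> R) (a b : Z -> radon_prob R Y) :
  continuous t -> continuous a -> continuous b ->
  continuous (fun z => mix (t z) (a z) (b z)).
Proof.
move=> ct ca cb; apply: radon_continuous => f bf.
under eq_fun do rewrite mixE//.
move=> z.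
have cc : clamp \o t @ z --> clamp (t z).
  by apply: continuous_comp; [exact: ct|exact: clamp_continuous].
have cfa : (fun z => rint (a z) f) @ z --> rint (a z) f.
  by apply: (@continuous_comp _ _ _ a (fun m => rint m f)); [exact: ca|exact: rint_continuous].
have cfb : (fun z => rint (b z) f) @ z --> rint (b z) f.
  by apply: (@continuous_comp _ _ _ b (fun m => rint m f)); [exact: cb|exact: rint_continuous].
apply: cvgD; last exact: cvgM.
by apply: cvgM => //; apply: cvgB => //; exact: cvg_cst.
Qed.

End combinations.

(** * Density of finitely supported measures *)

Section density.
Context {R : realType} {Y : topologicalType}.
Variable m : radon_prob R Y.

Local Notation BY := (borel (radon_nonempty m)).
Local Notation P := (radon_measure m).

(** The range of each function is cut into intervals of length [e]. The shift by [M] in [u] makes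
    the values nonnegative, so that [Num.truncn] numbers the intervals. *)
Lemma finite_level_partition (s : seq (Y -> R)) (e : R) : 0 < e ->
    (forall f, f \in s -> Cb R Y f) ->
  exists (I : finType) (c : Y -> I), (forall i, measurable (c @^-1` [set i] : set BY)) /\
    forall f x y, f \in s -> c x = c y -> `|f x - f y| <= e.
Proof.
move=> e0; elim: s => [|f s ih] bs.
  exists unit, (fun=> tt); split => // -[].
  by rewrite (_ : _ @^-1` _ = setT)//; apply/seteqP; split.
have [I [c [mc oc]]] := ih (fun g gs => bs g (mem_behead (s := f :: s) gs)).
have bf : Cb R Y f by apply: bs; rewrite inE eqxx.
have [M M0 fM] := Cb_ex bf.
pose u x := (f x + M) / e.
have u0 x : 0 <= u x.
  apply: divr_ge0; last exact: ltW.
  by have := fM x; rewrite ler_norml => /andP[? _]; lra.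
pose N := Num.truncn (2 * M / e).
have uN x : (Num.truncn (u x) <= N)%N.
  apply: le_truncn; rewrite /u ler_pM2r ?invr_gt0//.
  by have := fM x; rewrite ler_norml => /andP[_ ?]; lra.
pose k x : 'I_N.+1 := inord (Num.truncn (u x)).
have kE x : k x = Num.truncn (u x) :> nat by rewrite inordK// ltnS.
suff mck (i : I) (j : 'I_N.+1) :
    measurable ((fun x => (c x, k x)) @^-1` [set (i, j)] : set BY).
  exists (I * 'I_N.+1)%type, (fun x => (c x, k x)); split => [[i j]|]; first exact: mck.
  move=> g x y; rewrite inE => /orP[/eqP ->|gs] [cxy kxy]; last exact: oc.
  have : Num.truncn (u x) = Num.truncn (u y) by rewrite -!kE kxy.
  have /andP[x1 x2] := truncn_itv (u0 x); have /andP[y1 y2] := truncn_itv (u0 y).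
  move=> E; rewrite E in x1 x2.
  have : `|u x - u y| <= 1.
    by rewrite ler_norml; move: x2 y2; rewrite -natr1 => x2 y2; apply/andP; split; lra.
  have -> : u x - u y = (f x - f y) / e by rewrite /u; field; rewrite gt_eqF.
  by rewrite normrM normfV (gtr0_norm e0) ler_pdivrMr// mul1r.
have -> : (fun x => (c x, k x)) @^-1` [set (i, j)] =
      c @^-1` [set i] `&` (u @^-1` [set r | j%:R <= r] `\` u @^-1` [set r | j.+1%:R <= r]).
    apply/seteqP; split => x /=.
      move=> E; have <- : c x = i := congr1 fst E.
      have jE : j = Num.truncn (u x) :> nat.
        by rewrite -kE; exact: (congr1 (fun p => nat_of_ord p.2) (esym E)).
      split => //; have /andP[h1 h2] := truncn_itv (u0 x).
      by rewrite jE; split => //; apply/negP; rewrite -ltNge.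
    move=> [<- [h1 /negP]]; rewrite -ltNge => h2; congr (_, _).
    by apply/ord_inj; rewrite kE; apply/truncn_def; rewrite h1 h2.
  have cu : continuous u.
    have [cf _] := bf.
    move=> x; apply: cvgM; last exact: cvg_cst.
    by apply: cvgD; [exact: cf|exact: cvg_cst].
  have mu r : measurable (u @^-1` [set x | r <= x] : set BY).
    rewrite -[X in measurable X]setCK; apply: measurableC; apply: borel_open.
    by apply: closed_openC; apply: ((continuous_closedP u).1 cu); exact: closed_ge.
  by apply: measurableI => //; exact: measurableD.
Qed.

Lemma Rintegral_sum_indic (I : finType) (A : I -> set BY) (a : I -> R) :
  (forall i, measurable (A i)) ->
  P.-integrable setT (EFin \o (fun x : BY => \sum_i a i * \1_(A i) x)) /\
  \int[P]_x (\sum_i a i * \1_(A i) x) = \sum_i a i * fine (P (A i)).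
Proof.
move=> mA.
have int i : P.-integrable setT (EFin \o (fun x : BY => a i * \1_(A i) x)).
  exact: (integrableZl measurableT (a i) (indic_integrable P (mA i))).
suff H (r : seq I) : P.-integrable setT (EFin \o (fun x : BY => \sum_(i <- r) a i * \1_(A i) x)) /\
    \int[P]_x (\sum_(i <- r) a i * \1_(A i) x) = \sum_(i <- r) a i * fine (P (A i)).
  exact: H.
elim: r => [|i r [ih1 ih2]].
  rewrite big_nil (_ : (fun x => _) = fun=> 0); last by apply/funext => x; rewrite big_nil.
  split; last by rewrite Rintegral_cst// mul0r.
  by rewrite (_ : _ \o _ = cst 0%E)//; exact: integrable0.
rewrite big_cons.
rewrite (_ : (fun x => _) = fun x => a i * \1_(A i) x + \sum_(i <- r) a i * \1_(A i) x); last first.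
  by apply/funext => x; rewrite big_cons.
split; first exact: (integrableD measurableT (int i) ih1).
rewrite RintegralD// ih2 RintegralZl// ?Rintegral_indicT//.
exact: indic_integrable.
Qed.

(** The mass of each piece of a fine partition is concentrated at one of its points. Asking for
    atoms in [Z] lets a measure carried by the zero set of a pseudometric be approximated from
    within that set. *)
Lemma finite_comb_approx (Z : set Y) (s : seq (Y -> R)) (e : R) :
    closed Z -> P (~` Z) = 0%E -> 0 < e -> (forall f, f \in s -> Cb R Y f) ->
  exists2 c : finite_comb R Y, forall i, Z (atom c i) &
    forall f, f \in s -> `|comb_int c f - rint m f| < e.
Proof.
move=> cZ PZ e0 bs; have e2 : 0 < e / 2 by lra.
have mZ : measurable (~` Z : set BY) by apply: borel_open; exact: closed_openC.
have [z0 Zz0] : Z !=set0.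
  apply/set0P/eqP => Z0; move: PZ; rewrite Z0 setC0.
  have := probability_setT P; move=> /= -> /eqP; by rewrite onee_eq0.
have [I [c [mc oc]]] := finite_level_partition e2 bs.
pose w i := fine (P (c @^-1` [set i])).
(* A piece that misses [Z] has mass zero, so the default atom [z0] does no harm. *)
pose p i := if pselect (exists2 x, Z x & c x = i) is left h then s2val (cid2 h) else z0.
have Zp i : Z (p i).
  by rewrite /p; case: pselect => // h; case: (cid2 h).
have cp x : Z x -> c (p (c x)) = c x.
  move=> Zx; rewrite /p; case: pselect => [h|[]]; last by exists x.
  by case: (cid2 h).
have w0 i : 0 <= w i by rewrite /w fine_ge0.
have sumE (a : I -> R) x : \sum_i a i * \1_(c @^-1` [set i]) x = a (c x) :> R.
  rewrite (bigD1 (c x))//= big1 ?addr0.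
    by rewrite indicE mem_set// mulr1.
  move=> i ic; rewrite indicE memNset ?mulr0//= => ci.
  by rewrite ci eqxx in ic.
have w1 : \sum_i w i = 1.
  have [_ h] := Rintegral_sum_indic (fun=> 1) mc.
  transitivity (\sum_i 1 * w i); first by apply: eq_bigr => i _; rewrite mul1r.
  rewrite -h -[RHS](state_one (rint_tight m)) /rint.
  by apply: eq_Rintegral => x _; exact: (sumE (fun=> 1)).
exists (comb_of p w0 w1) => [i|f fs]; first exact: Zp.
have [i1 i2] := Rintegral_sum_indic (fun i => f (p i)) mc.
have bf := bs f fs; have [M M0 fM] := Cb_ex bf.
have -> : comb_int (comb_of p w0 w1) f = \int[P]_x f (p (c x)).
  rewrite comb_ofE; transitivity (\sum_i f (p i) * w i).
    by apply: eq_bigr => i _; rewrite mulrC.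
  by rewrite -i2; apply: eq_Rintegral => x _; exact: (sumE (fun i => f (p i))).
have i1' : P.-integrable setT (EFin \o (fun x : BY => f (p (c x)))).
  apply: eq_integrable i1 => // x _ /=; congr EFin.
  exact: (sumE (fun i => f (p i))).
have if_ := Cb_integrable P bf.
rewrite /rint -RintegralB//.
have iB := integrableB measurableT i1' if_.
apply: (le_lt_trans (le_normr_Rintegral measurableT iB)).
(* The majorant is [e / 2] on [Z], where [x] and its atom lie in the same piece, and has the trivial
   bound [2 * M] added off [Z], which is a null set. *)
have iC : P.-integrable setT (EFin \o (fun x : BY => e / 2 + 2 * M * \1_(~` Z) x)).
  apply: (@integrableD _ BY R P setT measurableT (cst (e / 2)%:E)
    (EFin \o (fun x : BY => 2 * M * \1_(~` Z) x))).
    exact: finite_measure_integrable_cst.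
  exact: (integrableZl measurableT (2 * M) (indic_integrable P mZ)).
apply: (@le_lt_trans _ _ (\int[P]_x (e / 2 + 2 * M * \1_(~` Z) x))).
  apply: le_Rintegral => //; first exact: integrable_norm.
  move=> x _; rewrite indicE.
  have [Zx|nZx] := pselect (Z x).
    rewrite memNset ?mulr0 ?addr0//.
    by apply: oc => //; exact: cp.
  rewrite mem_set// mulr1 (le_trans (ler_normB _ _))//.
  by have := fM (p (c x)); have := fM x; lra.
rewrite RintegralD//; first last.
- exact: (integrableZl measurableT (2 * M) (indic_integrable P mZ)).
- exact: finite_measure_integrable_cst.
rewrite (RintegralZl (2 * M) measurableT (indic_integrable P mZ)).
rewrite Rintegral_indicT// PZ mulr0 addr0 Rintegral_cst//.
have -> : fine (P setT) = 1 := congr1 fine (probability_setT P).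
by rewrite mulr1; lra.
Qed.

End density.

Lemma cvg_finite_sum {R : realType} (I T : Type) (F : set_system T) (r : seq I)
    (P : pred I) (u : I -> T -> R) (l : I -> R) : Filter F ->
    (forall i, P i -> u i @ F --> l i) ->
  (fun x => \sum_(i <- r | P i) u i x) @ F --> \sum_(i <- r | P i) l i.
Proof.
move=> FF ul; apply: (@cvg_big R I +%R 0 P) => //.
by move=> [x y]; apply: cvgD; [exact: cvg_fst|exact: cvg_snd].
Qed.

(** Without such a point the functions [g n] vanish locally from some index on, so the sum of the
    [n * g n] is finite near every point, hence continuous. It is unbounded because each [g n]
    reaches [1]. *)
Lemma pseudocompact_cluster {R : realType} {T : topologicalType} (g : nat -> T -> R) :
    pseudocompact R T -> (forall n, continuous (g n)) ->
    (forall n x, 0 <= g n x) -> (forall n, exists x, 1 <= g n x) ->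
  exists x : T, forall A, nbhs x A -> forall N, exists n, (N <= n)%N /\
    exists2 y, A y & 0 < g n y.
Proof.
move=> pT cg g0 g1; apply: contrapT => nex.
have H (x : T) : exists AN : set T * nat, nbhs x AN.1 /\
    forall n y, (AN.2 <= n)%N -> AN.1 y -> g n y = 0.
  apply: contrapT => nH; apply: nex; exists x => A nA N.
  apply: contrapT => nE; apply: nH; exists (A, N); split => // n y Nn Ay /=.
  apply/eqP; rewrite eq_le g0 andbT leNgt; apply/negP => gy.
  by apply: nE; exists n; split => //; exists y.
have /choice[AN ANP] := H.
pose G x : R := \sum_(n < (AN x).2) n%:R * g n x.
have GE (y : T) N : (forall n, (N <= n)%N -> g n y = 0) ->
    \sum_(n < N) n%:R * g n y = G y.
  move=> gN0; rewrite /G.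
  have ext K K' : (K <= K')%N -> (forall n, (K <= n)%N -> g n y = 0) ->
      \sum_(n < K) n%:R * g n y = \sum_(n < K') n%:R * g n y.
    move=> KK' gK; rewrite -(subnKC KK') big_split_ord /= [X in _ + X]big1 ?addr0//.
    by move=> i _; rewrite gK ?mulr0// leq_addr.
  rewrite (ext N (maxn N (AN y).2)) ?leq_maxl//.
  rewrite -(ext (AN y).2) ?leq_maxr// => n Nn.
  by apply: (ANP y).2 => //; exact: nbhs_singleton (ANP y).1.
have cG : continuous G.
  move=> x; have [nA gA] := ANP x.
  have cS : (fun y => \sum_(n < (AN x).2) n%:R * g n y) @ x --> G x.
    apply: cvg_finite_sum => n _.
    by apply: cvgM; [exact: cvg_cst|exact: cg].
  apply: cvg_trans cS; apply: near_eq_cvg.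
  by apply: filterS nA => y Ay; rewrite -(GE y (AN x).2)// => n Nn; exact: gA.
have /bounded_funP[M GM] := pT G cG.
pose n := (Num.truncn M).+1.
have Mn : M < n%:R by exact: truncnS_gt.
have [x gx] := g1 n.
have nx : (n < (AN x).2)%N.
  rewrite ltnNge; apply/negP => /(ANP x).2 /(_ (nbhs_singleton (ANP x).1)) g00.
  by move: gx; rewrite g00 ler10.
have : n%:R <= G x.
  rewrite /G (bigD1 (Ordinal nx))//= -[leLHS]addr0 lerD//.
    by rewrite -[leLHS]mulr1 ler_wpM2l.
  by apply: sumr_ge0 => i _; rewrite mulr_ge0.
have := GM x; have := ler_norm (G x); lra.
Qed.

Section radon_density.
Context {R : realType} {X : topologicalType}.
Hypotheses (crX : completely_regular_space X) (hX : hausdorff_space X).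

Lemma radon_comb_approx (m : radon_prob R X) (Z : set X) A : closed Z ->
    radon_measure m (~` Z) = 0%E -> nbhs m A ->
  exists2 c : finite_comb R X, forall i, Z (atom c i) & A (radon_comb crX hX c).
Proof.
move=> cZ mZ /radon_nbhs_basis[s [e [e0 bs sA]]].
have [c Zc cm] := finite_comb_approx cZ mZ e0 bs.
exists c => //; apply: sA => f fs; rewrite radon_combE; last exact: bs.
exact: cm.
Qed.

Lemma radon_comb_dense (m : radon_prob R X) A : nbhs m A ->
  exists c : finite_comb R X, A (radon_comb crX hX c).
Proof.
move=> nA; have [|c _ Ac] := radon_comb_approx closedT _ nA; last by exists c.
by rewrite setCT measure0.
Qed.

End radon_density.

(** * Finite powers of a space *)

Section products.
Context {R : realType} {X : topologicalType} {I : finType}.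

Lemma product_hausdorff : hausdorff_space X -> hausdorff_space {ptws I -> X}.
Proof. by move=> hX; apply: (@hausdorff_product I (fun=> X)). Qed.

(** Complete regularity means that a uniformity induces the topology, and uniformities are stable
    under products. *)
Lemma product_completely_regular :
  completely_regular_space X -> completely_regular_space {ptws I -> X}.
Proof.
move=> crX.
exact: (@uniform_completely_regular R
  (prod_topology (fun _ : I => @completely_regular_uniformity.type R _ crX))).
Qed.

Lemma product_proj_continuous (i : I) :
  continuous ((fun y => y i) : {ptws I -> X} -> X).
Proof. exact: (@proj_continuous I (fun=> X) i). Qed.

Lemma product_cvg (T : Type) (F : set_system T) (u : T -> {ptws I -> X})
    (x : {ptws I -> X}) : Filter F ->
  (forall i, (fun a => u a i) @ F --> x i) -> u @ F --> x.
Proof.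
move=> FF cu; apply/cvg_sup => i A [_ [[B oB <-] Bx BA]].
by apply: filterS BA _; apply: (cu i); exact: open_nbhs_nbhs.
Qed.

(** As in [radon_nbhs_basis], the sets containing a box around [x] form a filter that converges to
    [x]. *)
Lemma product_nbhs_box (x : {ptws I -> X}) (A : set {ptws I -> X}) : nbhs x A ->
  exists Q : I -> set X, [/\ forall i, open (Q i), forall i, Q i (x i) &
    forall y : {ptws I -> X}, (forall i, Q i (y i)) -> A y].
Proof.
pose F : set_system {ptws I -> X} := [set A | exists Q : I -> set X,
  [/\ forall i, open (Q i), forall i, Q i (x i) &
    forall y : {ptws I -> X}, (forall i, Q i (y i)) -> A y]].
have FF : Filter F.
  split.
  - by exists (fun=> setT); split => // i; exact: openT.
  - move=> C D [Q [oQ xQ QC]] [Q' [oQ' xQ' QD]].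
    exists (fun i => Q i `&` Q' i); split.
    + by move=> i; exact: openI.
    + by move=> i; split.
    + by move=> y Oy; split; [apply: QC|apply: QD] => i; have [] := Oy i.
  - by move=> C D CD [Q [oQ xQ QC]]; exists Q; split => // y /QC /CD.
suff : F --> x by move=> h nA; exact: h nA.
apply: (@product_cvg _ F id) => i B.
rewrite nbhsE => -[C [oC Cx] CB].
exists (fun j => if j == i then C else setT); split.
- by move=> j; case: ifP => // _; exact: openT.
- by move=> j; case: eqP => [->|].
- by move=> y /(_ i); rewrite eqxx => /CB.
Qed.

(* If no neighbourhood [V] of [C] worked, a point of [V^I] outside [W] for each
   [V] would give a net accumulating at a point of [C^I]. *)
Lemma compact_power_tube (C : set X) (W : set {ptws I -> X}) :
    compact C -> open W -> (forall y : {ptws I -> X}, (forall i, C (y i)) -> W y) ->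
  exists V, [/\ open V, C `<=` V &
    forall y : {ptws I -> X}, (forall i, V (y i)) -> W y].
Proof.
move=> cC oW CW; apply: contrapT => nV.
have bad V : open V -> C `<=` V ->
    exists y : {ptws I -> X}, (forall i, V (y i)) /\ ~ W y.
  move=> oV CV; apply: contrapT => nb; apply: nV; exists V; split => // y Vy.
  by apply: contrapT => nWy; apply: nb; exists y.
pose F : set_system {ptws I -> X} := [set S | exists V, [/\ open V, C `<=` V &
  forall y, (forall i, V (y i)) -> ~ W y -> S y]].
have FF : ProperFilter F.
  apply: Build_ProperFilter_ex.
    by move=> S [V [oV CV VS]]; have [y [Vy Wy]] := bad V oV CV; exists y; exact: VS.
  split.
  - by exists setT; split => //; exact: openT.
  - move=> S S' [V [oV CV VS]] [V' [oV' CV' VS']].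
    exists (V `&` V'); split; first exact: openI.
      by move=> x Cx; split; [exact: CV|exact: CV'].
    by move=> y Vy nWy; split; [apply: VS|apply: VS'] => // i; have [] := Vy i.
  - by move=> S S' SS' [V [oV CV VS]]; exists V; split => // y Vy nWy; exact/SS'/VS.
have [U [UU FU]] := ultraFilterLemma FF.
have lim i : exists2 x, C x & (fun y : {ptws I -> X} => y i) @ U --> x.
  apply: contrapT => nx.
  (* If coordinate [i] had no limit in [C], compactness would give an open set around [C] that this
     coordinate avoids along [U], whereas [U] concentrates on every power [V^I] with [V] open around
     [C]. *)
  pose good A := exists2 V, open V /\ A `<=` V & U [set y | ~ V (y i)].
  have [V [oV CV] UV] : good C.
    apply: compact_induction => //.
    - exists set0; first by split => //; exact: open0.
      by apply: (filterS _ filterT) => y _ [].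
    - by move=> A B AB [V [oV BV] UV]; exists V => //; split => //; exact: subset_trans BV.
    - move=> A B [V [oV AV] UV] [V' [oV' BV'] UV']; exists (V `|` V').
        by split; [exact: openU|exact: setUSS].
      by apply: filterS2 UV UV' => y /= h h' [|].
    - move=> x Cx; apply: contrapT => nV'; apply: nx; exists x => // A.
      rewrite nbhsE => -[B [oB Bx] BA].
      have [UB|UB] := in_ultra_setVsetC [set y : {ptws I -> X} | B (y i)] UU.
        by apply: filterS UB => y /BA.
      case: nV'; exists B; first exact: open_nbhs_nbhs.
      by exists B; [split|exact: UB].
  have : U [set y | V (y i)] by apply: FU; exists V; split => // y + _; exact.
  move=> UV'; have [y [h h']] := filter_ex (filterI UV UV').
  exact: h.
have /choice[x xP] : forall i, exists x, C x /\ (fun y : {ptws I -> X} => y i) @ U --> x.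
  by move=> i; have [x] := lim i; exists x.
have cUx : U --> (x : {ptws I -> X}).
  by apply: (@product_cvg _ U id) => i; exact: (xP i).2.
have Wx : W x by apply: CW => i; exact: (xP i).1.
have UW : U W by apply: cUx; exact: open_nbhs_nbhs.
have UnW : U (~` W) by apply: FU; exists setT; split => //; exact: openT.
by have [y []] := filter_ex (filterI UW UnW).
Qed.

End products.

(** * Couplings and cluster points *)

Lemma min_positive {R : realType} (K : finType) (w : K -> R) :
  exists2 eta : R, 0 < eta & forall p, 0 < w p -> eta <= w p.
Proof.
suff [eta e0 ew] : exists2 eta : R, 0 < eta & forall p, p \in enum K -> 0 < w p -> eta <= w p.
  by exists eta => // p; apply: ew; rewrite mem_enum.
elim: (enum K) => [|q r [eta e0 ih]]; first by exists 1.
have [wq|wq] := ltP 0 (w q).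
  exists (Num.min eta (w q)); first by rewrite lt_min e0.
  move=> p; rewrite inE => /orP[/eqP ->|pr] wp; first by rewrite ge_min lexx orbT.
  by rewrite ge_min ih.
exists eta => // p; rewrite inE => /orP[/eqP -> wp|]; last exact: ih.
by move: wq; rewrite leNgt wp.
Qed.

Section splitting.
Context {R : realType} {X : topologicalType}.
Hypotheses (crX : completely_regular_space X) (hX : hausdorff_space X).

(* Points [x p] may coincide; then the common mass is shared among the
   functions [h p] proportionally to the weights. *)
Lemma splitting_functions (K : finType) (w : K -> R) (x : K -> X) (U : K -> set X) :
    (forall p, 0 <= w p) -> (forall p, open (U p)) -> (forall p, U p (x p)) ->
  exists h : K -> X -> R, [/\ forall p, Cb R X (h p), forall p y, 0 <= h p y,
    forall y, \sum_p h p y <= 1, forall p y, ~ U p y -> h p y = 0 &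
    forall p, \sum_q w q * h p (x q) = w p].
Proof.
move=> w0 oU Ux; have [eta e0 ew] := min_positive w.
have /choice[a aP] : forall p, exists a : X -> R, [/\ Cb R X a,
    forall y, 0 <= a y <= 1, forall q, a (x q) = (x q == x p)%:R &
    forall y, ~ U p y -> a y = 0].
  move=> p; pose F := \big[setU/set0]_(q | x q != x p) [set x q].
  have cF : closed F.
    by apply: compact_closed => //; apply: bigsetU_compact => q _; exact: compact_set1.
  have inF q : x q != x p -> F (x q).
    by move=> xqp; rewrite /F (bigD1 q)//=; left.
  have nF : ~ F (x p).
    rewrite /F; elim/big_ind: _ => //; first by move=> A B nA nB [].
    by move=> q /eqP xqp /= /esym.
  have [a [ba a01 ax a0]] := @cr_bump R X crX (x p) (U p `&` ~` F)
    (openI (oU p) (closed_openC cF)) (conj (Ux p) nF).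
  exists a; split => //; last by move=> y nUy; apply: a0 => -[].
  move=> q; have [->//|xqp] := eqVneq (x q) (x p); apply: a0 => -[_]; apply.
  exact: inF.
have ba p : Cb R X (a p) by have [] := aP p.
have a0 p y : 0 <= a p y by have [_ /(_ y)/andP[]] := aP p.
pose S y := \sum_p w p * a p y.
have bS : Cb R X S by apply: Cb_sum => p _; exact: Cb_scale.
have S0 y : 0 <= S y by apply: sumr_ge0 => p _; rewrite mulr_ge0.
(* The lower bound [eta] keeps the quotient continuous everywhere. It does not alter [S] at an atom
   of positive weight, where [S] is at least that weight. *)
pose D y := Num.max eta (S y).
have De y : eta <= D y by rewrite le_max lexx.
have D0 y : 0 < D y := lt_le_trans e0 (De y).
have bD : Cb R X (fun y => (D y)^-1).
  by apply: (Cb_inv e0) => //; apply: Cb_max => //; exact: Cb_cst.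
exists (fun p y => w p * a p y * (D y)^-1); split.
- by move=> p; apply: Cb_mul => //; exact: Cb_scale.
- by move=> p y; rewrite !mulr_ge0// invr_ge0 ltW.
- move=> y; rewrite -mulr_suml ler_pdivrMr// mul1r.
  by rewrite /D le_max lexx orbT.
- by move=> p y nUy; have [_ _ _ ->] := aP p; rewrite ?mulr0 ?mul0r.
- move=> p; have [wp|wp] := ltP 0 (w p); last first.
    have -> : w p = 0 by apply/eqP; rewrite eq_le wp w0.
    by rewrite big1// => q _; rewrite !mul0r mulr0.
  have axE q : a p (x q) = (x q == x p)%:R by have [] := aP p.
  have axE' q : a q (x p) = (x q == x p)%:R.
    by have [_ _ -> _] := aP q; rewrite eq_sym.
  have Sp : S (x p) = \sum_(q | x q == x p) w q.
    rewrite /S [RHS]big_mkcond; apply: eq_bigr => q _; rewrite axE'.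
    by case: eqP => _; rewrite ?mulr1 ?mulr0.
  have wSp : w p <= S (x p).
    by rewrite Sp (bigD1 p)//= lerDl sumr_ge0.
  have DS : D (x p) = S (x p).
    by apply/max_idPr; exact: le_trans (ew p wp) wSp.
  transitivity (\sum_(q | x q == x p) w q * (w p / S (x p))).
    rewrite [RHS]big_mkcond; apply: eq_bigr => q _; rewrite axE.
    by case: eqP => [->|_]; rewrite ?DS ?mulr1// mulr0 mul0r mulr0.
  rewrite -mulr_suml -Sp mulrC divfK// gt_eqF//.
  exact: lt_le_trans wp wSp.
Qed.

(** Split [c] into its parts [h p * c] and the remainder. Giving part [p] the mass [w p] costs
    [|c (h p) - w p|], and the mass of the remainder is the sum of the [w p - c (h p)]; the two
    contributions explain the factor 2. *)
Lemma splitting_approx (K : finType) (w : K -> R) (h : K -> X -> R)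
    (c : finite_comb R X) (f : X -> R) (M : R) :
    (forall p, 0 <= w p) -> \sum_p w p = 1 ->
    (forall p y, 0 <= h p y) -> (forall y, \sum_p h p y <= 1) ->
    (forall p, 0 < w p -> 0 < comb_int c (h p)) ->
    (forall y, `|f y| <= M) ->
  `|comb_int c f -
    \sum_p w p * \sum_l weight c l * h p (atom c l) / comb_int c (h p) * f (atom c l)|
  <= (\sum_p `|comb_int c (h p) - w p|) *+ 2 * M.
Proof.
move=> w0 w1 h0 h1 hc fM.
pose A p := \sum_l weight c l * h p (atom c l) * f (atom c l).
have AM p : `|A p| <= comb_int c (h p) * M.
  rewrite /A (le_trans (ler_norm_sum _ _ _))// mulr_suml ler_sum// => l _.
  rewrite normrM ger0_norm; last by rewrite mulr_ge0// weight_ge0.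
  by rewrite ler_wpM2l// mulr_ge0// weight_ge0.
have M0 : 0 <= M.
  have [l _|c0] := pickP (xpredT : pred 'I_(comb_size c)).
    exact: le_trans (normr_ge0 _) (fM (atom c l)).
  by have /esym/eqP := weight_sum c; rewrite big_pred0// oner_eq0.
rewrite (_ : \sum_p _ = \sum_p w p * (A p / comb_int c (h p))); last first.
  apply: eq_bigr => p _; congr (_ * _); rewrite /A mulr_suml.
  by apply: eq_bigr => l _; rewrite mulrAC.
have -> : comb_int c f = \sum_p A p +
    \sum_l weight c l * (1 - \sum_p h p (atom c l)) * f (atom c l).
  rewrite /A exchange_big /= -big_split /=; apply: eq_bigr => l _.
  by rewrite -mulr_suml -mulrDl -mulr_sumr -mulrDr addrCA subrr addr0 mulr1.
rewrite addrAC -sumrB mulr2n mulrDl (le_trans (ler_normD _ _))// lerD//.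
  rewrite (le_trans (ler_norm_sum _ _ _))// mulr_suml ler_sum// => p _.
  have [wp|wp] := ltP 0 (w p).
    have hp := hc p wp.
    have -> : A p - w p * (A p / comb_int c (h p)) =
        (comb_int c (h p) - w p) * (A p / comb_int c (h p)).
      by field; rewrite gt_eqF.
    rewrite normrM ler_wpM2l// normrM normfV (gtr0_norm hp).
    by rewrite ler_pdivrMr// mulrC.
  have -> : w p = 0 by apply/eqP; rewrite eq_le wp w0.
  rewrite mul0r !subr0 (le_trans (AM p))// ler_wpM2r//; exact: ler_norm.
have le1 l : 0 <= 1 - \sum_p h p (atom c l) by rewrite subr_ge0.
apply: (@le_trans _ _ (\sum_l weight c l * (1 - \sum_p h p (atom c l)) * M)).
  rewrite (le_trans (ler_norm_sum _ _ _))// ler_sum// => l _.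
  rewrite normrM ger0_norm; last by rewrite mulr_ge0// weight_ge0.
  by rewrite ler_wpM2l// mulr_ge0// weight_ge0.
rewrite -mulr_suml ler_wpM2r//.
under eq_bigr do rewrite mulrBr mulr1 mulr_sumr.
rewrite sumrB weight_sum exchange_big /= -{1}w1 -sumrB.
apply: ler_sum => p _; rewrite distrC; exact: ler_norm.
Qed.

End splitting.

Section tensor.
Context {R : realType} {X : Type} (I J L : finType).
Variables (t : J -> R) (u : J -> I -> L -> R) (z : L -> X).
Hypotheses (t0 : forall j, 0 <= t j) (t1 : \sum_j t j = 1).
Hypotheses (u0 : forall j i l, 0 <= u j i l).
Hypothesis u1 : forall j i, 0 < t j -> \sum_l u j i l = 1.

(** A mixture of product measures: [j] has probability [t j], and given [j] the coordinates are
    independent with laws [u j i]. *)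
Definition tensor_weight (p : J * {ffun I -> L}) : R :=
  t p.1 * \prod_i u p.1 i (p.2 i).

Lemma tensor_weight_ge0 p : 0 <= tensor_weight p.
Proof. by rewrite mulr_ge0//; apply: prodr_ge0. Qed.

Let tensor_sum (F : J -> I -> L -> R) :
  \sum_(p : J * {ffun I -> L}) t p.1 * \prod_i (u p.1 i (p.2 i) * F p.1 i (p.2 i)) =
  \sum_j t j * \prod_i \sum_l u j i l * F j i l.
Proof.
rewrite -(pair_bigA _ (fun j (s : {ffun I -> L}) => t j * \prod_i (u j i (s i) * F j i (s i)))) /=.
by apply: eq_bigr => j _; rewrite -mulr_sumr bigA_distr_bigA.
Qed.

Lemma tensor_weight_sum : \sum_p tensor_weight p = 1.
Proof.
transitivity (\sum_(p : J * {ffun I -> L}) t p.1 * \prod_i (u p.1 i (p.2 i) * 1)).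
  by apply: eq_bigr => p _; congr (_ * _); apply: eq_bigr => i _; rewrite mulr1.
rewrite (tensor_sum (fun _ _ _ => 1)) -[RHS]t1; apply: eq_bigr => j _.
have [tj|tj] := ltP 0 (t j).
  rewrite big1 ?mulr1// => i _; rewrite -[RHS](u1 i tj).
  by apply: eq_bigr => l _; rewrite mulr1.
have -> : t j = 0 by apply/eqP; rewrite eq_le tj t0.
by rewrite mul0r.
Qed.

Definition tensor : finite_comb R (I -> X) :=
  comb_of (fun p : J * {ffun I -> L} => (fun i => z (p.2 i)) : I -> X)
    tensor_weight_ge0 tensor_weight_sum.

Lemma tensor_marginal (i : I) (f : X -> R) :
  comb_int tensor (fun y => f (y i)) = \sum_j t j * \sum_l u j i l * f (z l).
Proof.
rewrite comb_ofE.
transitivity (\sum_(p : J * {ffun I -> L}) t p.1 *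
    \prod_k (u p.1 k (p.2 k) * (if k == i then f (z (p.2 k)) else 1))).
  apply: eq_bigr => p _; rewrite /tensor_weight -mulrA big_split /=; congr (_ * (_ * _)).
  rewrite (bigD1 i)//= eqxx big1 ?mulr1//.
  by move=> k /negbTE ->.
rewrite (tensor_sum (fun _ k l => if k == i then f (z l) else 1)).
apply: eq_bigr => j _; have [tj|tj] := ltP 0 (t j); last first.
  have -> : t j = 0 by apply/eqP; rewrite eq_le tj t0.
  by rewrite !mul0r.
congr (_ * _); rewrite (bigD1 i)//= eqxx [X in _ * X]big1 ?mulr1// => k /negbTE ->.
by rewrite -[RHS](u1 k tj); apply: eq_bigr => l _; rewrite mulr1.
Qed.

Lemma tensor_le (f : (I -> X) -> R) (b : J -> R) :
    (forall j y, (forall i, exists2 l, 0 < u j i l & y i = z l) -> f y <= b j) ->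
  comb_int tensor f <= \sum_j t j * b j.
Proof.
move=> fb.
have -> : \sum_j t j * b j = \sum_(p : J * {ffun I -> L}) tensor_weight p * b p.1.
  rewrite -(pair_bigA _ (fun j (s : {ffun I -> L}) => tensor_weight (j, s) * b j)) /=.
  apply: eq_bigr => j _; rewrite -mulr_suml; have [tj|tj] := ltP 0 (t j).
    rewrite /tensor_weight /= -mulr_sumr -bigA_distr_bigA big1 ?mulr1// => i _.
    exact: u1.
  have tj0 : t j = 0 by apply/eqP; rewrite eq_le tj t0.
  by rewrite /tensor_weight /= tj0 mul0r big1 ?mul0r// => s _; rewrite mul0r.
rewrite comb_ofE; apply: ler_sum => p _.
have [|] := ltP 0 (tensor_weight p) => wp; last first.
  have -> : tensor_weight p = 0 by apply/eqP; rewrite eq_le wp tensor_weight_ge0.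
  by rewrite !mul0r.
rewrite ler_pM2l//; apply: fb => i; exists (p.2 i) => //.
rewrite lt_neqAle u0 andbT eq_sym; apply/eqP => u00.
by move: wp; rewrite /tensor_weight (bigD1 i)//= u00 mul0r mulr0 ltxx.
Qed.

End tensor.

Section power_tight.
Context {R : realType} {X : topologicalType} {I : finType}.
Hypotheses (crX : completely_regular_space X).

(** If [f] vanishes on [C^I], it is below [e / 2] on some [V^I]. With a bump [h] that is [1] on [C]
    and [0] off [V], [f] is at most [e / 2] plus the sum of the [1 - h (y i)], and the marginals
    make these terms small. *)
Lemma power_tight (L : ({ptws I -> X} -> R) -> R) (m : (X -> R) -> R) (k : R) :
    tight_state m ->
    (forall f g, Cb R _ f -> Cb R _ g -> (forall x, f x <= g x) -> L f <= L g) ->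
    (forall e (f : I -> X -> R), (forall i, Cb R X (f i)) ->
       L (fun y => e + \sum_i f i (y i)) = e + \sum_i L (fun y => f i (y i))) ->
    (forall i f, Cb R X f -> (forall x, 0 <= f x) -> L (fun y => f (y i)) <= k * m f) ->
  forall e, 0 < e -> exists2 C : set {ptws I -> X}, compact C &
      forall f, Cb R _ f -> (forall x, 0 <= f x <= 1) ->
        (forall x, C x -> f x = 0) -> L f <= e.
Proof.
move=> tm Lmono Lsum Lm e e0; have e2 : 0 < e / 2 by lra.
(* There are [#|I|] marginals, each dominated with factor [k]; the summand [1] keeps the divisor
   positive. *)
pose N : R := 1 + `|k| *+ #|I|.
have N0 : 0 < N by rewrite ltr_wpDr// mulrn_wge0.
have eN : 0 < e / 2 / N by rewrite divr_gt0.
have [C cC tC] := state_tight tm eN.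
exists [set y : {ptws I -> X} | forall i, C (y i)].
  exact: (@tychonoff I (fun=> X) (fun=> C)).
move=> f bf f01 f0.
have oW : open [set y | f y < e / 2].
  by have [cf _] := bf; apply: ((continuousP f).1 cf [set r | r < e / 2]); exact: open_lt.
have [|V [oV CV VW]] := compact_power_tube cC oW.
  by move=> y Cy /=; rewrite f0.
have [h [bh h01 h1 h0]] := @cr_bump_compact R X crX C V cC oV CV.
have b1h i : Cb R {ptws I -> X} (fun y => 1 - h (y i)).
  apply: Cb_sub; first exact: Cb_cst.
  exact: (Cb_comp (@product_proj_continuous X I i) bh).
have b1 : Cb R X (fun x => 1 - h x) by apply: Cb_sub => //; exact: Cb_cst.
apply: (@le_trans _ _ (L (fun y => e / 2 + \sum_i (1 - h (y i))))).
  apply: Lmono => //; first by apply: Cb_add; [exact: Cb_cst|exact: Cb_sum].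
  move=> y.
  have S0 : 0 <= \sum_i (1 - h (y i)).
    by apply: sumr_ge0 => i _; rewrite subr_ge0; have /andP[] := h01 (y i).
  have [Vy|/existsNP[i nVy]] := pselect (forall i, V (y i)).
    by rewrite -[leLHS]addr0 lerD// ltW//; exact: VW.
  have /andP[_ /le_trans] := f01 y; apply.
  rewrite (bigD1 i)//= (h0 _ nVy) subr0 addrCA lerDl addr_ge0//; first exact: ltW.
  by apply: sumr_ge0 => j _; rewrite subr_ge0; have /andP[] := h01 (y j).
rewrite (Lsum _ (fun=> (fun x => 1 - h x)))//.
have le1 : m (fun x => 1 - h x) <= e / 2 / N.
  apply: tC => //.
    by move=> x; have /andP[? ?] := h01 x; apply/andP; split; lra.
  by move=> x Cx; rewrite h1// subrr.
have m0 : 0 <= m (fun x => 1 - h x).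
  by apply: (state_ge0 tm) => // x; rewrite subr_ge0; have /andP[] := h01 x.
have : \sum_(i : I) L (fun y => 1 - h (y i)) <= \sum_(i : I) `|k| * (e / 2 / N).
  apply: ler_sum => i _; apply: le_trans (Lm i _ b1 _) _.
    by move=> x; rewrite subr_ge0; have /andP[] := h01 x.
  apply: (@le_trans _ _ (`|k| * m (fun x => 1 - h x))).
    by rewrite ler_wpM2r// ler_norm.
  by rewrite ler_wpM2l.
have : \sum_(i : I) `|k| * (e / 2 / N) <= e / 2.
  have -> : \sum_(i : I) `|k| * (e / 2 / N) = e / 2 * (`|k| *+ #|I| / N).
    by rewrite sumr_const -mulrnAl mulrCA.
  rewrite ler_piMr//; first exact: ltW.
  by rewrite ler_pdivrMr// mul1r /N lerDr.
lra.
Qed.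

End power_tight.

Section coupling_cluster.
Context {R : realType} {X : topologicalType} {I : finType}.
Hypotheses (crX : completely_regular_space X) (hX : hausdorff_space X).
Hypotheses (pX : pseudocompact R (radon_prob R X)) (I0 : (0 < #|I|)%N).
Variable s : nat -> finite_comb R (I -> X).
Variable U : forall n, 'I_(comb_size (s n)) -> I -> set X.
Arguments U : clear implicits.
Hypotheses (oU : forall n j i, open (U n j i)).
Hypotheses (sU : forall n j i, U n j i (atom (s n) j i)).

Local Notation k := (#|I|%:R : R).
Let k0 : 0 < k. Proof. by rewrite ltr0n. Qed.

(** Weights of the average of the marginals of [s n]: its atoms are all the coordinates of the atoms
    of [s n]. *)
Let w n (p : 'I_(comb_size (s n)) * I) : R := weight (s n) p.1 / k.

Let w_ge0 n p : 0 <= @w n p.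
Proof. by rewrite divr_ge0 ?weight_ge0. Qed.

Let sum_pair n (F : 'I_(comb_size (s n)) -> I -> R) :
  \sum_p w p * F p.1 p.2 = k^-1 * \sum_i \sum_j weight (s n) j * F j i.
Proof.
rewrite -(pair_bigA _ (fun j i => w (j, i) * F j i)) /= exchange_big /= mulr_sumr.
apply: eq_bigr => i _; rewrite mulr_sumr; apply: eq_bigr => j _.
by rewrite /w /= mulrAC mulrC.
Qed.

Let w_sum n : \sum_p @w n p = 1.
Proof.
transitivity (\sum_p @w n p * 1); first by apply: eq_bigr => p _; rewrite mulr1.
rewrite (@sum_pair n (fun _ _ => 1)).
under eq_bigr do (under eq_bigr do rewrite mulr1; rewrite weight_sum).
by rewrite sumr_const mulVf// gt_eqF.
Qed.

Let x n (p : 'I_(comb_size (s n)) * I) : X := atom (s n) p.1 p.2.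

(** Membership of [c] in the [n]-th open set means giving each [h p] about the mass that the average
    marginal gives it. The combination [s'] recombined from [c] averages to nearly [c]; the last
    clause expresses that it is spread over the boxes with the weights of [s n]. *)
Let split_spec n (h : 'I_(comb_size (s n)) * I -> X -> R) (d : R) : Prop :=
  [/\ forall p, Cb R X (h p),
    forall p, comb_int (comb_of (@x n) (@w_ge0 n) (@w_sum n)) (h p) = w p, 0 < d &
    forall c : finite_comb R X, \sum_p `|comb_int c (h p) - w p| < d ->
    exists s' : finite_comb R (I -> X),
     (forall f M, (forall y, `|f y| <= M) -> 0 < M ->
       `|comb_int c f - k^-1 * \sum_i comb_int s' (fun y => f (y i))| <= n.+1%:R^-1 *+ 2 * M) /\
     (forall (f : (I -> X) -> R) b, (forall j y, (forall i, U n j i (y i)) -> f y <= b j) ->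
       comb_int s' f <= \sum_j weight (s n) j * b j)].

(* The normalised measures [h p * c / c (h p)] carried by the sides of the
   boxes are recombined into a measure on the boxes by [tensor]. *)
Let split_comb n : exists h d, @split_spec n h d.
Proof.
have [h [bh h0 h1 hU hw]] := splitting_functions crX hX
  (@w_ge0 n) (fun p => @oU n p.1 p.2) (fun p => @sU n p.1 p.2).
have [eta eta0 etaw] := min_positive (@w n).
have n0 : 0 < n.+1%:R^-1 :> R by rewrite invr_gt0.
(* [eta] forces [c (h p) > 0] wherever [w p > 0], so that the parts can be normalised; the other
   bound makes the error vanish as [n] grows. *)
exists h, (Num.min eta n.+1%:R^-1); split => //.
- by move=> p; rewrite comb_ofE.
- by rewrite lt_min eta0.
move=> c; rewrite lt_min => /andP[d1 d2].
have hc p : 0 < w p -> 0 < comb_int c (h p).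
  move=> wp; rewrite ltNge; apply/negP => hp.
  have : `|comb_int c (h p) - w p| < eta.
    apply: le_lt_trans d1; rewrite (bigD1 p)//= lerDl sumr_ge0//.
  have := etaw p wp; rewrite ltr_norml => ? /andP[? _]; lra.
pose u j i l := if 0 < comb_int c (h (j, i)) then
  weight c l * h (j, i) (atom c l) / comb_int c (h (j, i)) else 0.
have u0 j i l : 0 <= u j i l.
  by rewrite /u; case: ifPn => // hp; rewrite divr_ge0 ?mulr_ge0 ?weight_ge0// ltW.
have wk j i : 0 < weight (s n) j -> 0 < w (j, i) by move=> tj; rewrite divr_gt0.
have u1 j i : 0 < weight (s n) j -> \sum_l u j i l = 1.
  move=> /(wk j i) /hc hp; rewrite /u hp -mulr_suml.
  by rewrite -[X in X / _]/(comb_int c (h (j, i))) divff// gt_eqF.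
exists (tensor (atom c) (weight_ge0 (f := s n)) (weight_sum (s n)) u0 u1).
split.
  move=> f M fM M0.
  have := splitting_approx (@w_ge0 n) (@w_sum n) h0 h1 hc fM.
  rewrite [X in k^-1 * X](eq_bigr (fun i => \sum_j weight (s n) j * \sum_l u j i l * f (atom c l)));
    last by move=> i _; exact: tensor_marginal.
  rewrite -(@sum_pair n (fun j i => \sum_l u j i l * f (atom c l))).
  have -> : \sum_p w p * (\sum_l weight c l * h p (atom c l) / comb_int c (h p) * f (atom c l)) =
      \sum_p w p * \sum_l u p.1 p.2 l * f (atom c l).
    apply: eq_bigr => -[j i] _ /=.
    have [wp|wp] := ltP 0 (w (j, i)); first by rewrite /u hc.
    have -> : w (j, i) = 0 by apply/eqP; rewrite eq_le wp w_ge0.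
    by rewrite !mul0r.
  move=> /le_trans; apply; apply: ler_wpM2r; first exact: ltW.
  by rewrite lerMn2r (ltW d2) orbT.
move=> f b fb; apply: tensor_le => j y yu; apply: fb => i.
have [l ul ->] := yu i; apply: contrapT => nU.
move: ul; rewrite /u (hU (j, i) _ nU) mulr0 mul0r.
by case: ifP; rewrite ltxx.
Qed.

Lemma coupling_cluster : exists m : radon_prob R {ptws I -> X},
  forall (t : seq ({ptws I -> X} -> R)) e N, 0 < e -> (forall f, f \in t -> Cb R _ f) ->
  exists n (s' : finite_comb R (I -> X)), [/\ (N <= n)%N,
    forall f, f \in t -> `|comb_int s' f - rint m f| < e &
    forall (f : (I -> X) -> R) b, (forall j y, (forall i, U n j i (y i)) -> f y <= b j) ->
      comb_int s' f <= \sum_j weight (s n) j * b j].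
Proof.
pose h n := projT1 (cid (split_comb n)).
pose d n := projT1 (cid (projT2 (cid (split_comb n)))).
have hd n : split_spec (h n) (d n) := projT2 (cid (projT2 (cid (split_comb n)))).
have bh n p : Cb R X (h n p) by have [] := hd n.
have d0 n : 0 < d n by have [] := hd n.
pose D n (m : radon_prob R X) : R := \sum_p `|rint m (h n p) - w p|.
have cD n : continuous (D n).
  move=> m; apply: (@cvg_finite_sum R _ _ (nbhs m)) => p _; apply: cvg_norm.
  by apply: cvgB; [exact: rint_continuous|exact: cvg_cst].
have D0 n m : 0 <= D n m by exact: sumr_ge0.
(* A continuous function on E that is [1] at the average marginal of [s n] and positive only on the
   [n]-th open set. *)
pose g n m := Num.max 0 (1 - D n m / d n).
have gD n m : 0 < g n m -> D n m < d n.
  by rewrite /g lt_max ltxx /= subr_gt0 ltr_pdivrMr// mul1r.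
have cg n : continuous (g n).
  move=> m; apply: (@continuous_max _ _ (fun=> 0) (fun m => 1 - D n m / d n)).
    exact: (@cst_continuous _ _ 0 m).
  have : (fun m => 1 - D n m / d n) @ m --> 1 - D n m / d n.
    apply: (cvgB (F := nbhs m)); first exact: cvg_cst.
    by apply: (cvgM (F := nbhs m)); [exact: cD|exact: cvg_cst].
  exact.
have [||mu muP] := pseudocompact_cluster pX cg.
- by move=> n m; rewrite le_max lexx.
- move=> n; have [_ hw _ _] := hd n.
  exists (radon_comb crX hX (comb_of (@x n) (@w_ge0 n) (@w_sum n))).
  rewrite /g; have -> : D n (radon_comb crX hX (comb_of (@x n) (@w_ge0 n) (@w_sum n))) = 0.
    by rewrite /D big1// => p _; rewrite radon_combE// hw subrr normr0.
  by rewrite mul0r subr0 le_max lexx orbT.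
(* The index [n] tends to infinity while [c] tends to [mu] inside the [n]-th open sets. The filter
   is proper because these conditions on the measure are open, so some finitely supported one
   satisfies them. *)
pose F : set_system (nat * finite_comb R X)%type := [set S | exists A N, nbhs mu A /\
  forall n c, (N <= n)%N -> A (radon_comb crX hX c) ->
    0 < g n (radon_comb crX hX c) -> S (n, c)].
have FF : ProperFilter F.
  apply: Build_ProperFilter_ex.
    move=> S [A [N [nA AS]]].
    move: nA; rewrite nbhsE => -[B [oB Bmu] BA].
    have [n [Nn [m Bm gm]]] := muP B (open_nbhs_nbhs (conj oB Bmu)) N.
    have nB : nbhs m (B `&` [set m | 0 < g n m]).
      apply: filterI; first exact: open_nbhs_nbhs.
      by apply: (cg n m [set r : R | 0 < r]); exact: open_nbhs_nbhs.
    have [c [Bc gc]] := radon_comb_dense crX hX nB.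
    by exists (n, c); apply: AS => //; exact: BA.
  split.
  - by exists setT, 0%N; split => //; exact: filterT.
  - move=> S S' [A [N [nA AS]]] [A' [N' [nA' AS']]].
    exists (A `&` A'), (maxn N N'); split; first exact: filterI.
    by move=> n c; rewrite geq_max => /andP[? ?] [? ?] ?; split; [exact: AS|exact: AS'].
  - move=> S S' SS' [A [N [nA AS]]]; exists A, N; split => // n c Nn Ac gc.
    by apply: SS'; exact: AS.
have [V [UV FV]] := ultraFilterLemma FF.
have /choice[T TP] : forall a : (nat * finite_comb R X)%type, exists s' : finite_comb R (I -> X),
    \sum_p `|comb_int a.2 (h a.1 p) - w p| < d a.1 ->
    (forall f M, (forall y, `|f y| <= M) -> 0 < M ->
     `|comb_int a.2 f - k^-1 * \sum_i comb_int s' (fun y => f (y i))| <= a.1.+1%:R^-1 *+ 2 * M) /\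
     (forall (f : (I -> X) -> R) b, (forall j y, (forall i, U a.1 j i (y i)) -> f y <= b j) ->
       comb_int s' f <= \sum_j weight (s a.1) j * b j).
  move=> [n c] /=; have [lt|nlt] := pselect (\sum_p `|comb_int c (h n p) - w p| < d n).
    by have [_ _ _ /(_ c lt)[s' s'P]] := hd n; exists s'.
  by exists (s n) => /nlt.
have good A N : nbhs mu A -> V [set a | [/\ (N <= a.1)%N, A (radon_comb crX hX a.2) &
    \sum_p `|comb_int a.2 (h a.1 p) - w p| < d a.1]].
  move=> nA; apply: FV; exists A, N; split => // n c Nn Ac /gD Dc; split => //=.
  rewrite (_ : \sum_p _ = D n (radon_comb crX hX c))//.
  by apply: eq_bigr => p _; rewrite radon_combE.
have [L [cL tL]] := ultra_state UV (fun a => @comb_tight R {ptws I -> X} (T a)).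
have bproj i f : Cb R X f -> Cb R {ptws I -> X} (fun y => f (y i)).
  by move=> bf; exact: (Cb_comp (@product_proj_continuous X I i) bf).
(* The marginals of [L] average to [mu]: the recombination error of order [2 * M / n] disappears
   along [V]. *)
have Lmu f : Cb R X f -> k^-1 * \sum_i L (fun y => f (y i)) = rint mu f.
  move=> bf; have [M M0 fM] := Cb_ex bf.
  have cl : (fun a => k^-1 * \sum_i comb_int (T a) (fun y => f (y i))) @ V -->
      k^-1 * \sum_i L (fun y => f (y i)).
    apply: cvgM; first exact: cvg_cst.
    by apply: cvg_finite_sum => i _; exact: (cL _ (bproj i f bf)).
  apply: (cvg_unique _ cl) => //.
  apply/cvgrPdist_lt => e e0; have e2 : 0 < e / 2 by lra.
  pose N := Num.truncn (2 * M / (e / 2)).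
  have nE := (continuous_epsP (fun m => rint m f)).1 (rint_continuous bf) mu _ e2.
  apply: filterS (good _ N nE) => -[n c] /= [Nn]; rewrite radon_combE// => h1.
  move=> /(TP (n, c))[/= /(_ f M fM M0) h2 _].
  have h3 : n.+1%:R^-1 *+ 2 * M < e / 2.
    have : 2 * M / (e / 2) < n.+1%:R.
      by apply: lt_le_trans (truncnS_gt _) _; rewrite ler_nat.
    rewrite ltr_pdivrMr// => h3.
    have -> : n.+1%:R^-1 *+ 2 * M = 2 * M / n.+1%:R by rewrite mulr2n; ring.
    by rewrite ltr_pdivrMr ?ltr0n// [ltRHS]mulrC.
  apply: le_lt_trans (ler_distD (comb_int c f) _ _) _.
  rewrite (splitr e) ltrD//; first by rewrite distrC.
  exact: le_lt_trans h2 h3.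
have tightL : tight_state L.
  apply: tL; apply: (power_tight (I := I) crX (k := k) (rint_tight mu)).
  - move=> f1 f2 b1 b2 f12; rewrite -subr_ge0.
    apply: (cvgr_to_ge (cvgB (cL _ b2) (cL _ b1))); apply: nearW => a.
    by rewrite subr_ge0; exact: (state_le (@comb_tight R {ptws I -> X} (T a))).
  - move=> e f bf.
    have bS : Cb R {ptws I -> X} (fun y => e + \sum_i f i (y i)).
      by apply: Cb_add; [exact: Cb_cst|apply: Cb_sum => i _; exact: bproj].
    apply: (cvg_unique _ (cL _ bS)) => //.
    have cl : (fun a => e + \sum_i comb_int (T a) (fun y => f i (y i))) @ V -->
        e + \sum_i L (fun y => f i (y i)).
      apply: cvgD; first exact: cvg_cst.
      by apply: cvg_finite_sum => i _; exact: (cL _ (bproj i _ (bf i))).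
    apply: cvg_trans cl; apply: near_eq_cvg; apply: nearW => a.
    have tS := @comb_tight R {ptws I -> X} (T a).
    have bi i : Cb R {ptws I -> X} (fun y => f i (y i)) by exact: bproj.
    rewrite (state_add tS (Cb_cst e)); last by apply: Cb_sum => i _; exact: bi.
    by rewrite (state_cst tS) (state_sum tS).
  (* One marginal is at most the sum of all of them, which is [k] times [mu]. *)
  - move=> i f bf f0; rewrite -(Lmu f bf) mulrA mulfV ?gt_eqF// mul1r.
    rewrite (bigD1 i)//= lerDl sumr_ge0// => j _.
    apply: (cvgr_to_ge (cL _ (bproj j f bf))); apply: nearW => a.
    by apply: (state_ge0 (@comb_tight R {ptws I -> X} (T a))) => //; exact: bproj.
have [m mL] := radon_exists (@product_completely_regular R X I crX)
  (@product_hausdorff X I hX) tightL.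
exists m => t e N e0 bt.
have Vt : V [set a | forall f, f \in t -> `|comb_int (T a) f - rint m f| < e].
  elim: t bt => [|f t ih] bt; first by apply: (filterS _ filterT).
  have bf : Cb R {ptws I -> X} f by apply: bt; rewrite inE eqxx.
  have h1 : V [set a | `|comb_int (T a) f - rint m f| < e].
    by rewrite mL//; have /cvgrPdistC_lt := cL f bf; apply.
  have h2 := ih (fun g gt => bt g (mem_behead (s := f :: t) gt)).
  apply: filterS2 h1 h2 => a /= h1 h2 f'; rewrite inE => /orP[/eqP -> //|].
  exact: h2.
have [[n c] /= [h1 [Nn _ /(TP (n, c))[_ h2]]]] := filter_ex (filterI Vt (good _ N (@filterT _ _ _))).
by exists n, (T (n, c)).
Qed.

End coupling_cluster.

Section pushforward_integral.
Context {R : realType} {Y Z : topologicalType} (h : Y -> Z).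
Hypotheses (ch : continuous h) (hZ : hausdorff_space Z).

Lemma rint_push (m : radon_prob R Y) (f : Z -> R) : Cb R Z f ->
  rint (radon_push ch hZ m) f = rint m (fun y => f (h y)).
Proof.
move=> bf; rewrite /rint /Rintegral; congr fine.
have mh : measurable_fun setT (h : borel (radon_nonempty m) -> borel (radon_push_nonempty h m)).
  by move=> _ B mB; rewrite setTI; exact: borel_preimage.
rewrite (eq_measure_integral (pushforward (radon_measure m)
  (h : borel (radon_nonempty m) -> borel (radon_push_nonempty h m)))); last first.
  by move=> A mA _; rewrite /= radon_push_measureE.
rewrite integral_pushforward//.
- by apply/measurable_realfun.measurable_EFinP; apply: continuous_borel; exact: Cb_continuous bf.
- rewrite preimage_setT; exact: (Cb_integrable (radon_measure m) (Cb_comp ch bf)).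
Qed.

Lemma radon_push_continuous : continuous (@radon_push R Y Z h ch hZ).
Proof.
apply: radon_continuous => f bf.
under eq_fun do rewrite rint_push//.
by apply: rint_continuous; exact: Cb_comp.
Qed.

End pushforward_integral.

(** * Supports and clusters of open sets *)

Section support.
Context {R : realType} {Y : topologicalType} (m : radon_prob R Y).

(** Otherwise every point has a neighbourhood on which some nonnegative function of integral zero is
    at least [1]. Adding finitely many gives one that is at least [1] on a compact set missing at
    most half of the mass, which is absurd. *)
Lemma radon_support : exists z : Y, forall f, Cb R Y f -> (forall x, 0 <= f x) ->
  0 < f z -> 0 < rint m f.
Proof.
apply: contrapT => nz.
have sm := rint_tight m.
have e2 : 0 < 2^-1 :> R by rewrite invr_gt0.
have [C cC tC] := state_tight sm e2.
pose good (A : set Y) := exists f : Y -> R, [/\ Cb R Y f, forall x, 0 <= f x,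
  forall x, A x -> 1 <= f x & rint m f = 0].
have [f [bf f0 f1 fm]] : good C.
  apply: compact_induction => //.
  - exists (fun=> 0); split => //; first exact: Cb_cst.
    exact: (state_cst sm).
  - by move=> A B AB [f [? ? f1 ?]]; exists f; split => // x /AB; exact: f1.
  - move=> A B [f [bf f0 f1 fm]] [g [bg g0 g1 gm]].
    exists (fun x => f x + g x); split.
    + exact: Cb_add.
    + by move=> x; rewrite addr_ge0.
    + move=> x [/f1|/g1] h; first by have := g0 x; lra.
      by have := f0 x; lra.
    + by rewrite (state_add sm)// fm gm addr0.
  - move=> z _; have [f [bf f0 fz fm]] : exists f, [/\ Cb R Y f, forall x, 0 <= f x,
        0 < f z & rint m f = 0].
      apply: contrapT => nf; apply: nz; exists z => f bf f0 fz.
      rewrite lt_neqAle (state_ge0 sm bf f0) andbT eq_sym; apply/eqP => fm.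
      by apply: nf; exists f.
    exists [set x | f z / 2 < f x].
      have [cf _] := bf.
      apply: (cf z [set r | f z / 2 < r]); apply: open_nbhs_nbhs; split => /=; first exact: open_gt.
      lra.
    exists (fun x => (f z / 2)^-1 * f x); split.
    + exact: Cb_scale.
    + by move=> x; rewrite mulr_ge0// invr_ge0; lra.
    + by move=> x /= /ltW fx; rewrite mulrC ler_pdivlMr ?mul1r//; lra.
    + by rewrite (state_scale sm)// fm mulr0.
have b1 : Cb R Y (fun x => 1 - Num.min 1 (f x)).
  by apply: Cb_sub; [|apply: Cb_min => //]; exact: Cb_cst.
have : rint m (fun x => 1 - Num.min 1 (f x)) <= 2^-1.
  apply: tC => // x; last by move=> /f1 fx; rewrite (min_idPl fx) subrr.
  by rewrite subr_ge0 ge_min lexx /= lerBlDr lerDl le_min ler01 f0.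
have : 1 - rint m f <= rint m (fun x => 1 - Num.min 1 (f x)).
  rewrite -{1}(state_one sm) -(state_sub sm)//; last exact: Cb_cst.
  apply: (state_le sm) => //; first by apply: Cb_sub => //; exact: Cb_cst.
  by move=> x; rewrite lerD2l lerN2 ge_min lexx orbT.
by rewrite fm; lra.
Qed.

End support.

(** No sequence of nonempty open sets is locally finite (feeble compactness). In Tychonoff spaces
    this is pseudocompactness, in the form that couplings deliver. *)
Definition open_cluster (T : topologicalType) : Prop :=
  forall V : nat -> set T, (forall n, open (V n)) -> (forall n, V n !=set0) ->
  exists x : T, forall A, nbhs x A -> forall N, exists2 n, (N <= n)%N & V n `&` A !=set0.

Lemma open_cluster_pseudocompact (R : realType) (T : topologicalType) :
  open_cluster T -> pseudocompact R T.
Proof.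
move=> cT f cf; apply: contrapT => nb.
have big n : exists x, n%:R < `|f x|.
  apply: contrapT => nx; apply: nb; apply/bounded_funP; exists n%:R => x.
  by rewrite leNgt; apply/negP => h; apply: nx; exists x.
have cnf : continuous (fun x => `|f x|).
  by move=> x; apply: cvg_norm; exact: cf.
have [x xP] := cT (fun n => [set x | n%:R < `|f x|])
  (fun n => (continuousP _).1 cnf [set r | n%:R < r] (open_gt (y := _))) big.
have nA : nbhs x [set y | `|f y| < `|f x| + 1].
  apply: (cnf x [set r | r < `|f x| + 1]); apply: open_nbhs_nbhs; split => /=.
    exact: open_lt.
  by rewrite ltrDl.
have [n Nn [y [/= h1 h2]]] := xP _ nA (Num.truncn (`|f x| + 1)).+1.
have : `|f x| + 1 < n%:R.
  by apply: lt_le_trans (truncnS_gt _) _; rewrite ler_nat.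
lra.
Qed.

Section clusters.
Context {R : realType} {X : topologicalType}.
Hypotheses (crX : completely_regular_space X) (hX : hausdorff_space X).
Hypothesis pX : pseudocompact R (radon_prob R X).

Let unit_w0 (t : unit) : 0 <= 1 :> R. Proof. exact: ler01. Qed.
Let unit_w1 : \sum_(t : unit) 1 = 1 :> R.
Proof. by rewrite sumr_const card_unit. Qed.

Definition dirac_comb (Y : Type) (y : Y) : finite_comb R Y :=
  comb_of (fun _ : unit => y) unit_w0 unit_w1.

Lemma dirac_combE (Y : Type) (y : Y) (f : Y -> R) : comb_int (dirac_comb y) f = f y.
Proof. by rewrite comb_ofE (big_pred1 tt) ?mul1r//; case. Qed.

(** Place a Dirac mass in each [V n] and take for [z] a support point of the cluster measure. A bump
    at [z] has positive integral, so for arbitrarily large [n] it is not zero on the whole box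
    inside [V n]. *)
Lemma power_open_cluster (I : finType) : (0 < #|I|)%N -> open_cluster {ptws I -> X}.
Proof.
move=> I0 V oV /choice[y Vy].
have /choice[U UP] : forall n, exists U : I -> set X, [/\ forall i, open (U i),
    forall i, U i (y n i) & forall z : {ptws I -> X}, (forall i, U i (z i)) -> V n z].
  by move=> n; apply: product_nbhs_box; exact: open_nbhs_nbhs.
have [m mP] := coupling_cluster crX hX pX I0
  (s := fun n => dirac_comb (y n : I -> X)) (U := fun n _ => U n)
  (fun n _ i => let: And3 o _ _ := UP n in o i) (fun n _ i => let: And3 _ o _ := UP n in o i).
have [z zP] := radon_support m.
exists z => A; rewrite nbhsE => -[B [oB Bz] BA] N.
have [f [bf f01 fz f0]] := @cr_bump R _
  (@product_completely_regular R X I crX) z B oB Bz.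
have mf : 0 < rint m f.
  by apply: zP => //; [move=> x; have /andP[] := f01 x|rewrite fz].
have [|n [s' [Nn h1 h2]]] := mP [:: f] (rint m f) N mf.
  by move=> g; rewrite inE => /eqP ->.
exists n => //; apply: contrapT => nVA.
have : comb_int s' f <= 0.
  have -> : 0 = \sum_j weight (dirac_comb (y n : I -> X)) j * 0 :> R.
    by rewrite big1// => j _; rewrite mulr0.
  apply: h2 => _ x Ux; rewrite f0// => /BA Ax; apply: nVA; exists x; split => //.
  by have [_ _] := UP n; apply.
have := h1 f; rewrite inE eqxx ltr_norml => /(_ isT)/andP[]; lra.
Qed.

Lemma base_open_cluster : open_cluster X.
Proof.
move=> V oV V0.
have cV n : open [set y : {ptws unit -> X} | V n (y tt)].
  by apply: ((continuousP _).1 (@product_proj_continuous X unit tt)).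
have [||y yP] := @power_open_cluster unit _ (fun n => [set y | V n (y tt)]) cV.
- by rewrite card_unit.
- by move=> n; have [x Vx] := V0 n; exists (fun=> x).
exists (y tt) => A nA N.
have [n Nn [z [Vz Az]]] := yP _ (@product_proj_continuous X unit tt y A nA) N.
by exists n => //; exists (z tt).
Qed.

Definition side (b : bool) : radon_prob R {ptws bool -> X} -> radon_prob R X :=
  radon_push (@product_proj_continuous X bool b) hX.

Lemma sideE b m f : Cb R X f -> rint (side b m) f = rint m (fun y => f (y b)).
Proof. exact: rint_push. Qed.

(** With small boxes, the combinations that approach the cluster measure have both marginals in the
    prescribed sets [A b n], which therefore accumulate at its two marginals; [rho] stays below
    [1 / (n + 1)] on the boxes and so integrates to zero in the limit. *)
Lemma coupled_cluster (s : nat -> finite_comb R (bool -> X))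
    (rho : {ptws bool -> X} -> R) (A : bool -> nat -> set (radon_prob R X)) :
    (forall b n, open (A b n)) ->
    (forall b n, A b n (radon_comb crX hX (comb_map (fun y => y b) (s n)))) ->
    Cb R _ rho -> (forall y, 0 <= rho y) ->
    (forall n j, rho (atom (s n) j) < n.+1%:R^-1) ->
  exists2 m : radon_prob R {ptws bool -> X}, rint m rho = 0 &
    forall G, (forall b, nbhs (side b m) (G b)) -> forall N, exists2 n, (N <= n)%N &
      forall b, A b n `&` G b !=set0.
Proof.
move=> oA sA brho rho0 srho.
have basis b n : exists q : seq (X -> R) * R, [/\ 0 < q.2, forall f, f \in q.1 -> Cb R X f &
    forall m', (forall f, f \in q.1 ->
      `|rint m' f - rint (radon_comb crX hX (comb_map (fun y => y b) (s n))) f| < q.2) -> A b n m'].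
  have [t [e [e0 bt tA]]] := radon_nbhs_basis (open_nbhs_nbhs (conj (oA b n) (sA b n))).
  by exists (t, e).
have /choice[q qP] : forall b, exists q : nat -> seq (X -> R) * R, forall n,
    [/\ 0 < (q n).2, forall f, f \in (q n).1 -> Cb R X f &
    forall m', (forall f, f \in (q n).1 ->
      `|rint m' f - rint (radon_comb crX hX (comb_map (fun y => y b) (s n))) f| < (q n).2) -> A b n m'].
  by move=> b; have /choice[q qP] := basis b; exists q.
(* On the box of an atom, the test functions of a basic neighbourhood inside [A b n] may vary by
   half the tolerance, so spreading the mass over the boxes keeps the marginals in [A b n]. *)
have box n (j : 'I_(comb_size (s n))) : exists U : bool -> set X, [/\ forall b, open (U b),
    forall b, U b (atom (s n) j b) &
    forall y : {ptws bool -> X}, (forall b, U b (y b)) -> rho y < n.+1%:R^-1 /\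
      forall b f, f \in (q b n).1 -> `|f (y b) - f (atom (s n) j b)| < (q b n).2 / 2].
  apply: (@product_nbhs_box X bool (atom (s n) j)
    [set y : {ptws bool -> X} | rho y < n.+1%:R^-1 /\
      forall b f, f \in (q b n).1 -> `|f (y b) - f (atom (s n) j b)| < (q b n).2 / 2]).
  apply: filterI.
    have [crho _] := brho.
    apply: (crho _ [set r | r < n.+1%:R^-1]); apply: open_nbhs_nbhs; split; last exact: srho.
    exact: open_lt.
  pose a : {ptws bool -> X} := atom (s n) j.
  suff nb b : nbhs a [set y |
      forall f, f \in (q b n).1 -> `|f (y b) - f (atom (s n) j b)| < (q b n).2 / 2].
    by apply: (@filterS2 _ (nbhs a) _ _ _ _ _ (nb true) (nb false)) => y ht hf [] f fq; [exact: ht|exact: hf].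
  have [e0 bq _] := qP b n.
  have e2 : 0 < (q b n).2 / 2 by lra.
  elim: (q b n).1 bq => [|f t ih] bq; first by apply: (@filterS _ (nbhs a) _ setT _ _ filterT).
  have bf : Cb R X f by apply: bq; rewrite inE eqxx.
  have [cf _] := Cb_comp (@product_proj_continuous X bool b) bf.
  have h1 := (continuous_epsP _).1 cf a _ e2.
  have h2 := ih (fun g gt => bq g (mem_behead (s := f :: t) gt)).
  apply: (@filterS2 _ (nbhs a) _ _ _ _ _ h1 h2) => y h3 h4 g; rewrite inE => /orP[/eqP ->//|].
  exact: h4.
pose U n j := projT1 (cid (box n j)).
have UP n j := projT2 (cid (box n j)).
have card_b : (0 < #|{: bool}|)%N by rewrite card_bool.
have [m mP] := coupling_cluster crX hX pX card_b (s := s) (U := U)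
  (fun n j i => let: And3 o _ _ := UP n j in o i) (fun n j i => let: And3 _ o _ := UP n j in o i).
have sm := rint_tight m.
exists m.
  apply/eqP; rewrite eq_le (state_ge0 sm)// andbT leNgt; apply/negP => mrho.
  have r2 : 0 < rint m rho / 2 by lra.
  have [|n [s' [Nn h1 h2]]] := mP [:: rho] (rint m rho / 2)
      (Num.truncn (rint m rho / 2)^-1) r2.
    by move=> g; rewrite inE => /eqP ->.
  have : comb_int s' rho <= n.+1%:R^-1.
    have -> : n.+1%:R^-1 = \sum_j weight (s n) j * n.+1%:R^-1.
      by rewrite -mulr_suml weight_sum mul1r.
    apply: h2 => j y Uy; have [_ _ /(_ y Uy)[/ltW]] := UP n j; exact.
  have : n.+1%:R^-1 < rint m rho / 2.
    rewrite invf_plt ?posrE//; apply: lt_le_trans (truncnS_gt _) _.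
    by rewrite ler_nat ltnS.
  have := h1 rho; rewrite inE eqxx ltr_norml => /(_ isT)/andP[h3 _] h4 h5.
  by have := le_lt_trans h5 h4; lra.
move=> G nG N.
have bas b : exists t : seq (X -> R) * R, [/\ 0 < t.2, forall f, f \in t.1 -> Cb R X f &
    forall m', (forall f, f \in t.1 -> `|rint m' f - rint (side b m) f| < t.2) -> G b m'].
  by have [t [e h]] := radon_nbhs_basis (nG b); exists (t, e).
have /choice[t tP] := bas.
pose pb (b : bool) (f : X -> R) : {ptws bool -> X} -> R := fun y => f (y b).
pose T := [seq pb true f | f <- (t true).1] ++ [seq pb false f | f <- (t false).1].
have inT b f : f \in (t b).1 -> pb b f \in T.
  by move=> fb; rewrite mem_cat; case: b fb => fb; rewrite (map_f _ fb)// orbT.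
have bT f : f \in T -> Cb R _ f.
  rewrite mem_cat => /orP[] /mapP[g gt ->].
    by have [_ bt _] := tP true; exact: Cb_comp (@product_proj_continuous X bool true) (bt g gt).
  by have [_ bt _] := tP false; exact: Cb_comp (@product_proj_continuous X bool false) (bt g gt).
have e0 : 0 < Num.min (t true).2 (t false).2.
  by rewrite lt_min; have [-> _ _] := tP true; have [-> _ _] := tP false.
have [n [s' [Nn h1 h2]]] := mP T _ N e0 bT.
exists n => // b.
have [tb0 bt tG] := tP b; have [qb0 bq qA] := qP b n.
exists (radon_comb crX hX (comb_map (fun y => y b) s')); split.
  apply: qA => f fq; have bf := bq f fq; rewrite !radon_combE//.
  set c := (q b n).2 / 2.
  have wc (d : R) : \sum_j weight (s n) j * (f (atom (s n) j b) + d) =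
      comb_int (comb_map (fun y => y b) (s n)) f + d.
    under eq_bigr do rewrite mulrDr.
    by rewrite big_split /= -mulr_suml weight_sum mul1r.
  have up : comb_int (comb_map (fun y => y b) s') f <=
      comb_int (comb_map (fun y => y b) (s n)) f + c.
    rewrite -wc; apply: (h2 (pb b f)) => j y Uy.
    have [_ _ /(_ y Uy)[_ /(_ b f fq)]] := UP n j.
    by rewrite ltr_norml -/c /pb => /andP[_ ?]; lra.
  (* [coupling_cluster] gives upper bounds only, so it is applied to [- f] as well. *)
  have lo : - comb_int (comb_map (fun y => y b) s') f <=
      - comb_int (comb_map (fun y => y b) (s n)) f + c.
    have -> : - comb_int (comb_map (fun y => y b) s') f = comb_int s' (fun y => - f (y b)).
      by rewrite /comb_int -sumrN; apply: eq_bigr => j _; rewrite mulrN.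
    have -> : - comb_int (comb_map (fun y => y b) (s n)) f + c =
        \sum_j weight (s n) j * (- f (atom (s n) j b) + c).
      under eq_bigr do rewrite mulrDr mulrN.
      by rewrite big_split /= -mulr_suml weight_sum mul1r sumrN.
    apply: (h2 (fun y => - f (y b))) => j y Uy.
    have [_ _ /(_ y Uy)[_ /(_ b f fq)]] := UP n j.
    by rewrite ltr_norml -/c => /andP[? _]; lra.
  by rewrite ltr_norml; rewrite /c in up lo; apply/andP; split; lra.
apply: tG => f ft; rewrite radon_combE ?sideE//; try exact: bt.
apply: lt_le_trans (h1 _ (inT b f ft)) _.
by case: (b); rewrite ge_min lexx ?orbT.
Qed.

End clusters.

(** * Uniform continuity of functions on a pseudocompact space of measures *)

Lemma ltr_dist4 {R : realDomainType} (x y x' y' v d : R) :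
  `|x' - x| < d -> `|y' - y| < d -> `|x' - v| < d -> `|y' - v| < d -> `|x - y| < d *+ 4.
Proof.
rewrite !ltr_norml => /andP[? ?] /andP[? ?] /andP[? ?] /andP[? ?].
by apply/andP; split; lra.
Qed.

Lemma ltr_dist_shift {R : realFieldType} (r r' a b e : R) : 0 < e -> a <= e / 3 -> b <= e / 3 ->
  r' <= a + (r + b) -> r <= a + (r' + b) -> `|r' - r| < e.
Proof. by move=> *; rewrite ltr_norml; apply/andP; split; lra. Qed.

Lemma pseudometric_Cb {R : realType} {X : topologicalType} (d : X -> X -> R) M :
    (forall x y, 0 <= d x y <= M) -> (forall x y, d x y = d y x) ->
    (forall z x y, d x y <= d x z + d z y) ->
    (forall x e, 0 < e -> \forall y \near x, d y x <= e) ->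
  Cb R {ptws bool -> X} (fun y => d (y true) (y false)).
Proof.
move=> d0 dC dT dx; apply/CbP; split; last first.
  by exists M => y; have /andP[? ?] := d0 (y true) (y false); rewrite ger0_norm.
apply/continuous_epsP => y e e0; have e3 : 0 < e / 3 by lra.
have h1 := @product_proj_continuous X bool true y _ (dx (y true) _ e3).
have h2 := @product_proj_continuous X bool false y _ (dx (y false) _ e3).
apply: (@filterS2 _ (nbhs y) _ _ _ _ _ h1 h2) => z /= h3 h4.
apply: (ltr_dist_shift e0 h3 h4).
  apply: le_trans (dT (y true) _ _) _; rewrite lerD2l.
  by rewrite (dC (z false)).
apply: le_trans (dT (z true) _ _) _; rewrite dC lerD2l.
exact: dT.
Qed.

Lemma radon_measure_nonzero {R : realType} {Y : topologicalType} (m : radon_prob R Y)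
    (f : Y -> R) : Cb R Y f -> (forall x, 0 <= f x) -> rint m f = 0 ->
  radon_measure m (~` [set x | f x = 0]) = 0%E.
Proof.
move=> bf f0 mf; have intf := Cb_integrable (radon_measure m) bf.
have int0 : (\int[radon_measure m]_x `|(EFin \o f) x|)%E = 0%E.
  have fin := integrable_fin_num measurableT intf.
  rewrite -[RHS](_ : (rint m f)%:E = 0%E); last by rewrite mf.
  rewrite /rint /Rintegral fineK//; apply: eq_integral => x _ /=.
  by rewrite ger0_norm.
have ae := (ae_eq_integral_abs (radon_measure m) measurableT (measurable_int _ intf)).1 int0.
have mZ : measurable (~` [set x | f x = 0] : set (borel (radon_nonempty m))).
  apply: borel_open; apply: closed_openC.
  by apply: ((continuous_closedP _).1 (Cb_continuous bf) [set 0]); exact: closed_eq.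
apply/(negligibleP _ mZ); apply: negligibleS ae => x /= fx h; apply: fx.
by have [] := h I.
Qed.

Section uniform_continuity.
Context {R : realType} {X : topologicalType}.
Hypotheses (crX : completely_regular_space X) (hX : hausdorff_space X).
Hypothesis pX : pseudocompact R (radon_prob R X).
Variable f : radon_prob R X -> R.
Hypothesis cf : continuous f.

Local Notation E := (radon_prob R X).
Local Notation mixf t b a := (f (mix crX hX t b a)).
Local Notation rc := (radon_comb crX hX).

(** Pseudocompactness of [E * E] in cluster form: independent couplings of finitely supported
    elements of [A n] and [B n], with the constraint [rho] set to zero. *)
Lemma pair_open_cluster (A B : nat -> set E) :
    (forall n, open (A n)) -> (forall n, open (B n)) ->
    (forall n, A n !=set0) -> (forall n, B n !=set0) ->
  exists a b : E, forall G H, nbhs a G -> nbhs b H -> forall N, exists2 n, (N <= n)%N &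
    A n `&` G !=set0 /\ B n `&` H !=set0.
Proof.
move=> oA oB A0 B0.
have /choice[c cP] : forall n, exists c : finite_comb R (bool -> X),
    A n (rc (comb_map (fun y => y true) c)) /\ B n (rc (comb_map (fun y => y false) c)).
  move=> n; have [a Aa] := A0 n; have [b Bb] := B0 n.
  have [ca Aca] := radon_comb_dense crX hX (open_nbhs_nbhs (conj (oA n) Aa)).
  have [cb Bcb] := radon_comb_dense crX hX (open_nbhs_nbhs (conj (oB n) Bb)).
  have w0 (p : 'I_(comb_size ca) * 'I_(comb_size cb)) : 0 <= weight ca p.1 * weight cb p.2.
    by rewrite mulr_ge0// weight_ge0.
  have w1 : \sum_(p : 'I_(comb_size ca) * 'I_(comb_size cb)) weight ca p.1 * weight cb p.2 = 1.
    rewrite -(pair_bigA _ (fun i j => weight ca i * weight cb j)) /=.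
    by under eq_bigr do rewrite -mulr_sumr weight_sum mulr1; exact: weight_sum.
  pose c := comb_of (fun p : 'I_(comb_size ca) * 'I_(comb_size cb) =>
    (fun b : bool => if b then atom ca p.1 else atom cb p.2)) w0 w1.
  exists c; split.
    have -> // : rc (comb_map (fun y => y true) c) = rc ca.
    apply: (radon_ext crX hX) => g bg; rewrite !radon_combE//.
    transitivity (comb_int c (fun y => g (y true))); first by [].
    rewrite comb_ofE -(pair_bigA _ (fun i j => weight ca i * weight cb j * g (atom ca i))) /=.
    by apply: eq_bigr => i _; rewrite -mulr_suml -mulr_sumr weight_sum mulr1.
  have -> // : rc (comb_map (fun y => y false) c) = rc cb.
  apply: (radon_ext crX hX) => g bg; rewrite !radon_combE//.
  transitivity (comb_int c (fun y => g (y false))); first by [].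
  rewrite comb_ofE -(pair_bigA _ (fun i j => weight ca i * weight cb j * g (atom cb j))) /=.
  rewrite exchange_big /=; apply: eq_bigr => j _.
  by rewrite -mulr_suml -mulr_suml weight_sum mul1r.
have [m _ mP] := @coupled_cluster R X crX hX pX c (fun=> 0)
  (fun b n => if b then A n else B n) (fun b n => if b as b' return open (if b' then A n else B n) then oA n else oB n)
  (fun b n => if b as b' return (if b' then A n else B n) (rc (comb_map (fun y => y b') (c n)))
     then (cP n).1 else (cP n).2) (Cb_cst 0) (fun=> lexx 0) (fun n _ => ltac:(by rewrite invr_gt0)).
exists (side hX true m), (side hX false m) => G H nG nH N.
have [|n Nn nP] := mP (fun b => if b then G else H) _ N; first by case.
by exists n => //; split; [exact: (nP true)|exact: (nP false)].
Qed.

(* If the family were not equicontinuous at [a0], one could choose points [a n]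
   closer and closer to [a0] together with witnesses [(b n, t n)]; at a cluster
   point of these [f (mix t b a)] would be discontinuous. *)
Lemma mix_equicontinuous (a0 : E) e : 0 < e ->
  exists2 U, nbhs a0 U & forall a b t, U a -> `|mixf t b a - mixf t b a0| <= e.
Proof.
move=> e0; apply: contrapT => nU.
have cF t : continuous (fun p : E * E => mixf t p.2 p.1).
  move=> p; apply: (@continuous_comp _ _ _ (fun p : E * E => mix crX hX t p.2 p.1) f);
    last exact: cf.
  apply: (@mix_continuous R X crX hX (E * E)%type (fun=> t) snd fst).
  - exact: cst_continuous.
  - by move=> q; exact: cvg_snd.
  - by move=> q; exact: cvg_fst.
(* Four errors of this size add up to [e / 2], less than the gap [e] of the witnesses. *)
pose e8 := e / 8.
have e80 : 0 < e8 by rewrite /e8; lra.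
have near_box t a b : exists A B : set E, [/\ open A, open B, A a, B b &
    forall a' b', A a' -> B b' -> `|mixf t b' a' - mixf t b a| < e8].
  have [[A B] /= [nA nB] AB] := (continuous_epsP _).1 (cF t) (a, b) _ e80.
  move: nA nB; rewrite !nbhsE => -[A' [oA' A'a] A'A] [B' [oB' B'b] B'B].
  exists A', B'; split => // a' b' Aa' Bb'.
  by apply: (AB (a', b')); split; [exact: A'A|exact: B'B].
have step (U : set E) : exists q : (E * E * R * (set E * set E * set E))%type,
  let: (a, b, t, (A, B, U')) := q in nbhs a0 U -> [/\ nbhs a0 U' /\ (open A /\ open B), A a /\ B b,
     A `<=` U, U' `<=` U & e < `|mixf t b a - mixf t b a0| /\
     (forall a' b', A a' -> B b' -> `|mixf t b' a' - mixf t b a| < e8) /\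
     (forall a' b', U' a' -> B b' -> `|mixf t b' a' - mixf t b a0| < e8)].
  have [nU0|] := pselect (nbhs a0 U); last first.
    by move=> nU0; exists (a0, a0, 0, (setT, setT, setT)) => /= /nU0.
  have [V [oV Va] VU] : exists2 V, open_nbhs a0 V & V `<=` U by move: nU0; rewrite nbhsE.
  have [a [b [t [Va' ab]]]] : exists a b t, V a /\ e < `|mixf t b a - mixf t b a0|.
    apply: contrapT => nab; apply: nU; exists V; first exact: open_nbhs_nbhs.
    move=> a b t Va'; rewrite leNgt; apply/negP => h; apply: nab.
    by exists a, b, t.
  have [A [B [oA oB Aa Bb AB]]] := near_box t a b.
  have [A' [B' [oA' oB' Aa' Bb' AB']]] := near_box t a0 b.
  exists (a, b, t, (A `&` V, B `&` B', A' `&` V)) => _; split.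
  - split; last by split; exact: openI.
    by apply: open_nbhs_nbhs; split => //; exact: openI.
  - by [].
  - by move=> x [_ /VU].
  - by move=> x [_ /VU].
  - split => //; split.
      by move=> a' b' [? _] [? _]; exact: AB.
    by move=> a' b' [? _] [_ ?]; exact: AB'.
have /choice[Q QP] := step.
pose Us := fix Us n := if n is n'.+1 then (Q (Us n')).2.2 else setT.
have nUs n : nbhs a0 (Us n).
  elim: n => [|n ih]; first exact: filterT.
  rewrite /=; have := QP (Us n); case: (Q (Us n)) => [[[a b] t] [[A B] U']] /= h.
  by have [[]] := h ih.
pose an n := (Q (Us n)).1.1.1; pose bn n := (Q (Us n)).1.1.2; pose tn n := (Q (Us n)).1.2.
pose An n := (Q (Us n)).2.1.1; pose Bn n := (Q (Us n)).2.1.2.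
have H n : [/\ open (An n) /\ open (Bn n), An n (an n) /\ Bn n (bn n),
     An n `<=` Us n, Us n.+1 `<=` Us n & e < `|mixf (tn n) (bn n) (an n) - mixf (tn n) (bn n) a0| /\
     (forall a' b', An n a' -> Bn n b' -> `|mixf (tn n) b' a' - mixf (tn n) (bn n) (an n)| < e8) /\
     (forall a' b', Us n.+1 a' -> Bn n b' -> `|mixf (tn n) b' a' - mixf (tn n) (bn n) a0| < e8)].
  rewrite /An /Bn /an /bn /tn /=; have := QP (Us n).
  case: (Q (Us n)) => [[[a b] t] [[A B] U']] /= h.
  by have [[_ ?]] := h (nUs n).
have Usle n m : (n <= m)%N -> Us m `<=` Us n.
  move=> nm; rewrite -(subnK nm); elim: (m - n)%N => [//|k ih].
  by rewrite addSn; apply: subset_trans ih; have [] := H (k + n)%N.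
have [al [be clP]] := pair_open_cluster (fun n => let: And5 h _ _ _ _ := H n in h.1)
  (fun n => let: And5 h _ _ _ _ := H n in h.2)
  (fun n => let: And5 _ h _ _ _ := H n in ex_intro _ (an n) h.1)
  (fun n => let: And5 _ h _ _ _ := H n in ex_intro _ (bn n) h.2).
(* Along these indices the sets [An n] approach [al] and [Bn n] approach [be]; the clamped
   parameters lie in a compact interval, so they have a cluster value [tau] along the same
   filter. *)
pose Fl : set_system nat := [set S | exists G H N, [/\ nbhs al G, nbhs be H &
  forall n, (N <= n)%N -> An n `&` G !=set0 -> Bn n `&` H !=set0 -> S n]].
have FF : ProperFilter Fl.
  apply: Build_ProperFilter_ex.
    move=> S [G [H' [N [nG nH hS]]]]; have [n Nn [h1 h2]] := clP G H' nG nH N.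
    by exists n; exact: hS.
  split.
  - by exists setT, setT, 0%N; split => //; exact: filterT.
  - move=> S S' [G [H1 [N [nG nH hS]]]] [G' [H1' [N' [nG' nH' hS']]]].
    exists (G `&` G'), (H1 `&` H1'), (maxn N N'); split; [exact: filterI|exact: filterI|].
    move=> n; rewrite geq_max => /andP[h1 h2] [x [Ax [Gx Gx']]] [y [By [Hy Hy']]].
    by split; [apply: hS => //; [exists x|exists y]|apply: hS' => //; [exists x|exists y]].
  - move=> S S' SS' [G [H1 [N [nG nH hS]]]]; exists G, H1, N; split => // n h1 h2 h3.
    by apply: SS'; exact: hS.
have [tau [_ tauP]] : `[0, 1]%classic `&` cluster ((fun n => clamp (tn n)) @ Fl) !=set0.
  have fl : Fl ((fun n => clamp (tn n)) @^-1` `[0, 1]).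
    by apply: filterS filterT => n _ /=; rewrite in_itv /= clamp_itv.
  exact: segment_compact (fmap_proper_filter _ _) fl.
have cF3 : continuous (fun p : E * (E * R) => mixf p.2.2 p.2.1 p.1).
  move=> p; apply: (@continuous_comp _ _ _ (fun p : E * (E * R) => mix crX hX p.2.2 p.2.1 p.1) f);
    last exact: cf.
  apply: (@mix_continuous R X crX hX (E * (E * R))%type (fun q => q.2.2) (fun q => q.2.1) fst).
  - move=> q; apply: (@continuous_comp _ _ _ snd snd); [exact: cvg_snd|exact: cvg_snd].
  - move=> q; apply: (@continuous_comp _ _ _ snd fst); [exact: cvg_snd|exact: cvg_fst].
  - by move=> q; exact: cvg_fst.
have [[G W] /= [nG nW] GW] := (continuous_epsP _).1 cF3 (al, (be, tau)) _ e80.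
have [[H1 D] /= [nH nD] HD] := nW.
have close a b t : G a -> H1 b -> D t -> `|mixf t b a - mixf tau be al| < e8.
  move=> Ga Hb Dt; apply: (GW (a, (b, t))); split => //.
  exact: (HD (b, t)).
have mixc t b a : mix crX hX (clamp t) b a = mix crX hX t b a.
  by apply: (radon_ext crX hX) => g bg; rewrite !mixE// (clamp_id (clamp_itv t)).
have [|x [[n [[a [Aa Ga]] [[b [Bb Hb]] <-]]] Dx]] :=
    tauP [set x | exists n, An n `&` G !=set0 /\ (Bn n `&` H1 !=set0 /\ clamp (tn n) = x)] D _ nD.
  exists G, H1, 0%N; split => // n _ h1 h2; by exists n.
(* A later index supplies a point [a'] near [al] inside [Us n.+1], where the [n]-th witness takes
   nearly its value at [a0]. Hence [a] and [a'] are both near [al] but give values of [f] that are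
   far apart. *)
have [m nm [[a' [Aa' Ga']] _]] := clP G H1 nG nH n.+1.
have [_ _ AUm _ _] := H m.
have Ua' : Us n.+1 a' by apply: (Usle _ _ nm); exact: AUm.
have [_ _ _ _ [h1 [h2 h3]]] := H n.
have c1 := close a b _ Ga Hb Dx; have c2 := close a' b _ Ga' Hb Dx.
rewrite !mixc in c1 c2.
have := ltr_dist4 (h2 a b Aa Bb) (h3 a' b Ua' Bb) c1 c2.
have -> : e8 *+ 4 = e / 2 by rewrite -mulr_natr /e8; field.
by move=> /(lt_trans h1); rewrite ltNge ler_pdivrMr// ler_pMr// ler1n.
Qed.

Definition point_mass (x : X) : E := rc (dirac_comb x).

Lemma point_massE x (g : X -> R) : Cb R X g -> rint (point_mass x) g = g x.
Proof. by move=> bg; rewrite radon_combE// dirac_combE. Qed.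

Lemma point_mass_continuous : continuous point_mass.
Proof.
apply: radon_continuous => g bg; under eq_fun do rewrite point_massE//.
exact: Cb_continuous.
Qed.

Definition swap_dist (x y : X) : R :=
  sup [set r | exists t b, r = `|mixf t b (point_mass x) - mixf t b (point_mass y)|].

Let f_bounded : exists2 M, 0 < M & forall m, `|f m| <= M.
Proof. by apply: Cb_ex; apply/CbP; split => //; apply/bounded_funP; exact: pX. Qed.

Let swap_sup x y :
  has_sup [set r | exists t b, r = `|mixf t b (point_mass x) - mixf t b (point_mass y)|].
Proof.
have [M M0 fM] := f_bounded.
split.
  by eexists; exists 0, (point_mass x); reflexivity.
exists (M + M) => _ [t [b ->]].
by rewrite (le_trans (ler_normB _ _))// lerD.
Qed.

Lemma swap_dist_ge x y t b :
  `|mixf t b (point_mass x) - mixf t b (point_mass y)| <= swap_dist x y.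
Proof. by apply: ub_le_sup; [exact: (swap_sup x y).2|exists t, b]. Qed.

Lemma swap_dist_le x y c :
  (forall t b, `|mixf t b (point_mass x) - mixf t b (point_mass y)| <= c) ->
  swap_dist x y <= c.
Proof.
by move=> h; apply: ge_sup; [exact: (swap_sup x y).1|move=> _ [t [b ->]]].
Qed.

Lemma swap_dist_ge0 x y : 0 <= swap_dist x y.
Proof. exact: le_trans (normr_ge0 _) (swap_dist_ge x y 0 (point_mass x)). Qed.

Lemma swap_distC x y : swap_dist x y = swap_dist y x.
Proof.
apply/eqP; rewrite eq_le; apply/andP; split; apply: swap_dist_le => t b;
  by rewrite distrC swap_dist_ge.
Qed.

Lemma swap_distxx x : swap_dist x x = 0.
Proof.
apply/eqP; rewrite eq_le swap_dist_ge0 andbT; apply: swap_dist_le => t b.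
by rewrite subrr normr0.
Qed.

Lemma swap_dist_triangle z x y : swap_dist x y <= swap_dist x z + swap_dist z y.
Proof.
apply: swap_dist_le => t b; apply: le_trans (ler_distD (mixf t b (point_mass z)) _ _) _.
by apply: lerD; exact: swap_dist_ge.
Qed.

Lemma swap_dist_small x e : 0 < e -> \forall y \near x, swap_dist y x <= e.
Proof.
move=> e0; have [U nU Ue] := mix_equicontinuous (point_mass x) e0.
apply: (@filterS _ (nbhs x) _ _ _ _ (@point_mass_continuous x U nU)) => y /= Uy.
by apply: swap_dist_le => t b; exact: Ue.
Qed.

Lemma swap_dist_Cb : Cb R {ptws bool -> X} (fun y => swap_dist (y true) (y false)).
Proof.
have [M M0 fM] := f_bounded.
apply: (@pseudometric_Cb R X swap_dist (M + M)).
- move=> x y; rewrite swap_dist_ge0; apply: swap_dist_le => t b.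
  by rewrite (le_trans (ler_normB _ _))// lerD.
- exact: swap_distC.
- exact: swap_dist_triangle.
- by move=> x e; exact: swap_dist_small.
Qed.

(** Normalising the common atoms to a measure [b] writes both combinations as mixtures of [b] with a
    point mass, which is the situation measured by [swap_dist]. *)
Lemma swap_one n (w : 'I_n -> R) (w0 : forall i, 0 <= w i) (w1 : \sum_i w i = 1)
    (p q : 'I_n -> X) (j : 'I_n) :
  (forall i, i != j -> p i = q i) -> swap_dist (p j) (q j) = 0 ->
  f (rc (FiniteComb p w0 w1)) = f (rc (FiniteComb q w0 w1)).
Proof.
move=> pq pqj.
have [b bP] : exists b : E, forall x : 'I_n -> X, (forall i, i != j -> x i = q i) ->
    rc (FiniteComb x w0 w1) = mix crX hX (w j) b (point_mass (x j)).
  have wj1 : 0 <= w j <= 1.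
    by rewrite w0/= -w1 (bigD1 j)//= lerDl sumr_ge0.
  have split (x : 'I_n -> X) g : Cb R X g -> rint (rc (FiniteComb x w0 w1)) g =
      w j * g (x j) + \sum_(i | i != j) w i * g (x i).
    by move=> bg; rewrite radon_combE// /comb_int (bigD1 j).
  have rest : \sum_(i | i != j) w i = 1 - w j.
    by rewrite -w1 [in RHS](bigD1 j)//= addrAC subrr add0r.
  (* If all the mass sits at [j], there is no rest to normalise and any [b] will do. *)
  have [wj|wj] := eqVneq (w j) 1.
    exists (point_mass (q j)) => x xq; apply: (radon_ext crX hX) => g bg.
    rewrite split// mixE// (clamp_id wj1) !point_massE// wj subrr mul0r add0r.
    rewrite big1 ?addr0// => i ij.
    have : \sum_(i | i != j) w i = 0 by rewrite rest wj subrr.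
    by move/eqP; rewrite psumr_eq0// => /allP/(_ i (mem_index_enum _))/implyP/(_ ij)/eqP ->; rewrite mul0r.
  have wj' : 0 < 1 - w j.
    by rewrite subr_gt0 lt_neqAle wj; have /andP[] := wj1.
  pose v i := if i == j then 0 else w i / (1 - w j).
  have v0 i : 0 <= v i by rewrite /v; case: ifP => // _; rewrite divr_ge0// ltW.
  have vE (F : 'I_n -> R) : \sum_i v i * F i = (1 - w j)^-1 * \sum_(i | i != j) w i * F i.
    rewrite (bigD1 j)//= /v eqxx mul0r add0r mulr_sumr.
    by apply: eq_bigr => i /negbTE ->; rewrite mulrAC mulrC.
  have v1 : \sum_i v i = 1.
    transitivity (\sum_i v i * 1); first by apply: eq_bigr => i _; rewrite mulr1.
    rewrite vE; under eq_bigr do rewrite mulr1.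
    by rewrite rest mulVf// gt_eqF.
  exists (rc (FiniteComb q v0 v1)) => x xq; apply: (radon_ext crX hX) => g bg.
  rewrite split// mixE// (clamp_id wj1) point_massE// radon_combE// /comb_int /= vE.
  rewrite mulrA mulfV ?gt_eqF// mul1r addrC; congr (_ + _).
  by apply: eq_bigr => i ij; rewrite xq.
have := swap_dist_ge (p j) (q j) (w j) b.
by rewrite pqj normr_le0 subr_eq0 => /eqP h; rewrite (bP p pq) (bP q).
Qed.

Lemma swap_comb (c : finite_comb R (bool -> X)) :
  (forall j, swap_dist (atom c j true) (atom c j false) = 0) ->
  f (rc (comb_map (fun y => y true) c)) = f (rc (comb_map (fun y => y false) c)).
Proof.
case: c => n w p w0 w1 /= pq.
pose x k (i : 'I_n) := if (i < k)%N then p i false else p i true.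
have xk k : (k <= n)%N -> f (rc (FiniteComb (x 0%N) w0 w1)) = f (rc (FiniteComb (x k) w0 w1)).
  elim: k => [//|k ih kn]; rewrite (ih (ltnW kn)).
  apply: (swap_one w0 w1 (j := Ordinal kn)).
    by move=> i; rewrite -val_eqE /= /x ltnS [(i <= k)%N]leq_eqVlt => /negbTE ->.
  by rewrite /x /= ltnn ltnSn pq.
transitivity (f (rc (FiniteComb (x 0%N) w0 w1))); first by congr (f (rc _)).
rewrite (xk n)//; congr (f _); apply: (radon_ext crX hX) => g bg.
by rewrite !radon_combE//; apply: eq_bigr => i _; rewrite /= /x ltn_ord.
Qed.

Lemma coupling_uniform e : 0 < e -> exists2 eta, 0 < eta &
  forall c : finite_comb R (bool -> X),
    (forall j, swap_dist (atom c j true) (atom c j false) < eta) ->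
    `|f (rc (comb_map (fun y => y true) c)) - f (rc (comb_map (fun y => y false) c))| < e.
Proof.
move=> e0; apply: contrapT => neta.
pose rho (y : {ptws bool -> X}) := swap_dist (y true) (y false).
have /choice[s sP] : forall n : nat, exists c : finite_comb R (bool -> X),
    (forall j, rho (atom c j) < n.+1%:R^-1) /\
    e <= `|f (rc (comb_map (fun y => y true) c)) - f (rc (comb_map (fun y => y false) c))|.
  move=> n; apply: contrapT => nc; apply: neta; exists n.+1%:R^-1; first by rewrite invr_gt0.
  by move=> c cn; rewrite ltNge; apply/negP => h; apply: nc; exists c.
have e8 : 0 < e / 8 by lra.
have op (a : E) : open [set m | `|f m - f a| < e / 8].
  have cfa : continuous (fun m => `|f m - f a|).
    move=> m; apply: (cvg_norm (F := nbhs m)).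
    by apply: (cvgB (F := nbhs m)); [exact: cf|exact: cvg_cst].
  by apply: ((continuousP _).1 cfa [set r | r < e / 8]); exact: open_lt.
have [m mrho mP] := @coupled_cluster R X crX hX pX s rho
  (fun b n => [set m | `|f m - f (rc (comb_map (fun y => y b) (s n)))| < e / 8])
  (fun b n => op _) (fun b n => ltac:(by rewrite /= subrr normr0)) swap_dist_Cb
  (fun y => swap_dist_ge0 _ _) (fun n => (sP n).1).
pose u b := side hX b m.
have far : e / 2 <= `|f (u true) - f (u false)|.
  have nG b : nbhs (u b) [set m | `|f m - f (u b)| < e / 8].
    by apply: open_nbhs_nbhs; split; [exact: op|rewrite /= subrr normr0].
  have [n _ nP] := mP (fun b => [set m | `|f m - f (u b)| < e / 8]) nG 0%N.
  have [a [/= a1 a2]] := nP true; have [b [/= b1 b2]] := nP false.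
  rewrite leNgt; apply/negP => h; move: (sP n).2; rewrite leNgt => /negP; apply.
  move: a1 a2 b1 b2 h; rewrite !ltr_norml.
  move=> /andP[? ?] /andP[? ?] /andP[? ?] /andP[? ?] /andP[? ?].
  by apply/andP; split; lra.
pose Z := [set y : {ptws bool -> X} | rho y = 0].
have crho := Cb_continuous swap_dist_Cb.
have cZ : closed Z by apply: ((continuous_closedP _).1 crho [set 0]); exact: closed_eq.
have mZ : radon_measure m (~` Z) = 0%E.
  exact: (radon_measure_nonzero swap_dist_Cb (fun y => swap_dist_ge0 _ _) mrho).
have csmall b : nbhs m [set m' | `|f (side hX b m') - f (u b)| < e / 8].
  have cs : continuous (fun m' => f (side hX b m')).
    move=> m'; apply: (@continuous_comp _ _ _ (side hX b) f); last exact: cf.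
    exact: radon_push_continuous.
  exact: ((continuous_epsP _).1 cs m _ e8).
have crP := @product_completely_regular R X bool crX.
have hP := @product_hausdorff X bool hX.
(* The atoms of [c] are pairs at distance zero, so [f] agrees on its two sides; these values are
   within [e / 8] of those at the sides of [m], against [far]. *)
have [c cZ' /= [c1 c2]] := radon_comb_approx crP hP cZ mZ (filterI (csmall true) (csmall false)).
have sideC b : side hX b (radon_comb crP hP c) = rc (comb_map (fun y => y b) (c : finite_comb R (bool -> X))).
  apply: (radon_ext crX hX) => g bg; rewrite sideE// !radon_combE//.
  exact: (Cb_comp (@product_proj_continuous X bool b) bg).
move: c1 c2; rewrite !sideC (swap_comb (c := c) cZ').
move: far; rewrite ler_normr !ltr_norml.
by move=> /orP[h|h] /andP[? ?] /andP[? ?]; lra.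
Qed.

End uniform_continuity.

(** * Extension to the Stone-Cech compactification *)

Section stone_cech_theory.
Context {R : realType} {X : topologicalType}.

Local Notation K := (stone_cech R X).
Local Notation eta := (@stone_cech_unit R X).

Let ext_ex (f : Cb R X) : exists M, forall x, `|(set_val f : X -> R) x| <= M.
Proof. by have /CbP[_] := set_valP f. Qed.

Let bd (f : Cb R X) : R := projT1 (cid (ext_ex f)).

Let box : set {ptws Cb R X -> R} := [set h | forall f, `[- bd f, bd f]%classic (h f)].

Let box_compact : compact box.
Proof.
apply: (@tychonoff _ (fun=> R) (fun f => `[- bd f, bd f]%classic)) => f.
exact: segment_compact.
Qed.

Let closure_box : closure (range (@evaluation R X)) `<=` box.
Proof.
have cb : closed box.
  apply: compact_closed box_compact.
  by apply: (@hausdorff_product _ (fun=> R)) => _; exact: Rhausdorff.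
have rb : range (@evaluation R X) `<=` box.
  move=> _ [x _ <-] f /=; rewrite in_itv /= -ler_norml.
  exact: projT2 (cid (ext_ex f)) x.
by apply: subset_trans (closureS rb) _; rewrite -((closure_id box).1 cb).
Qed.

Lemma stone_cech_compact : compact [set: K].
Proof.
have cC : compact (closure (range (@evaluation R X))).
  by apply: subclosed_compact box_compact closure_box; exact: closed_closure.
move=> F PF _.
pose v : K -> {ptws Cb R X -> R} := set_val.
have FC : F (v @^-1` closure (range (@evaluation R X))).
  by apply: (@filterS _ F _ setT _ _ filterT) => z _; exact: set_valP.
have [p [Cp clp]] := cC (v @ F) (fmap_proper_filter _ PF) FC.
exists (SigSub (mem_set Cp)); split => // B V FB [_ [[D oD <-] Dp DV]].
have [|_ [[y By <-] Dy]] := clp (v @` B) D _ (open_nbhs_nbhs (conj oD Dp)).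
  by apply: (@filterS _ F _ B _ _ FB) => y By; exists y.
by exists y; split => //; exact: DV.
Qed.

Lemma stone_cech_completely_regular : completely_regular_space K.
Proof.
apply: (@normal_completely_regular R).
  by apply: compact_normal; [exact: stone_cech_hausdorff|exact: stone_cech_compact].
by apply: hausdorff_accessible; exact: stone_cech_hausdorff.
Qed.

Lemma stone_cech_dense (z : K) A : nbhs z A -> exists x, A (eta x).
Proof.
move=> [_ [[D oD <-] Dz DA]].
have [_ [[x _ <-] Dx]] := set_valP z D (open_nbhs_nbhs (conj oD Dz)).
by exists x; exact: DA.
Qed.

Lemma stone_cech_proj_continuous (f : Cb R X) : continuous (fun z : K => set_val z f : R).
Proof.
move=> z; apply: (@continuous_comp _ _ _ (set_val : K -> {ptws Cb R X -> R})
  (fun h : {ptws Cb R X -> R} => h f)).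
  exact: initial_continuous.
exact: (@proj_continuous _ (fun=> R) f).
Qed.

Lemma stone_cech_extension (f : X -> R) : Cb R X f ->
  exists2 g, Cb R K g & forall x, g (eta x) = f x.
Proof.
move=> bf; pose i : Cb R X := SigSub (mem_set bf).
exists (fun z : K => set_val z i) => //; apply/CbP; split.
  exact: stone_cech_proj_continuous.
exists (bd i) => z; have /closure_box := set_valP z.
by move=> /(_ i) /=; rewrite in_itv /= -ler_norml.
Qed.

Lemma stone_cech_eq (T : topologicalType) (g h : K -> T) : hausdorff_space T ->
  continuous g -> continuous h -> (forall x, g (eta x) = h (eta x)) -> g = h.
Proof.
move=> hT cg ch gh; apply/funext => z; apply: hT => A B nA nB.
have nAB : nbhs z (g @^-1` A `&` h @^-1` B).
  by apply: filterI; [exact: (cg z A nA)|exact: (ch z B nB)].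
have [x [Ax Bx]] := stone_cech_dense nAB.
by exists (g (eta x)); split => //; rewrite gh.
Qed.

End stone_cech_theory.

(** A greedy choice would give a sequence with distances at least [e]. Two of the sets of points
    within [e / 5] of its terms come within [e / 5] of one point [y], and a path of four such
    distances is shorter than [e]. *)
Lemma pseudometric_totally_bounded {R : realType} {X : topologicalType}
    (d : X -> X -> R) : open_cluster X -> (forall x y, d x y = d y x) ->
    (forall z x y, d x y <= d x z + d z y) ->
    (forall x e, 0 < e -> \forall y \near x, d y x <= e) ->
  forall e, 0 < e -> exists s : seq X, forall x, exists2 y, y \in s & d x y < e.
Proof.
move=> oX dC dT dx e e0; apply: contrapT => ns.
have /choice[far farP] : forall s : seq X, exists x, forall y, y \in s -> e <= d x y.
  move=> s; apply: contrapT => nx; apply: ns; exists s => x.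
  apply: contrapT => ny; apply: nx; exists x => y ys.
  by rewrite leNgt; apply/negP => h; apply: ny; exists y.
pose L := fix L n := if n is n'.+1 then far (L n') :: L n' else [::].
pose x n := far (L n).
have xL n m : (n < m)%N -> x n \in L m.
  elim: m => // m ih; rewrite ltnS leq_eqVlt => /orP[/eqP ->|/ih nm] /=.
    by rewrite inE eqxx.
  by rewrite inE nm orbT.
have sep n m : (n < m)%N -> e <= d (x m) (x n).
  by move=> /xL; exact: farP.
have e4 : 0 < e / 5 by lra.
have nV n : nbhs (x n) [set y | d y (x n) <= e / 5] by exact: dx.
have [|y yP] := oX _ (fun n => open_interior [set y | d y (x n) <= e / 5]).
  by move=> n; exists (x n); exact: nV.
have nW := dx y _ e4.
have [n _ [a [/interior_subset /= a1 a2]]] := yP _ nW 0%N.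
have [m nm [b [/interior_subset /= b1 b2]]] := yP _ nW n.+1.
have := sep n m nm; have := dT b (x m) (x n); have := dT y b (x n).
have := dT a y (x n); rewrite (dC (x m) b) (dC y a); lra.
Qed.

Section extension.
Context {R : realType} {X : topologicalType}.
Hypotheses (crX : completely_regular_space X) (hX : hausdorff_space X).

Local Notation E := (radon_prob R X).
Local Notation K := (stone_cech R X).
Local Notation eta := (@stone_cech_unit R X).
Local Notation C := (radon_prob R K).
Local Notation emb := (radon_embedding R X).
Let crK : completely_regular_space K := stone_cech_completely_regular.
Let hK : hausdorff_space K := @stone_cech_hausdorff R X.

Lemma radon_embedding_continuous : continuous emb.
Proof. exact: radon_push_continuous. Qed.

Lemma radon_embeddingE (m : E) (g : K -> R) : Cb R K g ->
  rint (emb m) g = rint m (fun x => g (eta x)).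
Proof. exact: rint_push. Qed.

(** A neighbourhood tests finitely many functions: approximate [mu] by a finite combination on [K],
    then move each atom to a nearby point of [X]. *)
Lemma radon_embedding_dense (mu : C) A : nbhs mu A -> exists m : E, A (emb m).
Proof.
move=> nA; have [s [e [e0 bs sA]]] := radon_nbhs_basis nA.
have e2 : 0 < e / 2 by lra.
have nB := radon_basic_nbhs mu e2 bs.
have [c cP] := radon_comb_dense crK hK nB.
have /choice[x xP] : forall j, exists x, forall g, g \in s ->
    `|g (eta x) - g (atom c j)| < e / 2.
  move=> j; apply: (@stone_cech_dense _ _ (atom c j)
    [set z | forall g, g \in s -> `|g z - g (atom c j)| < e / 2]).
  elim: s bs {nA sA nB cP} => [|g s ih] bs.
    by apply: (@filterS _ (nbhs (atom c j)) _ setT _ _ filterT).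
  have bg : Cb R K g by apply: bs; rewrite inE eqxx.
  have h1 := (continuous_epsP _).1 (Cb_continuous bg) (atom c j) _ e2.
  have h2 := ih (fun g' gs => bs g' (mem_behead (s := g :: s) gs)).
  apply: (@filterS2 _ (nbhs (atom c j)) _ _ _ _ _ h1 h2) => y h3 h4 g'.
  by rewrite inE => /orP[/eqP ->//|]; exact: h4.
exists (radon_comb crX hX (FiniteComb x (weight_ge0 (f := c)) (weight_sum c))).
apply: sA => g gs; have bg := bs g gs.
rewrite radon_embeddingE// radon_combE; last exact: (Cb_comp (@stone_cech_unit_continuous R X)).
have h1 := cP g gs; rewrite radon_combE// in h1.
have h2 : `|comb_int (FiniteComb x (weight_ge0 (f := c)) (weight_sum c)) (fun x => g (eta x)) -
    comb_int c g| <= e / 2.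
  rewrite /comb_int /= -sumrB (le_trans (ler_norm_sum _ _ _))//.
  rewrite -[leRHS]mul1r -[X in _ <= X * _](weight_sum c) mulr_suml; apply: ler_sum => j _.
  rewrite -mulrBr normrM ger0_norm ?weight_ge0//.
  apply: ler_wpM2l; first exact: weight_ge0.
  by have := xP j g gs; exact: ltW.
apply: le_lt_trans (ler_distD (comb_int c g) _ _) _.
by rewrite (splitr e) ler_ltD.
Qed.

Section pseudocompact_extension.
Hypothesis pX : pseudocompact R E.
Variable f : E -> R.
Hypothesis cf : continuous f.

Local Notation rc := (radon_comb crX hX).

(* [f] is approximated by [f (\sum_i mu (h i) delta_(x i))], where [h] is a
   partition of unity subordinate to balls around the [x i]; this expression
   makes sense for every measure [mu] on the Stone-Cech compactification. *)
Lemma uniform_approximation e : 0 < e ->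
  exists2 g : C -> R, continuous g & forall m, `|f m - g (emb m)| <= e.
Proof.
move=> e0.
have [d [dxx cd dtb [t t0 tP]]] : exists d : X -> X -> R, [/\ forall x, d x x = 0,
    Cb R {ptws bool -> X} (fun y => d (y true) (y false)),
    forall t, 0 < t -> exists s : seq X, forall x, exists2 y, y \in s & d x y < t &
    exists2 t, 0 < t & forall c : finite_comb R (bool -> X),
      (forall j, d (atom c j true) (atom c j false) < t) ->
      `|f (rc (comb_map (fun y => y true) c)) - f (rc (comb_map (fun y => y false) c))| < e].
  exists (swap_dist crX hX f); split.
  - exact: swap_distxx.
  - exact: swap_dist_Cb.
  - apply: pseudometric_totally_bounded.
    + exact: (base_open_cluster crX hX pX).
    + exact: swap_distC.
    + exact: swap_dist_triangle.
    + exact: swap_dist_small.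
  - exact: coupling_uniform.
have t2 : 0 < t / 2 by lra.
have [s sP] := dtb _ t2.
pose n := size s; pose x (i : 'I_n) := tnth (in_tuple s) i.
have xP y : exists i, d y (x i) < t / 2.
  have [z zs dyz] := sP y.
  have /tnthP[i zE] : z \in in_tuple s by [].
  by exists i; rewrite /x -zE.
have bd (z : X) : Cb R X (fun y => d y z).
  apply: (@Cb_comp _ _ {ptws bool -> X} (fun y => (fun b : bool => if b then y else z) : {ptws bool -> X}) _ _ cd).
  move=> y; apply: (@product_cvg _ _ _ (nbhs y)) => -[]; first exact: cvg_id.
  exact: cvg_cst.
(* The centres are [t / 2]-dense but the balls have radius [t], so the sum stays above [t / 2] and
   dividing by it gives bounded continuous functions. *)
pose g i y := Num.max (t - d y (x i)) 0.
have bg i : Cb R X (g i) by apply: Cb_max; [apply: Cb_sub => //|]; exact: Cb_cst.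
have g0 i y : 0 <= g i y by rewrite le_max lexx orbT.
pose S y := \sum_i g i y.
have St y : t / 2 <= S y.
  have [i di] := xP y; rewrite /S (bigD1 i)//= -[leLHS]addr0 lerD//.
    by rewrite le_max; apply/orP; left; lra.
  by apply: sumr_ge0.
have S0 y : 0 < S y := lt_le_trans t2 (St y).
have bS : Cb R X (fun y => (S y)^-1) by apply: (Cb_inv t2 St); apply: Cb_sum => i _; exact: bg.
pose h i y := g i y * (S y)^-1.
have bh i : Cb R X (h i) by exact: Cb_mul.
have h0 i y : 0 <= h i y by rewrite mulr_ge0// invr_ge0 ltW.
have h1 y : \sum_i h i y = 1.
  by rewrite /h -mulr_suml -/(S y) divff// gt_eqF.
have hd i y : 0 < h i y -> d y (x i) < t.
  rewrite /h pmulr_lgt0 ?invr_gt0// /g lt_max ltxx orbF; lra.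
have /choice[H HP] : forall i, exists H, Cb R K H /\ forall y, H (eta y) = h i y.
  by move=> i; have [H bH HE] := stone_cech_extension (bh i); exists H.
have H0 i z : 0 <= H i z.
  rewrite leNgt; apply/negP => Hz.
  have nA : nbhs z [set z | H i z < 0].
    have cHi := Cb_continuous (HP i).1.
    apply: (cHi z [set r | r < 0]); apply: open_nbhs_nbhs; split => //.
  have [y /=] := stone_cech_dense nA.
  by rewrite (HP i).2 ltNge h0.
have H1 z : \sum_i H i z = 1.
  have cH : continuous (fun z => \sum_i H i z).
    by apply: Cb_continuous; apply: Cb_sum => i _; exact: (HP i).1.
  have c1 : continuous (fun _ : K => 1 : R) by exact: cst_continuous.
  have HE : (fun z => \sum_i H i z) = fun=> 1.
    apply: (stone_cech_eq (@Rhausdorff R) cH c1) => y.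
    by rewrite -[RHS](h1 y); apply: eq_bigr => i _; rewrite (HP i).2.
  exact: (congr1 (fun F => F z) HE).
have w0 mu i : 0 <= rint mu (H i) by apply: (state_ge0 (rint_tight mu)) => //; exact: (HP i).1.
have w1 mu : \sum_i rint mu (H i) = 1.
  rewrite -(state_sum (rint_tight mu)); last by move=> i _; exact: (HP i).1.
  rewrite -[RHS](state_one (rint_tight mu)); congr rint; apply/funext => z; exact: H1.
pose W (mu : C) : E := rc (FiniteComb x (w0 mu) (w1 mu)).
have cW : continuous W.
  apply: radon_continuous => q bq; under eq_fun do rewrite radon_combE//.
  move=> mu; apply: (@cvg_finite_sum R _ _ (nbhs mu)) => i _ /=.
  by apply: (cvgM (F := nbhs mu)); [apply: rint_continuous; exact: (HP i).1|exact: cvg_cst].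
have cfW : continuous (fun mu => f (W mu)).
  by move=> mu; apply: (@continuous_comp _ _ _ W f); [exact: cW|exact: cf].
exists (fun mu => f (W mu)) => // m.
have fin (c : finite_comb R X) : `|f (rc c) - f (W (emb (rc c)))| <= e.
  have q0 (p : 'I_(comb_size c) * 'I_n) : 0 <= weight c p.1 * h p.2 (atom c p.1).
    by rewrite mulr_ge0// weight_ge0.
  have qsum (F : 'I_(comb_size c) -> 'I_n -> R) :
      \sum_(p : 'I_(comb_size c) * 'I_n) weight c p.1 * h p.2 (atom c p.1) * F p.1 p.2 =
      \sum_k \sum_i weight c k * h i (atom c k) * F k i.
    by rewrite -(pair_bigA _ (fun k i => weight c k * h i (atom c k) * F k i)).
  have q1 : \sum_(p : 'I_(comb_size c) * 'I_n) weight c p.1 * h p.2 (atom c p.1) = 1.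
    transitivity (\sum_(p : 'I_(comb_size c) * 'I_n) weight c p.1 * h p.2 (atom c p.1) * 1).
      by apply: eq_bigr => p _; rewrite mulr1.
    rewrite (qsum (fun _ _ => 1)) -[RHS](weight_sum c); apply: eq_bigr => k _.
    by under eq_bigr do rewrite mulr1; rewrite -mulr_sumr h1 mulr1.
  (* The coupling sends the fraction [h i] of the mass at each atom to [x i]. Pairs of mass zero
     because [h i] vanishes repeat the atom, since [tP] needs a small distance for every pair. *)
  pose a (p : 'I_(comb_size c) * 'I_n) (b : bool) : X :=
    if b then atom c p.1 else
    if 0 < h p.2 (atom c p.1) then x p.2 else atom c p.1.
  pose l := comb_of a q0 q1.
  have lt_ : rc (comb_map (fun y => y true) l) = rc c.
    apply: (radon_ext crX hX) => q bq; rewrite !radon_combE//.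
    transitivity (comb_int l (fun y => q (y true))); first by [].
    rewrite comb_ofE (qsum (fun k _ => q (atom c k))); apply: eq_bigr => k _.
    by rewrite -mulr_suml -mulr_sumr h1 mulr1.
  have lf_ : rc (comb_map (fun y => y false) l) = W (emb (rc c)).
    apply: (radon_ext crX hX) => q bq; rewrite !radon_combE//.
    transitivity (comb_int l (fun y => q (y false))); first by [].
    rewrite comb_ofE /a /=.
    transitivity (\sum_(p : 'I_(comb_size c) * 'I_n) weight c p.1 * h p.2 (atom c p.1) * q (x p.2)).
      apply: eq_bigr => p _; case: ifPn => //; rewrite -leNgt => hp.
      have -> : h p.2 (atom c p.1) = 0 by apply/eqP; rewrite eq_le hp h0.
      by rewrite mulr0 !mul0r.
    rewrite (qsum (fun _ i => q (x i))) exchange_big /= /comb_int /=.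
    apply: eq_bigr => i _; rewrite -mulr_suml; congr (_ * _).
    rewrite radon_embeddingE; last exact: (HP i).1.
    have -> : (fun y => H i (eta y)) = h i by apply/funext => y; exact: (HP i).2.
    by rewrite radon_combE.
  rewrite -lf_ -{1}lt_; apply/ltW; apply: tP => j.
  rewrite /l /=; case: (enum_val j) => k i; rewrite /a /=.
  by case: ifPn => [/hd//|_]; rewrite dxx.
(* The bound is a closed condition on [m], so density extends it from finite combinations to all of
   E. *)
rewrite leNgt; apply/negP => far.
have cdiff : continuous (fun m => `|f m - f (W (emb m))|).
  move=> m'; apply: (cvg_norm (F := nbhs m')); apply: (cvgB (F := nbhs m')); first exact: cf.
  apply: (@continuous_comp _ _ _ emb (fun mu => f (W mu))); last exact: cfW.
  exact: radon_embedding_continuous.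
have nA : nbhs m [set m | e < `|f m - f (W (emb m))|].
  apply: (cdiff m [set r | e < r]); apply: open_nbhs_nbhs; split => //.
have [c /=] := radon_comb_dense crX hX nA.
by rewrite ltNge fin.
Qed.

Lemma radon_extension : exists2 g : C -> R, continuous g & forall m, g (emb m) = f m.
Proof.
have [v n0 small] : exists2 v : nat -> R, forall n, 0 < v n &
    forall r, 0 < r -> exists n, v n < r.
  exists (fun n => n.+1%:R^-1); first by move=> n; rewrite invr_gt0.
  move=> r r0; exists (Num.truncn r^-1).
  by rewrite invf_plt ?posrE//; exact: truncnS_gt.
have /choice[g gP] : forall n : nat, exists g : C -> R, continuous g /\
    forall m, `|f m - g (emb m)| <= v n.
  by move=> n; have [g cg gE] := uniform_approximation (n0 n); exists g.
have close n k mu : `|g n mu - g k mu| <= v n + v k.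
  rewrite leNgt; apply/negP => far.
  have cd : continuous (fun mu => `|g n mu - g k mu|).
    move=> nu; apply: (cvg_norm (F := nbhs nu)); apply: (cvgB (F := nbhs nu)); exact: (gP _).1.
  have nA : nbhs mu [set mu | v n + v k < `|g n mu - g k mu|].
    apply: (cd mu [set r | v n + v k < r]); apply: open_nbhs_nbhs; split => //.
  have [m /=] := radon_embedding_dense nA.
  rewrite ltNge (le_trans (ler_distD (f m) _ _))// lerD//; last exact: (gP k).2.
  by rewrite distrC; exact: (gP n).2.
(* The uniform limit, written as a supremum: the estimate [close], carried over from E by density,
   puts every [g n - v n] below every [g k + v k]. *)
pose G mu := sup [set g n mu - v n | n in [set: nat]].
have hG mu : has_sup [set g n mu - v n | n in [set: nat]].
  split; first by exists (g 0%N mu - v 0%N); exists 0%N.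
  exists (g 0%N mu + v 0%N) => _ [n _ <-].
  by have := close n 0%N mu; rewrite ler_norml => /andP[_]; lra.
have GE n mu : `|G mu - g n mu| <= v n.
  rewrite ler_norml; apply/andP; split.
    have : g n mu - v n <= G mu by apply: ub_le_sup; [exact: (hG mu).2|exists n].
    lra.
  rewrite lerBlDr; apply: ge_sup; first exact: (hG mu).1.
  move=> _ [k _ <-]; have := close k n mu; rewrite ler_norml => /andP[_]; lra.
exists G.
  apply/continuous_epsP => mu e e0; have e3 : 0 < e / 3 by lra.
  have [n ne] := small _ e3.
  apply: filterS ((continuous_epsP _).1 (gP n).1 mu _ e3) => nu.
  have := GE n nu; have := GE n mu; rewrite !ler_norml !ltr_norml.
  by move=> /andP[? ?] /andP[? ?] /andP[? ?]; apply/andP; split; lra.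
move=> m; apply/eqP; rewrite -subr_eq0 -normr_le0 leNgt; apply/negP => pos.
have p2 : 0 < `|G (emb m) - f m| / 2 by lra.
have [n nlt] := small _ p2.
have := ler_distD (g n (emb m)) (G (emb m)) (f m).
have := GE n (emb m); have := (gP n).2 m; rewrite (distrC (f m)); lra.
Qed.

End pseudocompact_extension.

End extension.

(** * The equivalences *)

Section embedding.
Context {R : realType} {X : topologicalType}.
Hypotheses (crX : completely_regular_space X) (hX : hausdorff_space X).

Local Notation E := (radon_prob R X).
Local Notation K := (stone_cech R X).
Local Notation C := (radon_prob R K).
Local Notation emb := (radon_embedding R X).
Let crK : completely_regular_space K := stone_cech_completely_regular.
Let hK : hausdorff_space K := @stone_cech_hausdorff R X.
Let cC : compact [set: C] := radon_compact crK hK stone_cech_compact.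

Definition extends_continuously (f : E -> R) : Prop :=
  exists2 g : C -> R, continuous g & forall m, g (emb m) = f m.

Let back (y : range emb) : E := s2val (cid2 (set_valP y)).

Let backK (y : range emb) : emb (back y) = set_val y.
Proof. exact: (s2valP' (cid2 (set_valP y))). Qed.

(** A test function on [X] extends to [K], so its integral is the restriction of a continuous
    function on [C]: the topology of E is the induced one. *)
Let back_continuous : continuous back.
Proof.
apply: radon_continuous => f bf; have [g bg gE] := stone_cech_extension bf.
rewrite (_ : (fun _ => _) = fun y : range emb => rint (set_val y) g).
  move=> y; apply: (@continuous_comp _ _ _ (set_val : range emb -> C) (fun m => rint m g)).
    exact: initial_continuous.
  exact: rint_continuous.
apply/funext => y; rewrite -backK radon_embeddingE//; congr rint.
by apply/funext => x; rewrite gE.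
Qed.

Let to_range (m : E) : range emb := SigSub (mem_set (imageT emb m)).

Let to_range_continuous : continuous to_range.
Proof.
move=> m A [_ [[D oD <-] Dm DA]].
apply: (@filterS _ (nbhs m) _ (emb @^-1` D)) => [m' Dm'|]; first exact: DA.
exact: (@radon_embedding_continuous R X m D (open_nbhs_nbhs (conj oD Dm))).
Qed.

Lemma radon_embedding_inj : injective emb.
Proof.
move=> m m' mm'; apply: (radon_ext crX hX) => f bf.
have [g bg gE] := stone_cech_extension bf.
have -> : f = fun x => g (stone_cech_unit x) by apply/funext => x; rewrite gE.
by rewrite -!radon_embeddingE// mm'.
Qed.

Lemma Cstar_embedded_extends : Cstar_embedded R (range emb) <->
  forall f : E -> R, Cb R E f -> extends_continuously f.
Proof.
split=> [CE f bf|ext f cf bf].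
  have [cf bf'] := Cb_comp back_continuous bf.
  have [g cg gE] := CE _ cf bf'; exists g => // m.
  rewrite -[emb m]/(set_val (to_range m)) gE; congr f.
  by apply: radon_embedding_inj; rewrite backK.
have [g cg gE] := ext _ (Cb_comp to_range_continuous (conj cf bf)).
exists g => // y; rewrite -backK gE; congr f.
by apply: val_inj; rewrite -[RHS]backK.
Qed.

Lemma mix_embedding t a b :
  emb (mix crX hX t a b) = mix crK hK t (emb a) (emb b).
Proof.
apply: (radon_ext crK hK) => g bg; rewrite mixE// !radon_embeddingE// mixE//.
exact: (Cb_comp (@stone_cech_unit_continuous R X)).
Qed.

(* Along the segment from [u] to [x], [f] can only increase by less than [pi]
   while [cos f] and [sin f] vary little, and the latter happens uniformly in
   [x] since both extend to a compact space. *)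
Lemma extends_pseudocompact :
  (forall f : E -> R, Cb R E f -> extends_continuously f) -> pseudocompact R E.
Proof.
move=> ext f cf; have [[u]|nE] := pselect (inhabited E); last first.
  by apply/bounded_funP; exists 0 => x; case: nE.
have bcos : Cb R E (fun m => cos (f m)).
  apply/CbP; split; last by exists 1 => m; rewrite ler_norml cos_geN1 cos_le1.
  by move=> m; apply: (@continuous_comp _ _ _ f cos); [exact: cf|exact: continuous_cos].
have bsin : Cb R E (fun m => sin (f m)).
  apply/CbP; split; last by exists 1 => m; rewrite ler_norml sin_geN1 sin_le1.
  by move=> m; apply: (@continuous_comp _ _ _ f sin); [exact: cf|exact: continuous_sin].
(* Compactness of [C] makes continuity in the parameter uniform over all endpoints [mu]. *)
have unif (g : C -> R) (t0 : R) : continuous g -> \forall t \near t0,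
    forall mu, `|g (mix crK hK t (emb u) mu) - g (mix crK hK t0 (emb u) mu)| < 2^-1.
  move=> cg.
  have cG : continuous (fun p : C * R => `|g (mix crK hK p.2 (emb u) p.1) -
      g (mix crK hK t0 (emb u) p.1)|).
    move=> p; apply: (cvg_norm (F := nbhs p)); apply: (cvgB (F := nbhs p)).
      apply: (@continuous_comp _ _ _ (fun p : C * R => mix crK hK p.2 (emb u) p.1) g); last exact: cg.
      apply: (@mix_continuous R K crK hK (C * R)%type snd (fun=> emb u) fst).
      - by move=> q; exact: cvg_snd.
      - exact: cst_continuous.
      - by move=> q; exact: cvg_fst.
    apply: (@continuous_comp _ _ _ (fun p : C * R => mix crK hK t0 (emb u) p.1) g); last exact: cg.
    apply: (@mix_continuous R K crK hK (C * R)%type (fun=> t0) (fun=> emb u) fst).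
    - exact: cst_continuous.
    - exact: cst_continuous.
    - by move=> q; exact: cvg_fst.
  have := (compact_near_coveringP [set: C]).1 cC R (nbhs t0)
    (fun t mu => `|g (mix crK hK t (emb u) mu) - g (mix crK hK t0 (emb u) mu)| < 2^-1)
    (nbhs_filter t0).
  move=> h; apply: (@filterS _ (nbhs t0) _ _ _ _ (h _)) => [t ht mu|mu _]; first exact: ht.
  apply: (cG (mu, t0) [set r | r < 2^-1]); apply: open_nbhs_nbhs; split.
    exact: open_lt.
  by rewrite /= subrr normr0 invr_gt0.
have [gc cgc gcE] := ext _ bcos; have [gs cgs gsE] := ext _ bsin.
pose phi x t := f (mix crX hX t u x).
have cphi x : continuous (phi x).
  move=> t; apply: (@continuous_comp _ _ _ (fun t => mix crX hX t u x) f); last exact: cf.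
  by apply: (@mix_continuous R X crX hX R id (fun=> u) (fun=> x)) => q;
    [exact: cvg_id|exact: cvg_cst|exact: cvg_cst].
have var t0 : \forall t \near t0, forall x, `|phi x t - phi x t0| <= pi.
  have H : \forall t \near t0, forall x,
      `|cos (phi x t) - cos (phi x t0)| < 2^-1 /\ `|sin (phi x t) - sin (phi x t0)| < 2^-1.
    apply: filterS2 (unif gc t0 cgc) (unif gs t0 cgs) => t h1 h2 x.
    have := h1 (emb x); rewrite -!mix_embedding !gcE => c1.
    have := h2 (emb x); rewrite -!mix_embedding !gsE => s1.
    exact: conj c1 s1.
  have [d /= d0 dH] := (nbhs_ballP _ _).1 H.
  apply/nbhs_ballP; exists d => // t tb x; rewrite leNgt; apply/negP => far.
  (* If the increment exceeded [pi], it would equal [pi] at some [s] between [t0] and [t]. There cos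
     and sin are negated, so doubling their absolute values at [t0] gives less than 1/2, contrary to
     the sum of their squares being 1. *)
  have [s [sb spi]] : exists s, ball t0 d s /\ `|phi x s - phi x t0| = pi.
    have cpsi : continuous (fun s => `|phi x s - phi x t0|).
      move=> s; apply: cvg_norm; apply: cvgB; [exact: cphi|exact: cvg_cst].
    have psi0 : `|phi x t0 - phi x t0| = 0 by rewrite subrr normr0.
    have [le_t|/ltW le_t] := leP t0 t.
      have [|s sI sE] := @IVT R (fun s => `|phi x s - phi x t0|) t0 t pi le_t (continuous_subspaceT cpsi).
        by rewrite psi0 ge_min pi_ge0 le_max (ltW far) orbT.
      exists s; split => //; move: tb; rewrite /ball /= => tb.
      move: sI; rewrite in_itv /= => /andP[? ?].
      by apply: le_lt_trans tb; rewrite !ler0_norm ?subr_le0//; lra.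
    have [|s sI sE] := @IVT R (fun s => `|phi x s - phi x t0|) t t0 pi le_t (continuous_subspaceT cpsi).
      by rewrite psi0 ge_min pi_ge0 orbT le_max (ltW far).
    exists s; split => //; move: tb; rewrite /ball /= => tb.
    move: sI; rewrite in_itv /= => /andP[? ?].
    by apply: le_lt_trans tb; rewrite !ger0_norm ?subr_ge0//; lra.
  have [h1 h2] := dH s sb x.
  have [cE sE] : cos (phi x s) = - cos (phi x t0) /\ sin (phi x s) = - sin (phi x t0).
    have [h|h] : phi x s = phi x t0 + pi \/ phi x s = phi x t0 - pi.
      by move: spi; case: ger0P => _ spi; [left|right]; rewrite -spi; ring.
      by rewrite h cosDpi sinDpi.
    have -> : phi x t0 = phi x s + pi by rewrite h subrK.
    by rewrite cosDpi sinDpi !opprK.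
  move: h1 h2; rewrite cE sE; have := cos2Dsin2 (phi x t0).
  set c := cos _; set q := sin _; rewrite !expr2 !ltr_norml.
  move=> h /andP[? ?] /andP[? ?]; nra.
(* At time 0 all segments are at [u], at time 1 they are at their endpoints. By [var] this set of
   times is open and closed, so boundedness travels along the unit interval. *)
pose S := [set t : R | exists M, forall x, `|phi x t| <= M].
have locS t0 : \forall t \near t0, S t <-> S t0.
  apply: filterS (var t0) => t h; split=> -[M hM]; exists (M + pi) => x.
    have -> : phi x t0 = phi x t - (phi x t - phi x t0) by rewrite opprB addrC subrK.
    by rewrite (le_trans (ler_normB _ _))// lerD.
  have -> : phi x t = phi x t0 + (phi x t - phi x t0) by rewrite addrC subrK.
  by rewrite (le_trans (ler_normD _ _))// lerD.
have oS : open S.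
  by rewrite openE => t St; apply: filterS (locS t) => s h; exact/h.
have cS : closed S.
  rewrite -[S]setCK; apply: open_closedC.
  by rewrite openE => t nSt; apply: filterS (locS t) => s h /= /h.
have SE : `[0, 1]%classic `&` S = `[0, 1]%classic.
  apply: (@segment_connected R 0 1).
  - exists 0; split; first by rewrite /= in_itv /= lexx ler01.
    by exists `|f u| => x; rewrite /phi mix0.
  - by exists S.
  - by exists S.
have [M hM] : S 1.
  have : (`[0, 1]%classic `&` S) 1 by rewrite SE /= in_itv /= lexx ler01.
  by case.
apply/bounded_funP; exists M => x; have := hM x; by rewrite /phi mix1.
Qed.

Lemma beta_radon_extends : beta_radon_eq R X ->
  forall f : E -> R, Cb R E f -> extends_continuously f.
Proof.
move=> [h [_ [g [cg hg _]]] hE] f bf.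
pose i : Cb R E := SigSub (mem_set bf).
exists (fun mu => set_val (g mu) i).
  move=> mu; apply: (@continuous_comp _ _ _ g (fun z => set_val z i)); first exact: cg.
  exact: stone_cech_proj_continuous.
by move=> m; rewrite -hE hg.
Qed.

(** The inverse [k] is built first, with the extensions as coordinates. It is injective because
    integrals of functions on [K] are among the coordinates, onto because its image is closed and
    dense, and closed by compactness; this makes [h] continuous. *)
Lemma extends_beta_radon :
  (forall f : E -> R, Cb R E f -> extends_continuously f) -> beta_radon_eq R X.
Proof.
move=> ext.
have /choice[F FP] : forall i : Cb R E, exists g : C -> R, continuous g /\
    forall m, g (emb m) = (set_val i : E -> R) m.
  by move=> i; have [g cg gE] := ext _ (set_valP i); exists g.
pose kk (mu : C) : {ptws Cb R E -> R} := fun i => F i mu.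
have ckk : continuous kk.
  move=> mu; have FF : Filter (kk @ mu) by apply: fmap_filter; exact: nbhs_filter.
  apply/cvg_sup => i A [_ [[B oB <-] Bx BA]].
  apply: (@filterS _ (nbhs mu) _ (F i @^-1` B)) => [nu Bnu|]; first exact: BA.
  exact: ((FP i).1 mu B (open_nbhs_nbhs (conj oB Bx))).
have kkE m : kk (emb m) = evaluation m by apply/funext => i; exact: (FP i).2.
have kkC mu : closure (range (@evaluation R E)) (kk mu).
  move=> A nA; have [m Am] := radon_embedding_dense crX hX (ckk mu A nA).
  by exists (kk (emb m)); split => //; rewrite kkE; exists m.
pose k (mu : C) : stone_cech R E := SigSub (mem_set (kkC mu)).
have ck : continuous k.
  move=> mu A [_ [[D oD <-] Dm DA]].
  apply: (@filterS _ (nbhs mu) _ (kk @^-1` D)) => [nu Dnu|]; first exact: DA.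
  exact: (ckk mu D (open_nbhs_nbhs (conj oD Dm))).
have kE m : k (emb m) = stone_cech_unit m by apply: val_inj; exact: kkE.
have kinj : injective k.
  move=> mu nu /(congr1 set_val) /= kmn; apply: (radon_ext crK hK) => g bg.
  have bF : Cb R E (fun m => rint (emb m) g).
    apply: (@Cb_comp R E C emb (fun mu => rint mu g)); first exact: radon_embedding_continuous.
    split; first exact: rint_continuous.
    apply/bounded_funP; have [M _ gM] := Cb_ex bg; exists M => m.
    exact: (state_norm_le (rint_tight m)).
  pose i : Cb R E := SigSub (mem_set bF).
  have FE : F i =1 (fun mu => rint mu g).
    move=> la; apply: (@Rhausdorff R) => A B nA nB.
    have nAB : nbhs la (F i @^-1` A `&` (fun mu => rint mu g) @^-1` B).
      by apply: filterI; [exact: ((FP i).1 la)|exact: (rint_continuous bg)].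
    have [m [Am Bm]] := radon_embedding_dense crX hX nAB.
    by exists (F i (emb m)); split => //; rewrite (FP i).2.
  by rewrite -!FE; exact: (congr1 (fun h => h i) kmn).
have compact_k (D : set C) : closed D -> closed (k @` D).
  move=> cD; apply: compact_closed; first exact: stone_cech_hausdorff.
  apply: continuous_compact; first exact: continuous_subspaceT.
  by apply: subclosed_compact cD cC _.
have ksurj z : exists mu, k mu = z.
  apply: contrapT => nz.
  have nA : nbhs z (~` (k @` setT)).
    apply: open_nbhs_nbhs; split; last by move=> [mu _ kz]; apply: nz; exists mu.
    by apply: closed_openC; apply: compact_k; exact: closedT.
  by have [m] := stone_cech_dense nA; apply; exists (emb m).
have /choice[h hP] := ksurj.
have hk : cancel k h by move=> mu; apply: kinj; rewrite hP.
exists h; last by move=> m; rewrite -kE hk.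
split; last by exists k; split.
apply/continuous_closedP => D cD.
rewrite (_ : h @^-1` D = k @` D); first exact: compact_k.
apply/seteqP; split => [z Dz|_ [mu Dmu <-]] /=; last by rewrite hk.
by exists (h z).
Qed.

End embedding.

Theorem theorem1p9 (R : realType) (X : topologicalType) :
  tychonoff_space X ->
  [/\ Cstar_embedded R (range (radon_embedding R X)) <->
        pseudocompact R (radon_prob R X),
      Cstar_embedded R (range (radon_embedding R X)) <-> beta_radon_eq R X
    & pseudocompact R (radon_prob R X) ->
        forall n : nat, pseudocompact R {ptws 'I_n -> X}].
Proof.
move=> [crX hX]; have ext := Cstar_embedded_extends crX hX.
split.
- split=> [/ext /extends_pseudocompact|pX]; first exact.
  by apply/ext => f [cf _]; exact: radon_extension.
- split=> [/ext|]; first exact: extends_beta_radon.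
  by move=> bE; apply/ext => f bf; exact: beta_radon_extends bE f bf.
(* The empty power is a single point and is treated apart, since averaging marginals requires at
   least one coordinate. *)
- move=> pX [|n].
    move=> f _; apply/bounded_funP.
    pose x0 (i : 'I_0) : X := False_rect X (notF (ltn_ord i)).
    exists `|f x0| => x; have -> // : x = x0.
    by apply/funext => -[].
  apply: open_cluster_pseudocompact; apply: (power_open_cluster crX hX pX).
  by rewrite card_ord.
Qed.
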